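(* Let $P$ be a $2$-point homogeneous non-degenerate convex polyhedron in $\mathbb{R}^3$. Then one of the following properties holds: 1) $P$ is a regular polyhedron (tetrahedron, cube, octahedron, dodecahedron, or icosahedron); 2) $P$ is a cuboctahedron; 3) $P$ is a homogeneous tetrahedron with four pairwise isometric faces that are acute triangles; 4) $P$ is a right prism over a regular $n$-gon, $n\geq 3$, such that the set of distances between vertices of $P$ from a fixed base has empty intersection with the set of distances between vertices of $P$ from distinct bases; 5) $P$ is a right antiprism over a regular $n$-gon, $n\geq 2$, such that the set of distances between vertices of $P$ from a fixed base has empty intersection with the set of distances between vertices of $P$ from distinct bases; 6) $P$ is a rectangular parallelepiped of size $a\times b\times c$, where $a\leq b\leq c$ and $a^2+b^2\neq c^2$.
   Context: All polytopes are convex. A metric space $(M,d)$ is $m$-point homogeneous ($m\in\mathbb{N}$) if for every two $m$-tuples $(A_1,\dots,A_m)$, $(B_1,\dots,B_m)$ of elements of $M$ with $d(A_i,A_j)=d(B_i,B_j)$ for all $i,j=1,\dots,m$, there is an isometry $f$ of $(M,d)$ onto itself with $f(A_i)=B_i$ for all $i$. A convex polytope is $m$-point homogeneous if its vertex set, with the metric $d$ induced from Euclidean space, is $m$-point homogeneous; homogeneous means $1$-point homogeneous (equivalently, the symmetry group acts transitively on the vertices). A polyhedron in $\mathbb{R}^3$ is non-degenerate if it has non-empty interior. The cuboctahedron is, up to similarity, the convex hull of all points of $\mathbb{R}^3$ with exactly one coordinate equal to $0$ and the other two equal to $\pm1$. A right prism over a regular $n$-gon ($n\ge 3$) is a polyhedron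 isometric to $Q\times[0,c]$, where $Q\subset\mathbb{R}^2$ is a regular $n$-gon and $c>0$; its bases are the two faces corresponding to $Q\times\{0\}$ and $Q\times\{c\}$. A right antiprism over a regular $n$-gon ($n\ge 2$, where a regular $2$-gon is understood to be a segment) is the convex hull of two congruent regular $n$-gons (its bases) lying in two distinct parallel planes, whose centers lie on a common line perpendicular to these planes, and which are twisted by the angle $\pi/n$ relative to each other; its other $2n$ (lateral) faces are isosceles triangles. For $n=2$ the bases are two segments and the antiprism is a tetrahedron. *)

(* Defs.v *)
From mathcomp Require Export all_boot all_order all_algebra.
From mathcomp Require Export all_classical all_reals all_analysis.
Export Order.TTheory GRing.Theory Num.Theory numFieldNormedType.Exports.

Set Implicit Arguments.
Unset Strict Implicit.
Unset Printing Implicit Defensive.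

Local Open Scope classical_set_scope.
Local Open Scope ring_scope.

(* Points of R^n are row vectors 'rV[R]_n. The library norm `|x| on 'rV[R]_n is
   the sup norm, so the Euclidean norm and distance are defined here; they
   induce the same topology. *)

Section Euclidean.
Variables (R : realType) (n : nat).
Implicit Types (x y u v : 'rV[R]_n) (A S P : set 'rV[R]_n).

Definition dot u v : R := \sum_(i < n) u 0 i * v 0 i.
Definition enorm u : R := Num.sqrt (dot u u).
Definition edist x y : R := enorm (x - y).

(* The angle at x of the triangle x y z. *)
Definition angle x y z : R :=
  acos (dot (y - x) (z - x) / (enorm (y - x) * enorm (z - x))).

Definition conv_hull S : set 'rV[R]_n := smallest (@convex_set R 'rV[R]_n) S.

Definition polytope P := exists2 S, finite_set S & P = conv_hull S.

(* For a polytope the vertices are exactly the extreme points. *)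
Definition vertices P : set 'rV[R]_n :=
  [set x | P x /\ forall y z (t : R), P y -> P z -> 0 < t < 1 ->
             x = t *: y + (1 - t) *: z -> y = x /\ z = x].

Definition affinely_independent k (p : 'I_k.+1 -> 'rV[R]_n) : bool :=
  row_free (\matrix_(i < k) (p (lift ord0 i) - p ord0)).

Definition dist_set A S : set R := [set edist x y | x in A & y in S].

End Euclidean.

Section Maps.
Variable R : realType.

Definition isometry m n (A : set 'rV[R]_m) (B : set 'rV[R]_n)
    (f : 'rV[R]_m -> 'rV[R]_n) :=
  set_bij A B f /\
  forall x y, A x -> A y -> edist (f x) (f y) = edist x y.

Definition isometric m n (A : set 'rV[R]_m) (B : set 'rV[R]_n) :=
  exists f, isometry A B f.

Definition similar m n (A : set 'rV[R]_m) (B : set 'rV[R]_n) :=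
  exists (k : R) (f : 'rV[R]_m -> 'rV[R]_n), [/\ 0 < k, set_bij A B f &
    forall x y, A x -> A y -> edist (f x) (f y) = k * edist x y].

(* Here V is the metric space with the Euclidean distance. *)
Definition point_homogeneous_space m n (V : set 'rV[R]_n) :=
  forall A B : 'I_m -> 'rV[R]_n,
    (forall i, V (A i)) -> (forall i, V (B i)) ->
    (forall i j, edist (A i) (A j) = edist (B i) (B j)) ->
    exists2 f, isometry V V f & forall i, f (A i) = B i.

Definition point_homogeneous m n (P : set 'rV[R]_n) :=
  point_homogeneous_space m (vertices P).

Definition homogeneous n (P : set 'rV[R]_n) := point_homogeneous 1 P.

End Maps.

Section RegularPolygons.
Variables (R : realType) (n : nat).
Implicit Types o u v : 'rV[R]_n.

Definition orthonormal2 u v := [/\ dot u u = 1, dot v v = 1 & dot u v = 0].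

(* The N-gon of center o and circumradius r in the plane o + <u, v>, rotated
   by the angle phi; for N = 2 it is a segment. *)
Definition ngon (N : nat) o u v (r phi : R) : set 'rV[R]_n :=
  conv_hull (range (fun k : 'I_N =>
    let t := phi + 2 * pi * k%:R / N%:R in
    o + (r * cos t) *: u + (r * sin t) *: v)).

Definition regular_ngon (N : nat) (Q : set 'rV[R]_n) :=
  exists o u v (r : R),
    [/\ orthonormal2 u v, 0 < r & Q = ngon N o u v r 0].

End RegularPolygons.

Section Polyhedra.
Variable R : realType.
Implicit Types P F B : set 'rV[R]_3.

Definition nondegenerate_polyhedron P := polytope P /\ interior P !=set0.

(* A two-dimensional face, i.e. the intersection of P with a supporting plane
   that contains three non-collinear points. *)
Definition facet P F :=
  (exists (u : 'rV[R]_3) (b : R),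
     [/\ u != 0, forall x, P x -> dot u x <= b
       & F = [set x | P x /\ dot u x = b]]) /\
  (exists p : 'I_3 -> 'rV[R]_3,
     affinely_independent p /\ forall i, F (p i)).

(* The inductive definition of regular polytopes, in dimension 3. *)
Definition regular_polyhedron P :=
  [/\ nondegenerate_polyhedron P, homogeneous P,
      forall F, facet P F -> exists N, (3 <= N)%N /\ regular_ngon N F
    & forall F G, facet P F -> facet P G -> isometric F G].

(* The five regular polyhedra are named after their numbers of faces. *)
Definition has_facets P (k : nat) :=
  ([set F | facet P F] #= `I_k)%card.

Definition regular_tetrahedron P := regular_polyhedron P /\ has_facets P 4.
Definition cube P := regular_polyhedron P /\ has_facets P 6.
Definition regular_octahedron P := regular_polyhedron P /\ has_facets P 8.
Definition regular_dodecahedron P := regular_polyhedron P /\ has_facets P 12.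
Definition regular_icosahedron P := regular_polyhedron P /\ has_facets P 20.

Definition cuboctahedron P :=
  similar P (conv_hull [set x : 'rV[R]_3 | exists i, x 0 i = 0 /\
                     forall j, j != i -> x 0 j = 1 \/ x 0 j = - 1]).

Definition tetrahedron P :=
  exists p : 'I_4 -> 'rV[R]_3, affinely_independent p /\ P = conv_hull (range p).

Definition acute_triangle F :=
  exists p : 'I_3 -> 'rV[R]_3,
    [/\ affinely_independent p, F = conv_hull (range p)
      & forall i j k, i != j -> i != k -> j != k ->
          angle (p i) (p j) (p k) < pi / 2].

Definition at_height (t : R) (Q : set 'rV[R]_2) : set 'rV[R]_3 :=
  [set (row_mx q (const_mx t) : 'rV[R]_(2 + 1)) | q in Q].

Definition right_prism (N : nat) P (B0 B1 : set 'rV[R]_3) :=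
  exists (Q : set 'rV[R]_2) (c : R) (f : 'rV[R]_3 -> 'rV[R]_3),
    [/\ regular_ngon N Q, 0 < c,
        isometry (\bigcup_(t in `[0, c]) at_height t Q) P f,
        B0 = f @` at_height 0 Q & B1 = f @` at_height c Q].

(* The planes of the two bases are orthogonal to w and the line of centers is directed by w. *)
Definition right_antiprism (N : nat) P (B0 B1 : set 'rV[R]_3) :=
  exists (o u v w : 'rV[R]_3) (r h : R),
    [/\ [/\ orthonormal2 u v, dot w w = 1, dot u w = 0 & dot v w = 0],
        0 < r /\ 0 < h,
        B0 = ngon N o u v r 0,
        B1 = ngon N (o + h *: w) u v r (pi / N%:R)
      & P = conv_hull (B0 `|` B1)].

(* The distance 0 from a vertex to itself is harmless in the first set, since
   the bases are disjoint. *)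
Definition base_distances_disjoint P (B0 B1 : set 'rV[R]_3) :=
  let V0 := vertices P `&` B0 in
  let V1 := vertices P `&` B1 in
  (dist_set V0 V0 `|` dist_set V1 V1) `&` dist_set V0 V1 = set0.

Definition box (a b c : R) : set 'rV[R]_3 :=
  [set x | forall i : 'I_3, 0 <= x 0 i <= [:: a; b; c]`_i].

Definition rectangular_parallelepiped (a b c : R) P :=
  [/\ 0 < a, 0 < b, 0 < c & isometric P (box a b c)].

End Polyhedra.

(* Main.v *)
Require Import Defs.
From mathcomp Require Import ring lra.

(** Centring and scaling turn the vertices into a set W of unit vectors with sum
    0, in which pairs with equal inner products are exchanged by orthogonal
    symmetries of W.

    If the stabilizer of some vertex fixes a vector not parallel to that vertex,
    then transporting this vector along W gives a non-scalar symmetric operator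
    commuting with all symmetries, so the symmetries preserve a line and W lies on
    two parallel circles at opposite heights (or has four points).  A symmetry
    fixing a vertex also fixes its height, hence no distance occurs both within a
    circle and between the circles.  If a vertex has two nearest neighbours on its
    circle, the circles carry regular polygons, reflection symmetry fixes their
    mutual position, and W is a prism or an antiprism; if it has only one, the
    symmetry group is an elementary abelian 2-group and W is a box.

    Otherwise the k nearest neighbours of a vertex v sum to a multiple of v, and
    k <= 5 by packing.  The values 1 and 2 are impossible, and reflecting
    neighbours in the bisecting plane of an edge produces enough further vertices
    to force the tetrahedron, cube or dodecahedron (k = 3), the octahedron or
    cuboctahedron (k = 4), or the icosahedron (k = 5); there is no room for
    another vertex since the known ones have too small a covering radius. *)

Set Implicit Arguments.
Unset Strict Implicit.
Unset Printing Implicit Defensive.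

Local Open Scope classical_set_scope.
Local Open Scope ring_scope.

(** * Vectors and orthogonal matrices *)

Section DotProduct.
Variables (R : realType) (n : nat).
Implicit Types (u v w : 'rV[R]_n) (A : 'M[R]_n).

(** The dichotomy is chosen because each side yields linear information. A fixed vector off the line
    of [v] defines an equivariant linear map; a real operator of odd size has an eigenvalue, and the
    kernel or the image of the shifted operator is the invariant line. In the opposite case every
    vector built symmetrically around [v] is a multiple of [v], which turns the nearest neighbours
    into a few equations in their common inner product [c]. The remaining input is metric: a
    reflected or transported vertex too close to a known one must coincide with it, and this pins
    [c] down. A single neighbour would be shorter than a unit vector; with two neighbours each, the
    vertices would lie on great circles, and any two of these cross where there is no room for both.

    The conclusions speak of facets, whereas the argument produces vertices. For the octahedron,
    dodecahedron and icosahedron this gap is closed by listing the facet normals, which are the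
    vertices of the dual solid. The regular tetrahedron and the cube need none of this, since they
    also fall under the tetrahedra and the boxes. *)

Lemma dotE u v : dot u v = (u *m v^T) 0 0.
Proof. by rewrite /dot mxE; apply: eq_bigr => i _; rewrite mxE. Qed.

Lemma dotC u v : dot u v = dot v u.
Proof. by apply: eq_bigr => i _; rewrite mulrC. Qed.

Lemma dotDl u v w : dot (u + v) w = dot u w + dot v w.
Proof. by rewrite !dotE mulmxDl mxE. Qed.

Lemma dotDr u v w : dot w (u + v) = dot w u + dot w v.
Proof. by rewrite dotC dotDl !(dotC w). Qed.

Lemma dotZl (a : R) u v : dot (a *: u) v = a * dot u v.
Proof. by rewrite !dotE -scalemxAl mxE. Qed.

Lemma dotZr (a : R) u v : dot u (a *: v) = a * dot u v.
Proof. by rewrite dotC dotZl dotC. Qed.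

Lemma dotNl u v : dot (- u) v = - dot u v.
Proof. by rewrite -scaleN1r dotZl mulN1r. Qed.

Lemma dotNr u v : dot u (- v) = - dot u v.
Proof. by rewrite dotC dotNl dotC. Qed.

Lemma dot0l u : dot 0 u = 0.
Proof. by rewrite -[0](scale0r u) dotZl mul0r. Qed.

Lemma dot0r u : dot u 0 = 0.
Proof. by rewrite dotC dot0l. Qed.

Lemma dot_suml (I : Type) (s : seq I) (F : I -> 'rV[R]_n) u :
  dot (\sum_(i <- s) F i) u = \sum_(i <- s) dot (F i) u.
Proof.
by elim/big_rec2: _ => [|i y x _ <-]; rewrite ?dot0l // dotDl.
Qed.

Lemma dot_sumr (I : Type) (s : seq I) (F : I -> 'rV[R]_n) u :
  dot u (\sum_(i <- s) F i) = \sum_(i <- s) dot u (F i).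
Proof. by rewrite dotC dot_suml; apply: eq_bigr => i _; rewrite dotC. Qed.

Lemma dot_ge0 u : 0 <= dot u u.
Proof. by apply: sumr_ge0 => i _; rewrite -expr2 sqr_ge0. Qed.

Lemma dot_eq0 u : (dot u u == 0) = (u == 0).
Proof.
apply/eqP/eqP => [u0|->]; last by rewrite dot0l.
apply/rowP => i; rewrite mxE; apply/eqP; rewrite -sqrf_eq0 expr2; apply/eqP.
by apply: (psumr_eq0P _ u0) => // j _; rewrite -expr2 sqr_ge0.
Qed.

Lemma dot_gt0 u : (0 < dot u u) = (u != 0).
Proof. by rewrite lt_def dot_ge0 dot_eq0 andbT. Qed.

Definition dotL := (dotDl, dotDr, dotZl, dotZr, dotNl, dotNr, dot0l, dot0r).

Lemma dotB u v : dot (u - v) (u - v) = dot u u + dot v v - 2 * dot u v.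
Proof. by rewrite !dotL (dotC v u); ring. Qed.

Lemma eq_dotB u v : dot (u - v) (u - v) = 0 -> u = v.
Proof. by move/eqP; rewrite dot_eq0 subr_eq0 => /eqP. Qed.

Lemma edistE u v : edist u v = Num.sqrt (dot (u - v) (u - v)).
Proof. by []. Qed.

Lemma edist_eq u v u' v' :
  edist u v = edist u' v' <-> dot (u - v) (u - v) = dot (u' - v') (u' - v').
Proof.
split=> [|e]; last by rewrite !edistE e.
move=> /(congr1 (fun x => x ^+ 2)).
by rewrite !edistE !sqr_sqrtr ?dot_ge0.
Qed.

Definition orthogonal A := A *m A^T = 1%:M.

Lemma dot_orth A u v : orthogonal A -> dot (u *m A) (v *m A) = dot u v.
Proof. by move=> oA; rewrite !dotE trmx_mul mulmxA -(mulmxA u) oA mulmx1. Qed.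

Lemma orthV A : orthogonal A -> A^T *m A = 1%:M.
Proof. exact: mulmx1C. Qed.

Lemma orth_tr A : orthogonal A -> orthogonal A^T.
Proof. by move=> /orthV; rewrite /orthogonal trmxK. Qed.

Lemma orth_mul A B : orthogonal A -> orthogonal B -> orthogonal (A *m B).
Proof.
by move=> oA oB; rewrite /orthogonal trmx_mul mulmxA -(mulmxA A) oB mulmx1.
Qed.

Lemma orthK A u : orthogonal A -> u *m A *m A^T = u.
Proof. by move=> oA; rewrite -mulmxA oA mulmx1. Qed.

Lemma orthVK A u : orthogonal A -> u *m A^T *m A = u.
Proof. by move=> /orthV oA; rewrite -mulmxA oA mulmx1. Qed.

Lemma orth_inj A : orthogonal A -> injective (fun u => u *m A).
Proof. by move=> oA u v /= /(congr1 (mulmx^~ A^T)); rewrite !orthK. Qed.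

Lemma dot_mxl A u v : dot (u *m A) v = dot u (v *m A^T).
Proof. by rewrite !dotE trmx_mul trmxK mulmxA. Qed.

Lemma unit_dot_le1 u v : dot u u = 1 -> dot v v = 1 -> dot u v <= 1.
Proof. by move=> uu vv; have := dot_ge0 (u - v); rewrite dotB uu vv; lra. Qed.

Lemma unit_dot_eq1 u v : dot u u = 1 -> dot v v = 1 -> dot u v = 1 -> u = v.
Proof. by move=> uu vv uv; apply: eq_dotB; rewrite dotB uu vv uv; lra. Qed.

Lemma unit_dot_lt1 u v : dot u u = 1 -> dot v v = 1 -> u != v -> dot u v < 1.
Proof.
move=> uu vv /eqP uv; rewrite lt_neqAle unit_dot_le1 // andbT.
by apply/eqP => /(unit_dot_eq1 uu vv).
Qed.

End DotProduct.

(** * Cross products and Gram determinants in dimension three *)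

Section Space.
Variable R : realType.
Implicit Types (u v w x y z : 'rV[R]_3).

Definition vec (a b c : R) : 'rV[R]_3 := \row_i [:: a; b; c]`_i.

Lemma vecE u : u = vec (u 0 0) (u 0 1) (u 0 2).
Proof.
apply/rowP => i; rewrite mxE; case: i => -[|[|[|]]] //= lt; congr (u _ _);
exact: val_inj.
Qed.

Lemma vec_eq a b c a' b' c' : a = a' -> b = b' -> c = c' ->
  vec a b c = vec a' b' c'.
Proof. by move=> -> -> ->. Qed.

Lemma vec_inj a b c a' b' c' : vec a b c = vec a' b' c' ->
  [/\ a = a', b = b' & c = c'].
Proof.
move=> /rowP e; split; [have := e 0 | have := e 1 | have := e 2];
by rewrite !mxE /=.
Qed.

Lemma vecD a b c a' b' c' :
  vec a b c + vec a' b' c' = vec (a + a') (b + b') (c + c').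
Proof. by apply/rowP => i; rewrite !mxE; case: i => -[|[|[|]]]. Qed.

Lemma vecZ k a b c : k *: vec a b c = vec (k * a) (k * b) (k * c).
Proof. by apply/rowP => i; rewrite !mxE; case: i => -[|[|[|]]]. Qed.

Lemma vecN a b c : - vec a b c = vec (- a) (- b) (- c).
Proof. by apply/rowP => i; rewrite !mxE; case: i => -[|[|[|]]]. Qed.

Lemma vec0 : vec 0 0 0 = 0.
Proof. by apply/rowP => i; rewrite !mxE; case: i => -[|[|[|]]]. Qed.

Definition vecL := (vecN, vecZ, vecD).

Lemma sum3E (F : 'I_3 -> R) : \sum_i F i = F 0 + F 1 + F 2.
Proof.
rewrite !big_ord_recl big_ord0 addr0 addrA.
by congr (_ + _ + _); congr F; apply: val_inj.
Qed.

Lemma dot3 u v : dot u v = u 0 0 * v 0 0 + u 0 1 * v 0 1 + u 0 2 * v 0 2.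
Proof. exact: sum3E. Qed.

Lemma dot_vec a b c a' b' c' :
  dot (vec a b c) (vec a' b' c') = a * a' + b * b' + c * c'.
Proof. by rewrite dot3 !mxE. Qed.

Definition cross u v := vec (u 0 1 * v 0 2 - u 0 2 * v 0 1)
  (u 0 2 * v 0 0 - u 0 0 * v 0 2) (u 0 0 * v 0 1 - u 0 1 * v 0 0).

Lemma cross_vec a b c a' b' c' : cross (vec a b c) (vec a' b' c') =
  vec (b * c' - c * b') (c * a' - a * c') (a * b' - b * a').
Proof. by rewrite /cross !mxE. Qed.

Lemma dot_crossl u v : dot (cross u v) u = 0.
Proof.
by rewrite (vecE u) (vecE v) cross_vec dot_vec; ring.
Qed.

Lemma dot_crossr u v : dot (cross u v) v = 0.
Proof.
by rewrite (vecE u) (vecE v) cross_vec dot_vec; ring.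
Qed.

Lemma dot_cross2 u v :
  dot (cross u v) (cross u v) = dot u u * dot v v - dot u v ^+ 2.
Proof.
by rewrite (vecE u) (vecE v) cross_vec !dot_vec; ring.
Qed.

(** The square of a triple product is the Gram determinant of the three vectors. *)
Lemma gram3 y u v : dot y (cross u v) ^+ 2 =
  dot y y * dot u u * dot v v + 2 * (dot y u * dot u v * dot y v)
  - dot y y * dot u v ^+ 2 - dot u u * dot y v ^+ 2 - dot v v * dot y u ^+ 2.
Proof.
by rewrite (vecE u) (vecE v) (vecE y) cross_vec !dot_vec; ring.
Qed.

(** Expansion of [y] along [cross u v] and along the dual basis of the plane of [u] and [v],
    multiplied by the Gram determinant so that no division occurs. *)
Lemma cross_decomp y u v : dot (cross u v) (cross u v) *: y =
  dot y (cross u v) *: cross u v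
  + dot y u *: (dot v v *: u - dot u v *: v)
  + dot y v *: (dot u u *: v - dot u v *: u).
Proof.
rewrite (vecE u) (vecE v) (vecE y) cross_vec !dot_vec !vecL.
by apply: vec_eq; ring.
Qed.

Lemma eq_of_dots u v y z : cross u v != 0 -> dot y u = dot z u ->
  dot y v = dot z v -> dot y (cross u v) = dot z (cross u v) -> y = z.
Proof.
rewrite -dot_eq0 => n0 eu ev en.
by apply: (scalerI n0); rewrite !cross_decomp eu ev en.
Qed.

Lemma cross_unit_neq0 u v : dot u u = 1 -> dot v v = 1 ->
  -1 < dot u v < 1 -> cross u v != 0.
Proof.
move=> uu vv /andP[l1 l2]; rewrite -dot_gt0 dot_cross2 uu vv.
have : 0 < (1 - dot u v) * (1 + dot u v) by apply: mulr_gt0; lra.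
by lra.
Qed.

(** By [gram3], the norm of a vector and its products with [u] and [v] determine the square of the
    triple product. *)
Lemma dot_cross_sqr_eq u v y z : dot y y = dot z z ->
  dot y u = dot z u -> dot y v = dot z v ->
  dot y (cross u v) = dot z (cross u v) \/
  dot y (cross u v) = - dot z (cross u v).
Proof.
move=> yz yu yv.
have /eqP : dot y (cross u v) ^+ 2 = dot z (cross u v) ^+ 2.
  by rewrite !gram3 yz yu yv.
by rewrite eqf_sqr => /orP[] /eqP; [left | right].
Qed.

(* The conditions on u and v define a line, which meets a sphere at most twice. *)
Lemma two_solutions u v x y z : cross u v != 0 -> x != y ->
  dot x x = dot y y -> dot x u = dot y u -> dot x v = dot y v ->
  dot z z = dot y y -> dot z u = dot y u -> dot z v = dot y v ->
  z = x \/ z = y.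
Proof.
move=> n0 /eqP xy ex eu ev zy zu zv.
have [e|e] := dot_cross_sqr_eq zy zu zv.
  by right; apply: (eq_of_dots n0).
have [f|f] := dot_cross_sqr_eq ex eu ev.
  by case: xy; apply: (eq_of_dots n0).
by left; apply: (eq_of_dots n0); rewrite ?zu ?zv ?e ?f.
Qed.

End Space.

(** * Two-point homogeneous sets of unit vectors *)

Section Eigen.
Variable R : realType.

(** A monic cubic changes sign: [K] exceeds the sum of the absolute values of the lower coefficients
    by 1, which lets the cubic term dominate at [- K] and [K]. *)
Lemma char_root3 (M : 'M[R]_3) : exists a, root (char_poly M) a.
Proof.
set p := char_poly M.
have sp : size p = 4 by rewrite size_char_poly.
have lp : p`_3 = 1.
  by have /monicP := char_poly_monic M; rewrite /lead_coef sp.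
have pE x : p.[x] = x ^+ 3 + p`_2 * x ^+ 2 + p`_1 * x + p`_0.
  by rewrite horner_coef sp !big_ord_recr big_ord0 /= lp; ring.
pose K := 1 + `|p`_0| + `|p`_1| + `|p`_2|.
have n0 := normr_ge0 p`_0; have n1 := normr_ge0 p`_1; have n2 := normr_ge0 p`_2.
have /andP[a0 b0] : - `|p`_0| <= p`_0 <= `|p`_0| by rewrite -ler_norml.
have /andP[a1 b1] : - `|p`_1| <= p`_1 <= `|p`_1| by rewrite -ler_norml.
have /andP[a2 b2] : - `|p`_2| <= p`_2 <= `|p`_2| by rewrite -ler_norml.
have K1 : 1 <= K by rewrite /K; lra.
have K2 : K <= K ^+ 2 by rewrite expr2 ler_peMr //; lra.
have e3 : K ^+ 3 = K ^+ 2 + `|p`_0| * K ^+ 2 + `|p`_1| * K ^+ 2 + `|p`_2| * K ^+ 2.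
  by rewrite (exprS K 2) {1}/K; ring.
have i0 : `|p`_0| <= `|p`_0| * K ^+ 2 by rewrite ler_peMr //; lra.
have i1 : `|p`_1| * K <= `|p`_1| * K ^+ 2 by rewrite ler_wpM2l.
have j1 : - (`|p`_1| * K) <= p`_1 * K <= `|p`_1| * K.
  by rewrite -mulNr !ler_wpM2r //; lra.
have j2 : - (`|p`_2| * K ^+ 2) <= p`_2 * K ^+ 2 <= `|p`_2| * K ^+ 2.
  by rewrite -mulNr !ler_wpM2r ?sqr_ge0.
suff h : p.[- K] <= 0 <= p.[K].
  have KK : - K <= K by lra.
  by have [x _ rx] := poly_ivt KK h; exists x.
move: j1 j2 => /andP[j1 j1'] /andP[j2 j2'].
have K20 : 0 <= K ^+ 2 by rewrite sqr_ge0.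
rewrite !pE; apply/andP; split.
  have -> : (- K) ^+ 3 = - K ^+ 3 by ring.
  have -> : (- K) ^+ 2 = K ^+ 2 by ring.
  by rewrite mulrN; lra.
by lra.
Qed.

Lemma rank1_generator n (K : 'M[R]_n) : \rank K = 1%N ->
  exists2 a : 'rV[R]_n, a != 0 & forall u, (u <= K)%MS -> exists k, u = k *: a.
Proof.
move=> rK; exists (nz_row K).
  by rewrite nz_row_eq0; apply: contra_eq_neq rK => ->; rewrite mxrank0.
have n0 : nz_row K != 0.
  by rewrite nz_row_eq0; apply: contra_eq_neq rK => ->; rewrite mxrank0.
have sK := nz_row_sub K.
have [_] := mxrank_leqif_eq sK.
rewrite rK rank_rV n0 eqxx => /esym/andP[_ Ka] u uK.
by apply/sub_rVP/(submx_trans uK).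
Qed.

(** For an eigenvalue [l], the row space and the kernel of [L - l] are both invariant under
    everything commuting with [L]. Their dimensions are positive and add up to 3, so one of them is
    a line. *)
Lemma common_eigenvector (L : 'M[R]_3) (G : 'M[R]_3 -> Prop) :
  L^T = L -> (forall k, L != k%:M) -> (forall A, G A -> L *m A = A *m L) ->
  exists2 a : 'rV[R]_3, a != 0 & forall A, G A -> exists k, a *m A = k *: a.
Proof.
move=> sL nL cL.
have [l rl] := char_root3 L.
pose B := L - l%:M.
have cB A : G A -> B *m A = A *m B.
  by move=> /cL e; rewrite /B mulmxBl mulmxBr e scalar_mxC.
have B0 : B != 0 by rewrite subr_eq0.
have kB : kermx B != 0.
  move: rl; rewrite -eigenvalue_root_char => /eigenvalueP[v ev v0].
  apply: contra_neq v0 => k0; apply/eqP; rewrite -submx0 -k0.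
  by apply/sub_kermxP; rewrite /B mulmxBr ev mul_mx_scalar subrr.
have rB : (0 < \rank B)%N by rewrite lt0n mxrank_eq0.
have rK : (0 < \rank (kermx B))%N by rewrite lt0n mxrank_eq0.
have /orP[/eqP r1|/eqP r1] : (\rank B == 1%N) || (\rank (kermx B) == 1%N).
  move: rK rB (rank_leq_row B); rewrite mxrank_ker.
  by case: (\rank B) => [|[|[|[|]]]].
- have [a a0 aP] := rank1_generator r1; exists a => // A GA.
  have [i Bi] : exists i, row i B != 0.
    apply: contrapT => nB; case/eqP: B0.
    apply/row_matrixP => i; rewrite row0; apply: contrapT => /eqP h.
    by apply: nB; exists i.
  have [k ek] : exists k, row i B = k *: a by apply/aP/row_sub.
  have [k' ek'] : exists k', row i B *m A = k' *: a.
    by apply: aP; rewrite rowE -mulmxA cB // mulmxA submxMl.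
  have k0 : k != 0 by apply: contra_neq Bi => k0; rewrite ek k0 scale0r.
  exists (k^-1 * k'); apply: (scalerI k0).
  by rewrite scalemxAl -ek ek' scalerA mulrA mulfV // mul1r.
- have [a a0 aP] := rank1_generator r1; exists (nz_row (kermx B)) => [|A GA].
    by rewrite nz_row_eq0.
  have sa := nz_row_sub (kermx B).
  have [k ek] := aP _ sa.
  have [k' ek'] : exists k', nz_row (kermx B) *m A = k' *: a.
    apply/aP/sub_kermxP; rewrite -mulmxA -cB // mulmxA.
    by move/sub_kermxP: sa => ->; rewrite mul0mx.
  have k0 : k != 0.
    by apply: contra_neq kB => k0; apply/eqP; rewrite -nz_row_eq0 ek k0 scale0r.
  exists (k' / k); rewrite ek' [in RHS]ek scalerA -mulrA mulVf // mulr1.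
  by [].
Qed.

End Eigen.

Section Configuration.
Variable R : realType.
Implicit Types (u v w x y z : 'rV[R]_3) (A : 'M[R]_3).

Definition symmetry_of (W : seq 'rV[R]_3) A :=
  orthogonal A /\ forall w, w \in W -> w *m A \in W.

(** The vertex set after centring and scaling. Among unit vectors equal distances are equal inner
    products, and non-empty interior becomes [th_span]. Symmetries are matrices rather than maps of
    [W], so that they also act on vectors outside [W]. *)
Record two_homogeneous (W : seq 'rV[R]_3) : Prop := TwoHomogeneous {
  th_uniq : uniq W;
  th_unit : forall w, w \in W -> dot w w = 1;
  th_sum : \sum_(w <- W) w = 0;
  th_span : forall u, (forall w, w \in W -> dot u w = 0) -> u = 0;
  th_hom : forall a b a' b', a \in W -> b \in W -> a' \in W -> b' \in W ->
    dot a b = dot a' b' ->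
    exists A, [/\ symmetry_of W A, a *m A = a' & b *m A = b'] }.

Variable W : seq 'rV[R]_3.
Hypothesis hW : two_homogeneous W.

Lemma th_trans v w : v \in W -> w \in W ->
  exists2 A, symmetry_of W A & v *m A = w.
Proof.
move=> vW wW; have [|A [sA vA _]] := th_hom hW vW vW wW wW; last by exists A.
by rewrite !(th_unit hW).
Qed.

Lemma th_swap v w : v \in W -> w \in W ->
  exists A, [/\ symmetry_of W A, v *m A = w & w *m A = v].
Proof. by move=> vW wW; apply: (th_hom hW) => //; rewrite dotC. Qed.

Lemma span_mx p (B C : 'M[R]_(3, p)) :
  (forall z, z \in W -> z *m B = z *m C) -> B = C.
Proof.
move=> BC; apply/eqP; rewrite -subr_eq0; apply/eqP.
have h z : z \in W -> z *m (B - C) = 0.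
  by move=> /BC e; rewrite mulmxBr e subrr.
apply/matrixP => i j.
suff /rowP/(_ i) : (col j (B - C))^T = 0 by rewrite !mxE.
apply: (th_span hW) => w wW; rewrite dotC dotE trmxK.
by rewrite colE mulmxA h // mul0mx mxE.
Qed.

Lemma perm_sym (s : seq 'rV[R]_3) A : orthogonal A -> uniq s ->
  (forall w, w \in s -> w *m A \in s) -> perm_eq (map (mulmx^~ A) s) s.
Proof.
move=> oA us sA.
have um : uniq (map (mulmx^~ A) s) by rewrite map_inj_uniq //; apply: orth_inj.
apply: uniq_perm => //.
have sub : {subset map (mulmx^~ A) s <= s}.
  by move=> _ /mapP[w ws ->]; apply: sA.
by have [] := uniq_min_size um sub; rewrite ?size_map.
Qed.

Lemma sum_sym (s : seq 'rV[R]_3) A : orthogonal A -> uniq s ->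
  (forall w, w \in s -> w *m A \in s) ->
  (\sum_(w <- s) w) *m A = \sum_(w <- s) w.
Proof.
move=> oA us sA; rewrite mulmx_suml -[RHS](perm_big _ (perm_sym oA us sA)).
by rewrite big_map.
Qed.

Lemma sym_tr A : symmetry_of W A -> symmetry_of W A^T.
Proof.
move=> [oA sA]; split; first exact: orth_tr.
move=> w; rewrite -{1}(perm_mem (perm_sym oA (th_uniq hW) sA)).
by case/mapP => z zW ->; rewrite orthK.
Qed.

Lemma sym_mul A B : symmetry_of W A -> symmetry_of W B ->
  symmetry_of W (A *m B).
Proof.
move=> [oA sA] [oB sB]; split; first exact: orth_mul.
by move=> w wW; rewrite mulmxA; apply/sB/sA.
Qed.

Lemma neq_exists v : v \in W -> exists2 w, w \in W & w != v.
Proof.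
move=> vW; apply: contrapT => nw.
have all_v w : w \in W -> w = v.
  by move=> wW; apply: contrapT => /eqP wv; apply: nw; exists w.
(* If [W] were reduced to [v], every vector orthogonal to [v] would vanish. The cross products of
   [v] with two coordinate vectors are orthogonal to [v], and their vanishing makes [v] zero. *)
pose u : 'rV[R]_3 := vec 1 0 0; pose u' : 'rV[R]_3 := vec 0 1 0.
have p0 : cross v v = 0 by rewrite /cross -vec0; apply: vec_eq; ring.
have ex x : dot v x = 0 -> x = 0.
  by move=> vx; apply: (th_span hW) => w /all_v ->; rewrite dotC.
have c1 := ex _ (etrans (dotC _ _) (dot_crossl v u)).
have c2 := ex _ (etrans (dotC _ _) (dot_crossl v u')).
have := th_unit hW vW; rewrite dot3.
move: c1 c2; rewrite /cross /u /u' !mxE /= -vec0.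
move=> /vec_inj[_ h1 h2] /vec_inj[_ _ h3]; move: h1 h2 h3; rewrite !(mulr0, mulr1, subr0, sub0r, add0r) => h1 h2 h3.
have -> : v 0 0 = 0 by lra.
have -> : v 0 1 = 0 by lra.
have -> : v 0 2 = 0 by lra.
by lra.
Qed.

(* If some vector fixed by the stabilizer of v is not parallel to v, its
   transports q_z satisfy z.q_z' = z'.q_z because z and z' can be swapped, so
   z |-> q_z is a non-scalar symmetric operator commuting with all
   symmetries. *)
Lemma reducible v q : v \in W -> (forall k, q != k *: v) ->
  (forall A, symmetry_of W A -> v *m A = v -> q *m A = q) ->
  exists2 a, dot a a = 1 & forall A, symmetry_of W A -> a *m A = a \/ a *m A = - a.
Proof.
move=> vW qv qfix.
have [f fP] : {f : 'rV[R]_3 -> 'M[R]_3 &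
    forall z, z \in W -> symmetry_of W (f z) /\ v *m f z = z}.
  apply: (@choice _ _ (fun z M => z \in W -> symmetry_of W M /\ v *m M = z)) => z.
  have [zW|zW] := boolP (z \in W); last by exists 0.
  by have [A sA vA] := th_trans vW zW; exists A.
(* Two symmetries carrying [v] to [z] differ by an element of the stabilizer of [v], which fixes
   [q]; hence [Q] does not depend on the choice [f] and is equivariant. *)
pose Q z := q *m f z.
have QA z A : z \in W -> symmetry_of W A -> Q (z *m A) = Q z *m A.
  move=> zW sA; have [sz vz] := fP z zW.
  have zA : z *m A \in W by apply: sA.2.
  have [sza vza] := fP _ zA.
  rewrite /Q; set B := f (z *m A).
  have sC : symmetry_of W (f z *m A *m B^T).
    by apply: sym_mul; [apply: sym_mul | apply: sym_tr].
  have vC : v *m (f z *m A *m B^T) = v.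
    by rewrite !mulmxA vz -{1}vza orthK //; apply: sza.1.
  by rewrite -{1}(qfix _ sC vC) !mulmxA orthVK //; apply: sza.1.
have QS z z' : z \in W -> z' \in W -> dot z (Q z') = dot z' (Q z).
  move=> zW zW'; have [A [sA zA zA']] := th_swap zW zW'.
  by rewrite -(dot_orth _ _ sA.1) -QA // zA zA'.
have qn : Q v != 0.
  have [sv vv] := fP v vW; rewrite /Q qfix //.
  by have := qv 0; rewrite scale0r.
pose S := \sum_(z <- W) z^T *m z.
pose M := \sum_(z <- W) (Q z)^T *m z.
have mulS x (F : 'rV[R]_3 -> 'rV[R]_3) :
    x *m (\sum_(z <- W) (F z)^T *m z) = \sum_(z <- W) dot x (F z) *: z.
  rewrite mulmx_sumr; apply: eq_bigr => z _.
  by rewrite mulmxA [_ *m _^T]mx11_scalar mul_scalar_mx -dotE.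
have uS : S \in unitmx.
  rewrite -row_free_unit; apply: inj_row_free => x xS.
  apply: (th_span hW) => w wW.
  have := mulS x id; rewrite -/S xS => /(congr1 (dot x))/esym/eqP.
  rewrite dot0r dot_sumr psumr_eq0 => [/allP/(_ w wW)|z _]; last first.
    by rewrite dotZr -expr2 sqr_ge0.
  by rewrite dotZr mulf_eq0 orbb => /eqP.
(* For [z] in [W], [z *m M] is the sum over [y] of [dot z (Q y) *: y], which [QS] turns into
   [Q z *m S]. So [L] is the linear extension of [Q]. *)
pose L := M *m invmx S.
have LQ z : z \in W -> z *m L = Q z.
  move=> zW; rewrite /L mulmxA -[RHS](mulmxK uS); congr (_ *m _).
  rewrite !(mulS _ Q) (mulS _ id) big_seq [RHS]big_seq.
  by apply: eq_bigr => y yW; rewrite QS // dotC.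
clearbody L.
have LA A : symmetry_of W A -> L *m A = A *m L.
  move=> sA; apply: span_mx => z zW.
  by rewrite !mulmxA (LQ z zW) (LQ _ (sA.2 _ zW)) QA.
have LT : L^T = L.
  apply: span_mx => z zW; apply/eqP; rewrite -subr_eq0; apply/eqP.
  apply: (th_span hW) => y yW.
  rewrite dotDl dotNl dot_mxl trmxK (LQ y yW) (LQ z zW) QS // dotC.
  by rewrite dotC subrr.
have nL k : L != k%:M.
  apply/eqP => Lk; have [sv vv] := fP v vW.
  have := qv k; rewrite -mul_mx_scalar -Lk LQ // /Q qfix // eqxx.
  by [].
have [a a0 aP] := common_eigenvector LT nL LA.
have na : 0 < dot a a by rewrite dot_gt0.
exists ((Num.sqrt (dot a a))^-1 *: a).
  rewrite dotZl dotZr mulrA -invfM -expr2 sqr_sqrtr ?ltW // mulVf //.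
  by rewrite lt0r_neq0.
move=> A sA; have [k ek] := aP A sA.
have : dot (a *m A) (a *m A) = dot a a by rewrite dot_orth //; apply: sA.1.
rewrite ek dotZl dotZr mulrA -[in RHS](mul1r (dot a a)).
move/(mulIf (lt0r_neq0 na))/eqP; rewrite -expr2 sqrf_eq1.
by rewrite -scalemxAl ek => /orP[]/eqP ->; rewrite ?scaleN1r ?scalerN ?scale1r; [left | right].
Qed.

End Configuration.

(** * Angles and regular polygons *)

Section Angles.
Variable R : realType.
Implicit Types (a b t : R).

Lemma cos_2pi : cos (2 * pi) = 1 :> R.
Proof. by rewrite (_ : 2 * pi = pi *+ 2) ?cos2pi // mulr_natl. Qed.

Lemma sin_2pi : sin (2 * pi) = 0 :> R.
Proof. by rewrite (_ : 2 * pi = pi *+ 2) ?sin2pi // mulr_natl. Qed.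

Lemma cosD2 t : cos (t + 2 * pi) = cos t.
Proof. by rewrite cosD cos_2pi sin_2pi; ring. Qed.

Lemma sinD2 t : sin (t + 2 * pi) = sin t.
Proof. by rewrite sinD cos_2pi sin_2pi; ring. Qed.

Lemma polar a b : a ^+ 2 + b ^+ 2 = 1 ->
  exists2 t, 0 <= t < 2 * pi & a = cos t /\ b = sin t.
Proof.
move=> ab.
have a1 : -1 <= a <= 1.
  by have b0 := sqr_ge0 b; apply/andP; split; nra.
have p0 := pi_gt0 R.
have ca : cos (acos a) = a by apply: acosK; rewrite in_itv.
have sa : sin (acos a) = `|b|.
  by rewrite sin_acos // -sqrtr_sqr; congr Num.sqrt; lra.
have g0 := acos_ge0 a1; have gp := acos_lepi a1.
have [b0|b0] := leP 0 b.
  exists (acos a); first by apply/andP; split; lra.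
  by rewrite ca sa ger0_norm.
exists (- acos a + 2 * pi); last first.
  by rewrite cosD2 sinD2 cosN sinN ca sa ltr0_norm // opprK.
have : acos a != 0.
  apply: contraTneq b0 => e; move: sa; rewrite e sin0 => /esym/eqP.
  by rewrite normr_eq0 => /eqP ->; rewrite ltxx.
by rewrite neq_lt => /orP[|] h; apply/andP; split; lra.
Qed.

(** The triple angle formula at [pi / 3] reads 4x^3 - 3x + 1 = 0, and this cubic is (x + 1)(2x -
    1)^2. *)
Lemma cos_pi3 : cos (pi / 3) = 1 / 2 :> R.
Proof.
set x := cos _.
have p0 := pi_gt0 R.
have e : cos (pi / 3 + pi / 3 + pi / 3) = -1 :> R.
  by rewrite -cospi; congr cos; lra.
move: e; rewrite !(cosD, sinD) -/x.
have := cos2Dsin2 (pi / 3 : R); rewrite -/x.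
set y := sin _ => xy e.
have x0 : 0 < x by apply: cos_gt0_pihalf; apply/andP; split; lra.
have e3 : (x + 1) * (2 * x - 1) ^+ 2 = 0.
  have -> : (x + 1) * (2 * x - 1) ^+ 2 = 4 * x ^+ 3 - 3 * x + 1 by ring.
  have y2 : y ^+ 2 = 1 - x ^+ 2 by lra.
  have : x ^+ 3 - 3 * x * y ^+ 2 = -1 by rewrite -e; ring.
  by rewrite y2; lra.
by move/eqP: e3; rewrite mulf_eq0 sqrf_eq0 => /orP[]/eqP; lra.
Qed.

Lemma cos_decr a b : 0 <= a -> a < b -> b <= pi -> cos b < cos a.
Proof. by move=> a0 ab bp; rewrite ltr_cos ?in_itv //=; lra. Qed.

Lemma cos_gt_close a b : - a < b -> b < a -> a <= pi -> cos a < cos b.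
Proof.
move=> l r ap; have [b0|b0] := leP 0 b; first by apply: cos_decr.
by rewrite -(cosN b); apply: cos_decr; lra.
Qed.

Lemma cos_2pi3 : cos (2 * pi / 3) = - (1 / 2) :> R.
Proof.
have -> : 2 * pi / 3 = pi - pi / 3 :> R by lra.
by rewrite cosB cospi sinpi cos_pi3; lra.
Qed.

(** The angle t = 2 pi / 5 satisfies cos 3t = cos 2t; the quadratic remains after division by the
    factor of the root x = 1. *)
Lemma cos_2pi5 : let x : R := cos (2 * pi / 5) in 0 < x /\ 4 * x ^+ 2 + 2 * x = 1.
Proof.
set t := 2 * pi / 5; move=> x.
have p0 := pi_gt0 R.
have x0 : 0 < x by apply: cos_gt0_pihalf; apply/andP; split; rewrite /t; lra.
split=> //.
have e : cos (t + t + t) = cos (t + t).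
  rewrite -[RHS]cosN -[RHS]cosD2; congr cos; rewrite /t; lra.
move: e; rewrite !(cosD, sinD) -/x.
have := cos2Dsin2 t; rewrite -/x; set y := sin t => xy e.
have y2 : y ^+ 2 = 1 - x ^+ 2 by lra.
have {}e : x ^+ 3 - 3 * x * y ^+ 2 = x ^+ 2 - y ^+ 2 by rewrite !expr2; lra.
rewrite y2 in e.
have x1 : x < 1.
  by rewrite -[ltRHS]cos0; apply: cos_decr; rewrite /t; lra.
have : (x - 1) * (4 * x ^+ 2 + 2 * x - 1) = 0.
  have -> : (x - 1) * (4 * x ^+ 2 + 2 * x - 1) =
     4 * x ^+ 3 - 2 * x ^+ 2 - 3 * x + 1 by ring.
  by lra.
by move/eqP; rewrite mulf_eq0 => /orP[]/eqP; lra.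
Qed.

End Angles.

Section Plane.
Variable R : realType.
Implicit Types (u v x y : 'rV[R]_3) (t : R).

Lemma exists_orth v : exists2 u, u != 0 & dot u v = 0.
Proof.
have [v0|v0] := eqVneq (v 0 0) 0; last first.
  exists (vec (- v 0 1) (v 0 0) 0); last by rewrite dot3 !mxE /=; ring.
  by apply: contra_neq v0; rewrite -vec0 => /vec_inj[].
exists (vec 1 0 0); last by rewrite dot3 !mxE v0 /=; ring.
by apply/eqP; rewrite -vec0 => /vec_inj[/eqP]; rewrite oner_eq0.
Qed.

Lemma normalize u : u != 0 -> dot ((enorm u)^-1 *: u) ((enorm u)^-1 *: u) = 1.
Proof.
rewrite -dot_gt0 => u0.
rewrite dotZl dotZr mulrA -invfM -expr2 sqr_sqrtr ?ltW // mulVf //.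
exact: lt0r_neq0.
Qed.

Lemma exists_unit_orth v : exists2 u, dot u u = 1 & dot u v = 0.
Proof.
have [u u0 uv] := exists_orth v; exists ((enorm u)^-1 *: u).
  exact: normalize.
by rewrite dotZl uv mulr0.
Qed.

Lemma ortho_cross u v : orthonormal2 u v ->
  [/\ dot (cross u v) (cross u v) = 1, dot (cross u v) u = 0 & dot (cross u v) v = 0].
Proof.
by move=> [uu vv uv]; rewrite dot_cross2 dot_crossl dot_crossr uu vv uv; split=> //; ring.
Qed.

Lemma ortho_decomp u v x : orthonormal2 u v ->
  x = dot x (cross u v) *: cross u v + dot x u *: u + dot x v *: v.
Proof.
move=> o; have [nn _ _] := ortho_cross o; case: o => uu vv uv.
have := cross_decomp x u v; rewrite nn uu vv uv scale1r => {1}->.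
by rewrite !scale0r !subr0 !scale1r.
Qed.

Lemma plane_decomp e1 e2 v x : orthonormal2 e1 e2 -> v != 0 ->
  dot v e1 = 0 -> dot v e2 = 0 -> dot x v = 0 ->
  x = dot x e1 *: e1 + dot x e2 *: e2.
Proof.
move=> o v0 v1 v2 xv.
have := ortho_decomp v o; rewrite v1 v2 !scale0r !addr0 => ev.
have k0 : dot v (cross e1 e2) != 0.
  by apply: contra_neq v0 => k0; rewrite ev k0 scale0r.
have xn : dot x (cross e1 e2) = 0.
  move: xv; rewrite ev dotZr => /eqP; rewrite mulf_eq0 (negPf k0) /=.
  by move/eqP.
by have := ortho_decomp x o; rewrite xn scale0r add0r.
Qed.

Lemma complete_frame v : dot v v = 1 -> forall e1, dot e1 e1 = 1 -> dot e1 v = 0 ->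
  exists2 e2, orthonormal2 e1 e2 & dot e2 v = 0.
Proof.
move=> vv e1 e11 e1v; exists (cross e1 v); last by rewrite dot_crossr.
have [|nn n1 _] := @ortho_cross e1 v; first by split.
by split=> //; rewrite dotC.
Qed.

Definition circle_pt (e1 e2 : 'rV[R]_3) t := cos t *: e1 + sin t *: e2.

Lemma dot_circle_pt (e1 e2 : 'rV[R]_3) s t : orthonormal2 e1 e2 ->
  dot (circle_pt e1 e2 s) (circle_pt e1 e2 t) = cos (s - t).
Proof.
move=> [u v uv]; rewrite /circle_pt !dotL u v uv (dotC e2) uv cosB; ring.
Qed.

Lemma circle_ptD2 e1 e2 t : circle_pt e1 e2 (t + 2 * pi) = circle_pt e1 e2 t.
Proof. by rewrite /circle_pt cosD2 sinD2. Qed.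

Lemma plane_polar e1 e2 v x r : orthonormal2 e1 e2 -> v != 0 ->
  dot v e1 = 0 -> dot v e2 = 0 -> dot x v = 0 -> 0 < r -> dot x x = r ^+ 2 ->
  exists2 t, 0 <= t < 2 * pi & x = r *: circle_pt e1 e2 t.
Proof.
move=> o v0 v1 v2 xv r0 xr.
have xE := plane_decomp o v0 v1 v2 xv; have [u1 u2 u12] := o.
have : (dot x e1 / r) ^+ 2 + (dot x e2 / r) ^+ 2 = 1.
  have e : dot x e1 ^+ 2 + dot x e2 ^+ 2 = r ^+ 2.
    rewrite -xr; move: (dot x e1) (dot x e2) xE => a b ->.
    by rewrite !dotL u1 u2 u12 (dotC e2) u12; ring.
  by rewrite !expr_div_n -mulrDl e mulfV // expf_neq0 // lt0r_neq0.
case/polar => t t0 [c s]; exists t => //.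
rewrite /circle_pt -c -s scalerDr !scalerA [LHS]xE.
by rewrite !(mulrC r) !divfK // lt0r_neq0.
Qed.

(* Pigeonhole on six sectors of angle pi/3, the last of which is empty when
   one of the points has angle 0. *)
Lemma circle_packing (s : seq 'rV[R]_3) (T : 'rV[R]_3 -> R) :
  uniq s -> (forall x, x \in s -> 0 <= T x < 2 * pi) ->
  (exists2 x, x \in s & T x = 0) ->
  (forall x y, x \in s -> y \in s -> x != y -> cos (T x - T y) < 1 / 2) ->
  (size s <= 5)%N.
Proof.
move=> us T2 [x0 x0s Tx0] sep.
have p0 := pi_gt0 R.
have far x y : x \in s -> y \in s -> x != y ->
    T x - T y <= - (pi / 3) \/ pi / 3 <= T x - T y.
  move=> xs ys xy; have := sep _ _ xs ys xy.
  have [|h1] := leP (T x - T y) (- (pi / 3)); first by left.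
  have [|h2] := leP (pi / 3) (T x - T y); first by right.
  have : cos (pi / 3) < cos (T x - T y) by apply: cos_gt_close => //; lra.
  by rewrite cos_pi3; lra.
pose idx t := Num.truncn (t / (pi / 3)).
have idxP x : x \in s -> (idx (T x))%:R * (pi / 3) <= T x < ((idx (T x))%:R + 1) * (pi / 3).
  move=> /T2/andP[t0 _]; have p3 : 0 < pi / 3 :> R by lra.
  rewrite natr1 -ler_pdivlMr // -ltr_pdivrMr //.
  by apply: truncn_itv; rewrite divr_ge0 //; lra.
have inj : {in s &, injective (idx \o T)}.
  move=> x y xs ys; apply: contra_eq => xy; apply/eqP => /= e.
  have := idxP _ xs; have := idxP _ ys; rewrite e => /andP[y1 y2] /andP[x1 x2].
  by have [h|h] := far _ _ xs ys xy; lra.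
have u' : uniq (map (idx \o T) s) by rewrite map_inj_in_uniq.
rewrite -(size_map (idx \o T)) -(size_iota 0 5).
apply: uniq_leq_size => // _ /mapP[x xs ->].
(* The sixth sector lies within [pi / 3] of the point of angle 0, measured through the full turn;
   its lower end is excluded because the separation is strict. *)
suff : T x < 5 * (pi / 3).
  move=> h; rewrite mem_iota /= add0n.
  have /andP[x1 _] := idxP _ xs; rewrite -(ltr_nat R).
  have p3 : 0 < pi / 3 :> R by lra.
  by rewrite -(ltr_pM2r p3); lra.
have [->|xo] := eqVneq x x0; first by rewrite Tx0; lra.
have := sep _ _ xs x0s xo; rewrite Tx0 subr0.
rewrite -cosN -cosD2.
have /andP[_ x2] := T2 _ xs.
have [//|h] := ltP (T x) (5 * (pi / 3)).
have [e|] := eqVneq (T x) (5 * (pi / 3)).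
  have -> : - T x + 2 * pi = pi / 3 by lra.
  by rewrite cos_pi3 ltxx.
rewrite neq_lt => /orP[|] h'; first by lra.
have : cos (pi / 3) < cos (- T x + 2 * pi) by apply: cos_gt_close; lra.
by rewrite cos_pi3; lra.
Qed.

(* From a point of T one reaches a second one by turning by the angle theta of
   the smallest distance, so T is swept out by such turns. *)
Lemma regular_polygon (T : seq 'rV[R]_3) e1 e2 r c :
  orthonormal2 e1 e2 -> 0 < r -> T != [::] ->
  (forall x, x \in T -> exists2 t, 0 <= t < 2 * pi & x = r *: circle_pt e1 e2 t) ->
  (forall x y, x \in T -> y \in T -> x != y -> dot x y <= c) ->
  (forall x, x \in T -> exists y y', [/\ y \in T, y' \in T, y != y',
     dot x y = c & dot x y' = c]) ->
  exists n, [/\ (3 <= n)%N, c = r ^+ 2 * cos (2 * pi / n%:R) &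
    forall t, r *: circle_pt e1 e2 t \in T -> forall x,
    x \in T <-> exists2 j : nat, (j < n)%N &
      x = r *: circle_pt e1 e2 (t + 2 * pi * j%:R / n%:R)].
Proof.
move=> o r0 T0 onc cmax two.
have r2 : 0 < r ^+ 2 by rewrite exprn_gt0.
have p0 := pi_gt0 R.
have dotp s t : dot (r *: circle_pt e1 e2 s) (r *: circle_pt e1 e2 t) =
    r ^+ 2 * cos (s - t).
  by rewrite dotZl dotZr dot_circle_pt // mulrA expr2.
have rr x : x \in T -> dot x x = r ^+ 2.
  by case/onc => t _ ->; rewrite dotp subrr cos0 mulr1.
have [x0 x0T] : exists x, x \in T.
  by case: T T0 {onc cmax two rr} => // x s _; exists x; rewrite mem_head.
pose k := c / r ^+ 2.
have ck : c = r ^+ 2 * k by rewrite mulrC divfK // lt0r_neq0.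
have ndot x y : x \in T -> y \in T -> dot (x - y) (x - y) = 2 * (r ^+ 2 - dot x y).
  by move=> xT yT; rewrite dotB !rr //; ring.
have k1 : k < 1.
  have [y [y' [yT y'T yy' xy xy']]] := two _ x0T.
  rewrite ltNge; apply/negP => k1.
  have rc : r ^+ 2 <= c by rewrite ck ler_peMr // ltW.
  have e z : z \in T -> dot x0 z = c -> x0 = z.
    move=> zT e; apply: eq_dotB; have := dot_ge0 (x0 - z).
    by rewrite ndot // e; lra.
  by move: yy'; rewrite -(e y) // -(e y') // eqxx.
have kN1 : -1 < k.
  have [y [y' [yT y'T yy' xy xy']]] := two _ x0T.
  rewrite ltNge; apply/negP => k1'.
  have rc : c <= - r ^+ 2 by rewrite ck -mulrN1 ler_pM2l.
  have e z : z \in T -> dot x0 z = c -> z = - x0.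
    move=> zT e; apply: eq_dotB; rewrite opprK.
    have := dot_ge0 (z + x0).
    by rewrite !dotL !rr // (dotC z) e; lra.
  by move: yy'; rewrite (e y) // (e y') // eqxx.
pose th := acos k.
have kin : -1 <= k <= 1 by rewrite !ltW.
have cth : cos th = k by apply: acosK; rewrite in_itv.
have th0 : 0 < th by apply: acos_gt0; rewrite ltW.
have thp : th < pi by apply: acos_ltpi; rewrite kN1 ltW.
have close s t : r *: circle_pt e1 e2 s \in T -> r *: circle_pt e1 e2 t \in T ->
    - th < s - t -> s - t < th -> s = t \/ circle_pt e1 e2 s = circle_pt e1 e2 t.
  move=> sT tT l u; right; apply: contrapT => ne.
  have : dot (r *: circle_pt e1 e2 s) (r *: circle_pt e1 e2 t) <= c.
    apply: cmax => //; apply/eqP => /(scalerI (lt0r_neq0 r0)).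
    exact: ne.
  rewrite dotp ck ler_pM2l // -cth leNgt.
  by rewrite (cos_gt_close l u (ltW thp)).
have pt_eq s t : cos s = cos t -> sin s = sin t ->
    circle_pt e1 e2 s = circle_pt e1 e2 t.
  by rewrite /circle_pt => -> ->.
have pt_shift s t : exists2 d, 0 <= d < 2 * pi &
    circle_pt e1 e2 s = circle_pt e1 e2 (t + d).
  have [q ->] : exists q, s = t + q by exists (s - t); rewrite addrC subrK.
  have [d d2 [cd sd]] := polar (cos2Dsin2 q).
  by exists d => //; apply: pt_eq; rewrite ?cosD ?sinD cd sd.
have nbr s t : cos (s - t) = k ->
    circle_pt e1 e2 t = circle_pt e1 e2 (s + th) \/
    circle_pt e1 e2 t = circle_pt e1 e2 (s - th).
  have [q ->] : exists q, t = s + q by exists (t - s); rewrite addrC subrK.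
  rewrite -cth opprD addrA subrr sub0r cosN => e.
  have : sin q ^+ 2 = sin th ^+ 2 by rewrite !sin2cos2 e.
  move/eqP; rewrite eqf_sqr => /orP[]/eqP f; [left | right]; apply: pt_eq;
  by rewrite ?cosD ?sinD ?cosN ?sinN e f.
(* Only the turns by [th] and [- th] give the inner product [c], so the two distinct neighbours take
   up both. *)
have step t : r *: circle_pt e1 e2 t \in T -> r *: circle_pt e1 e2 (t + th) \in T.
  move=> tT; have [y [y' [yT y'T yy' xy xy']]] := two _ tT.
  have [s _ ey] := onc _ yT; have [s' _ ey'] := onc _ y'T.
  move: xy xy'; rewrite ey ey' !dotp ck => /(mulfI (lt0r_neq0 r2))/nbr h.
  move=> /(mulfI (lt0r_neq0 r2))/nbr h'.
  case: h => h; first by rewrite -h -ey.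
  case: h' => h'; first by rewrite -h' -ey'.
  by move: yy'; rewrite ey ey' h h' eqxx.
have steps t j : r *: circle_pt e1 e2 t \in T ->
    r *: circle_pt e1 e2 (t + j%:R * th) \in T.
  move=> tT; elim: j => [|j IH]; first by rewrite mul0r addr0.
  by rewrite -(natr1 j) mulrDl mul1r addrA; apply: step.
have trunc d : 0 <= d -> exists j : nat, j%:R * th <= d < j.+1%:R * th.
  move=> d0; exists (Num.truncn (d / th)).
  rewrite -ler_pdivlMr // -ltr_pdivrMr //.
  by apply: truncn_itv; rewrite divr_ge0 // ltW.
have [s0 _ s0E] := onc _ x0T.
(* After [M] turns less than [th] of the circle is left, so the point reached is too close to the
   starting point to differ from it, and [th] divides the full turn exactly. *)
have [|M /andP[M1 M2]] := trunc (2 * pi); first by lra.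
have Mth : M%:R * th = 2 * pi.
  have h0 : r *: circle_pt e1 e2 s0 \in T by rewrite -s0E.
  have h1 : r *: circle_pt e1 e2 (s0 + 2 * pi) \in T by rewrite circle_ptD2.
  have h2 := steps s0 M h0.
  move: M2; rewrite -(natr1 M) mulrDl mul1r => M2.
  have [| |e|e] := close _ _ h1 h2; [lra|lra|lra|].
  have : cos (2 * pi - M%:R * th) = cos 0.
    rewrite cos0.
    have := dot_circle_pt (s0 + 2 * pi) (s0 + M%:R * th) o.
    rewrite e dot_circle_pt // subrr cos0 => h.
    by rewrite [RHS]h; congr cos; ring.
  by move/cos_inj; rewrite !in_itv /= => h; have := h _ _; lra.
have M0 : (0 < M)%N.
  by rewrite lt0n; apply/eqP => M0; move: Mth; rewrite M0 mul0r; lra.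
have thE : th = 2 * pi / M%:R.
  by rewrite -Mth mulrC mulKf // pnatr_eq0 -lt0n.
exists M; split.
- have : 2 * pi < M%:R * pi :> R by rewrite -Mth ltr_pM2l // ltr0n.
  by rewrite ltr_pM2r // ltr_nat.
- by rewrite -thE cth -ck.
- move=> t tT x; split=> [xT|[j jM ->]]; last first.
    by rewrite mulrAC -thE mulrC; apply: steps.
  have [s _ xE] := onc _ xT.
  have [d /andP[d0 d2] sE] := pt_shift s t.
  have [j /andP[j1 j2]] := trunc d d0.
  have jM : (j < M)%N.
    by rewrite -(ltr_nat R) -(ltr_pM2r th0) Mth; lra.
  exists j => //; rewrite mulrAC -thE (mulrC th) xE; congr (_ *: _).
  rewrite sE; move: j2; rewrite -(natr1 j) mulrDl mul1r => j2.
  have hd : r *: circle_pt e1 e2 (t + d) \in T by rewrite -sE -xE.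
  have [| |e|//] := close _ _ hd (steps _ j tT); [lra|lra|].
  by rewrite e.
Qed.

End Plane.

(** * Nearest neighbours *)

Lemma seq_argmax (R : realType) (T : eqType) (f : T -> R) (s : seq T) :
  s != [::] -> exists2 x, x \in s & forall y, y \in s -> f y <= f x.
Proof.
elim: s => // a s IH _; have [->|/IH[x xs xm]] := eqVneq s [::].
  by exists a => [|y]; rewrite mem_seq1 // => /eqP ->.
have [ax|ax] := leP (f a) (f x).
  exists x => [|y]; rewrite inE ?xs ?orbT // => /orP[/eqP-> //|]; exact: xm.
exists a => [|y]; first by rewrite mem_head.
by rewrite inE => /orP[/eqP-> //|/xm h]; apply: le_trans h (ltW ax).
Qed.

Section Nearest.
Variable R : realType.
Implicit Types (u v w x y z : 'rV[R]_3) (A : 'M[R]_3) (W : seq 'rV[R]_3).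

(** The name refers to the minimal distance: among unit vectors it corresponds to the largest inner
    product [c] of distinct points. *)
Record min_dot W (c : R) : Prop := MinDot {
  md_lt1 : c < 1;
  md_gtN1 : -1 < c;
  md_max : forall x y, x \in W -> y \in W -> x != y -> dot x y <= c;
  md_att : forall v, v \in W -> exists2 w, w \in W & dot v w = c }.

Lemma th_neq0 W : two_homogeneous W -> W != [::].
Proof.
move=> hW; apply/eqP => W0.
have : vec 1 0 0 = 0 :> 'rV[R]_3 by apply: (th_span hW) => w; rewrite W0.
by rewrite -vec0 => /vec_inj[/eqP]; rewrite oner_eq0.
Qed.

Lemma th_not_line W v : two_homogeneous W -> exists2 w, w \in W & w <> v /\ w <> - v.
Proof.
move=> hW; apply: contrapT => nw.
have [u u0 uv] := exists_orth v.
case/eqP: u0; apply: (th_span hW) => w wW.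
have [->//|wv] := eqVneq w v; have [->|wv'] := eqVneq w (- v).
  by rewrite dotNr uv oppr0.
by case: nw; exists w => //; split; apply/eqP.
Qed.

Lemma exists_min_dot W : two_homogeneous W -> exists c, min_dot W c.
Proof.
move=> hW; have W0 := th_neq0 hW.
have [v vW] : exists v, v \in W.
  by case: (W) W0 => // x s _; exists x; rewrite mem_head.
pose s := [seq w <- W | w != v].
have s0 : s != [::].
  have [w wW [/eqP wv _]] := th_not_line v hW.
  have : w \in s by rewrite mem_filter wv.
  by apply: contraTneq => ->.
have [w ws wmax] := seq_argmax (dot v) s0.
move: ws; rewrite mem_filter => /andP[wv wW].
pose c := dot v w.
have cmax x y : x \in W -> y \in W -> x != y -> dot x y <= c.
  move=> xW yW xy; have [A sA xA] := th_trans hW xW vW.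
  rewrite -(dot_orth x y sA.1) xA; apply: wmax.
  rewrite mem_filter (sA.2 _ yW) andbT -xA eq_sym.
  by apply: contra_neq xy => /(orth_inj sA.1).
exists c; split=> //.
- by apply: unit_dot_lt1; rewrite ?(th_unit hW) // eq_sym.
- rewrite ltNge; apply/negP => c1.
  have [z zW [zv zv']] := th_not_line v hW.
  apply: zv'; apply: eq_dotB; rewrite opprK.
  have := dot_ge0 (z + v); rewrite !dotL !(th_unit hW) //.
  have := cmax _ _ zW vW (introN eqP zv); rewrite (dotC v) => *; lra.
- move=> x xW; have [A sA vA] := th_trans hW vW xW.
  by exists (w *m A); [apply: sA.2 | rewrite -vA dot_orth //; apply: sA.1].
Qed.

Variables (W : seq 'rV[R]_3) (c : R).
Hypotheses (hW : two_homogeneous W) (hc : min_dot W c).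

Definition nb v := [seq w <- W | dot v w == c].

Lemma mem_nb v w : (w \in nb v) = (dot v w == c) && (w \in W).
Proof. by rewrite mem_filter. Qed.

Lemma nbP v w : w \in nb v -> w \in W /\ dot v w = c.
Proof. by rewrite mem_nb => /andP[/eqP]. Qed.

Lemma nb_intro v w : w \in W -> dot v w = c -> w \in nb v.
Proof. by rewrite mem_nb => -> ->; rewrite eqxx. Qed.

Lemma nb_uniq v : uniq (nb v).
Proof. exact/filter_uniq/(th_uniq hW). Qed.

Lemma separated x y : x \in W -> y \in W -> x = y \/ dot x y <= c.
Proof.
by move=> xW yW; have [|xy] := eqVneq x y; [left | right; apply: (md_max hc)].
Qed.

Lemma nb_sym_closed v A : v \in W -> symmetry_of W A -> v *m A = v ->
  forall w, w \in nb v -> w *m A \in nb v.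
Proof.
move=> vW sA vA w /nbP[wW vw]; apply: nb_intro; first exact: sA.2.
by rewrite -{1}vA dot_orth //; apply: sA.1.
Qed.

Lemma nb_size v w : v \in W -> w \in W -> size (nb v) = size (nb w).
Proof.
suff le x y : x \in W -> y \in W -> (size (nb x) <= size (nb y))%N.
  by move=> vW wW; apply/eqP; rewrite eqn_leq !le.
move=> xW yW; have [A sA xA] := th_trans hW xW yW.
rewrite -(size_map (mulmx^~ A)); apply: uniq_leq_size.
  by rewrite map_inj_uniq ?nb_uniq //; apply: orth_inj sA.1.
move=> _ /mapP[z /nbP[zW xz] ->]; apply: nb_intro; first exact: sA.2.
by rewrite -xA dot_orth //; apply: sA.1.
Qed.

Lemma cross_nb_neq0 v w : v \in W -> w \in nb v -> cross v w != 0.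
Proof.
have [c1 cN1 _ _] := hc.
move=> vW /nbP[wW vw]; apply: cross_unit_neq0; rewrite ?(th_unit hW) // vw.
by rewrite cN1.
Qed.

Lemma nb_unique v w x y z : v \in W -> w \in nb v -> x \in W -> y \in W ->
  x != y -> dot x v = dot y v -> dot x w = dot y w ->
  dot z z = 1 -> dot z v = dot y v -> dot z w = dot y w -> z = x \/ z = y.
Proof.
move=> vW wn xW yW xy xv xw zz zv zw.
by apply: (two_solutions (cross_nb_neq0 vW wn) xy) => //; rewrite ?zz !(th_unit hW).
Qed.

(** The case complementary to [reducible]. It applies to every vector built symmetrically around
    [v], notably to the sum of the nearest neighbours. *)
Hypothesis irr : forall v q, v \in W ->
  (forall A, symmetry_of W A -> v *m A = v -> q *m A = q) ->
  exists k, q = k *: v.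

Lemma nb_sum v : v \in W ->
  \sum_(w <- nb v) w = ((size (nb v))%:R * c) *: v.
Proof.
move=> vW; have [A sA vA|k ek] := @irr v (\sum_(w <- nb v) w) vW.
  by apply: sum_sym; [apply: sA.1 | apply: nb_uniq | apply: nb_sym_closed].
rewrite ek; congr (_ *: _).
have := congr1 (dot v) ek; rewrite dotZr (th_unit hW) // mulr1 => <-.
rewrite dot_sumr big_seq (eq_bigr (fun=> c)); last by move=> w /nbP[].
by rewrite -big_seq sumr_const_seq || (rewrite -big_seq big_const_seq count_predT iter_addr_0 mulr_natl).
Qed.

(** Projected to the plane orthogonal to [v], the neighbours lie on a circle of squared radius 1 -
    c^2. Their inner products there are at most c - c^2, which is less than half of 1 - c^2 because
    (1 - c)^2 > 0, so the angles between them exceed [pi / 3]. *)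
Lemma nb_size_le5 v : v \in W -> (size (nb v) <= 5)%N.
Proof.
have [c1 cN1 _ _] := hc.
move=> vW; have [w0 w0W vw0] := md_att hc vW.
have vv := th_unit hW vW.
pose s2 := 1 - c ^+ 2.
have s20 : 0 < s2.
  by have : 0 < (1 - c) * (1 + c); [apply: mulr_gt0; lra | rewrite /s2; lra].
pose r := Num.sqrt s2.
have r0 : 0 < r by rewrite sqrtr_gt0.
have r2 : r ^+ 2 = s2 by rewrite sqr_sqrtr // ltW.
pose u w := w - c *: v.
have udot x y : x \in nb v -> y \in nb v -> dot (u x) (u y) = dot x y - c ^+ 2.
  move=> /nbP[_ vx] /nbP[_ vy].
  by rewrite /u !dotL vv vy (dotC x v) vx; ring.
have w0n : w0 \in nb v by apply: nb_intro.
pose e1 := r^-1 *: u w0.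
have e11 : dot e1 e1 = 1.
  rewrite dotZl dotZr udot // (th_unit hW) // -/s2 -r2 expr2.
  by rewrite mulrA -invfM mulVf // mulf_neq0 // lt0r_neq0.
have uv x : x \in nb v -> dot (u x) v = 0.
  by move=> /nbP[_ vx]; rewrite /u !dotL vv dotC vx; ring.
have e1v : dot e1 v = 0 by rewrite dotZl uv // mulr0.
have [e2 o e2v] := complete_frame vv e11 e1v.
have v0 : v != 0 by rewrite -dot_gt0 vv.
have pol x : x \in nb v -> exists2 t, 0 <= t < 2 * pi & u x = r *: circle_pt e1 e2 t.
  move=> xn; apply: (plane_polar o v0); rewrite ?(dotC v) ?uv //.
  by rewrite udot // (th_unit hW) ?r2 //; case: (nbP xn).
have [T TP] : {T : 'rV[R]_3 -> R & forall x, x \in nb v ->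
    0 <= T x < 2 * pi /\ u x = r *: circle_pt e1 e2 (T x)}.
  apply: (@choice _ _ (fun x t => x \in nb v ->
    0 <= t < 2 * pi /\ u x = r *: circle_pt e1 e2 t)) => x.
  have [xn|xn] := boolP (x \in nb v); last by exists 0.
  by have [t t2 e] := pol _ xn; exists t.
have dotT x y : x \in nb v -> y \in nb v -> dot (u x) (u y) = s2 * cos (T x - T y).
  move=> xn yn; rewrite (TP x xn).2 (TP y yn).2 dotZl dotZr dot_circle_pt //.
  by rewrite mulrA -expr2 r2.
(* The packing lemma wants a point of angle literally 0; resetting the angle of [w0] does not change
   its position. *)
pose T' x := if x == w0 then 0 else T x.
have T'P x y : x \in nb v -> y \in nb v -> cos (T' x - T' y) = cos (T x - T y).
  have Tw0 : circle_pt e1 e2 (T w0) = circle_pt e1 e2 0.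
    apply: (scalerI (lt0r_neq0 r0)); rewrite -(TP w0 w0n).2 /circle_pt.
    by rewrite cos0 sin0 scale0r addr0 scale1r /e1 scalerA mulfV ?scale1r // lt0r_neq0.
  have TT z : circle_pt e1 e2 (T' z) = circle_pt e1 e2 (T z).
    by rewrite /T'; case: eqP => // ->.
  by move=> xn yn; rewrite -!(dot_circle_pt _ _ o) !TT.
apply: (@circle_packing _ (nb v) T' (nb_uniq v)).
- move=> x xn; rewrite /T'; case: eqP => _; last exact: (TP x xn).1.
  by have := pi_gt0 R; lra.
- by exists w0 => //; rewrite /T' eqxx.
- move=> x y xn yn xy; rewrite T'P // -(ltr_pM2l s20) -dotT // udot //.
  have [xW _] := nbP xn; have [yW _] := nbP yn.
  have := md_max hc xW yW xy; rewrite /s2.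
  have : 0 < (1 - c) ^+ 2 by rewrite exprn_gt0 //; lra.
  by rewrite !expr2; lra.
Qed.

(* The reflection of x in the bisecting plane of v and w has the same inner
   products with v and w as the images of x and x' under a symmetry exchanging
   v and w, so it is one of these two images. *)
Lemma mirror v w x x' : v \in W -> w \in nb v -> x \in nb v -> x' \in nb v ->
  x != x' -> dot x w = dot x' w ->
  x + ((c - dot x w) / (1 - c)) *: (w - v) \in nb w.
Proof.
have [c1 cN1 _ _] := hc.
move=> vW wn xn x'n xx' xw.
have [wW vw] := nbP wn; have [xW vx] := nbP xn; have [x'W vx'] := nbP x'n.
have [A [sA vA wA]] := th_swap hW vW wW.
have vv := th_unit hW vW; have ww := th_unit hW wW; have xx := th_unit hW xW.
have wv : dot w v = c by rewrite dotC.
have xv : dot x v = c by rewrite dotC.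
set t := _ / _; set z := _ + _.
have te : t * (1 - c) = c - dot x w by rewrite divfK // subr_eq0 gt_eqF.
have zw : dot w z = c.
  by rewrite /z !dotL ww wv (dotC w x); lra.
have zv : dot z v = dot x w.
  by rewrite /z !dotL vv wv xv; lra.
have zz : dot z z = 1.
  rewrite /z !dotL xx vv ww wv vw xv (dotC w x) (dotC v x) xv.
  have -> : dot x w = c - t * (1 - c) by lra.
  by ring.
have wn' : v \in nb w by apply: nb_intro.
have m1 : x *m A \in W by apply: sA.2.
have m2 : x' *m A \in W by apply: sA.2.
have d1 y : dot (y *m A) w = dot y v by rewrite -vA dot_orth //; apply: sA.1.
have d2 y : dot (y *m A) v = dot y w by rewrite -{1}wA dot_orth //; apply: sA.1.
have ne : x *m A != x' *m A by apply: contra_neq xx' => /(orth_inj sA.1).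
apply: nb_intro => //.
case: (@nb_unique w v (x *m A) (x' *m A) z) => //; rewrite ?d1 ?d2 //.
- by rewrite xv dotC.
- by rewrite dotC zw dotC.
- by rewrite zv.
- by move=> ->.
- by move=> ->.
Qed.

End Nearest.

Section VectorIdentities.
Variable R : realType.
Implicit Types (u v w x y z n : 'rV[R]_3).

(** Expansion of [n] in the reciprocal basis of [x], [y], [z], again without division. *)
Lemma triple_decomp n x y z : dot x (cross y z) *: n =
  dot n x *: cross y z + dot n y *: cross z x + dot n z *: cross x y.
Proof.
rewrite (vecE n) (vecE x) (vecE y) (vecE z) !cross_vec !dot_vec !vecL.
by apply: vec_eq; ring.
Qed.

Lemma coplanar n x y z : n != 0 -> dot x n = 0 -> dot y n = 0 -> dot z n = 0 ->
  dot x (cross y z) = 0.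
Proof.
move=> n0 xn yn zn; have := triple_decomp n x y z.
rewrite !(dotC n) xn yn zn !scale0r !addr0 => /eqP.
by rewrite scaler_eq0 (negPf n0) orbF => /eqP.
Qed.

Lemma cross_eq0 u v : cross u v = 0 -> dot v v *: u = dot u v *: v.
Proof.
move=> uv0; apply: eq_dotB; have := dot_cross2 u v; rewrite uv0 dot0l.
by rewrite !dotL (dotC v u) => e; have := congr1 (fun k => dot v v * k) e; lra.
Qed.

End VectorIdentities.

(** * Vertices with at most three nearest neighbours *)

Section SmallDegree.
Variable R : realType.
Implicit Types (u v w x y z n p q : 'rV[R]_3) (A : 'M[R]_3).
Variables (W : seq 'rV[R]_3) (c : R).
Hypotheses (hW : two_homogeneous W) (hc : min_dot W c).
Hypothesis irr : forall v q, v \in W ->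
  (forall A, symmetry_of W A -> v *m A = v -> q *m A = q) ->
  exists k, q = k *: v.

Local Notation nb := (nb W c).

(** A single neighbour would be [c *: v], whose length is less than 1. *)
Lemma nb_sizeN1 v : v \in W -> size (nb v) <> 1%N.
Proof.
have [c1 cN1 _ _] := hc.
move=> vW s1; have := nb_sum c hW irr vW; rewrite s1 mul1r.
case: (nb v) s1 (@nbP _ W c v) => [|w [|]] //= _ h; rewrite big_seq1 => e.
have [wW _] := h w (mem_head _ _).
have := th_unit hW wW; rewrite e dotZl dotZr (th_unit hW vW) mulr1.
have : 0 < (1 - c) * (1 + c) by apply: mulr_gt0; lra.
by lra.
Qed.

Lemma nb_pair v w : v \in W -> size (nb v) = 2%N -> w \in nb v ->
  2 * c *: v - w \in nb v /\ forall x, x \in nb v -> x = w \/ x = 2 * c *: v - w.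
Proof.
move=> vW s2; have := nb_sum c hW irr vW; rewrite s2.
case: (nb v) s2 => [|a [|b []]] //= _; rewrite !big_cons big_nil addr0 => <-.
rewrite !inE => /orP[]/eqP ->.
  by rewrite addrC addKr eqxx orbT; split=> // x /[!inE] /orP[]/eqP; [left | right].
by rewrite addrK eqxx; split=> // x /[!inE] /orP[]/eqP; [right | left].
Qed.

(** Passing from neighbour to neighbour stays on one great circle in steps of the angle t with cos t
    = c, and a vertex off its plane starts a second circle. Near a common point [y] of the two
    circles each has a vertex within t / 2. Distinct vertices of this kind would have to be on
    opposite sides of [y] on one great circle, which is impossible since the two planes differ; a
    common vertex would have its neighbours on both circles. *)
Lemma nb_sizeN2 : ~ (forall v, v \in W -> size (nb v) = 2%N).
Proof.
have [c1 cN1 _ _] := hc.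
move=> s2.
pose inC n p := [/\ p \in W, dot p n = 0 & forall q, q \in nb p -> dot q n = 0].
have in_step n p q : inC n p -> q \in nb p -> inC n q.
  move=> [pW pn qn] qp; have [qW pq] := nbP qp; split=> //; first exact: qn.
  have pq' : p \in nb q by apply: nb_intro; rewrite // dotC.
  move=> x xq; have [_ h] := nb_pair qW (s2 q qW) pq'.
  by case: (h x xq) => ->; rewrite ?dotL pn ?(qn q) //; ring.
have in_start v w : v \in W -> w \in nb v -> inC (cross v w) v.
  move=> vW wv; have [_ h] := nb_pair vW (s2 v vW) wv.
  split=> //; first by rewrite dotC dot_crossl.
  move=> q /h[] ->; first by rewrite dotC dot_crossr.
  by rewrite !dotL 2!(dotC _ (cross _ _)) dot_crossl dot_crossr; ring.
have near n p0 y : n != 0 -> inC n p0 -> dot y y = 1 -> dot y n = 0 ->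
    exists p, [/\ inC n p, 0 <= dot y p & 1 + c <= 2 * dot y p ^+ 2].
  move=> n0 p0C yy yn.
  pose s := [seq p <- W | `[< inC n p >]].
  have sP p : p \in s -> inC n p by rewrite mem_filter => /andP[/asboolP].
  have sI p : inC n p -> p \in s.
    by move=> pC; rewrite mem_filter; apply/andP; split; [apply/asboolP | case: pC].
  have [|p ps pm] := @seq_argmax R _ (dot y) s.
    by apply/eqP => s0; have := sI _ p0C; rewrite s0.
  have pC := sP _ ps; have [pW pn qn] := pC.
  have [q qW pq] := md_att hc pW.
  have qp : q \in nb p by apply: nb_intro.
  have [q'p _] := nb_pair pW (s2 p pW) qp.
  (* Neither of the two neighbours of [p] is closer to [y] than [p], and [y], [p], [q] are coplanar,
     so their Gram determinant vanishes; this puts [y] within half a step of [p]. *)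
  have := pm _ (sI _ (in_step _ _ _ pC qp)).
  have := pm _ (sI _ (in_step _ _ _ pC q'p)).
  have := gram3 y p q; rewrite (coplanar n0 yn pn (qn q qp)) yy pq.
  rewrite !(th_unit hW) // !dotL.
  set m := dot y p; set g := dot y q => e l1 l2.
  have m0 : 0 <= m by rewrite -(pmulr_rge0 (x := 1 - c)); lra.
  exists p; split=> //.
  have {}e : (1 - c) * ((1 + c) * (1 - m ^+ 2)) = (g - c * m) ^+ 2 by lra.
  have : (g - c * m) ^+ 2 <= (m - c * m) ^+ 2.
    rewrite -ler_sqrt_abs || rewrite -subr_ge0 subr_sqr; apply: mulr_ge0; lra.
  rewrite -e (_ : (m - c * m) ^+ 2 = (1 - c) * ((1 - c) * m ^+ 2)); last by ring.
  rewrite ler_pM2l; last by lra.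
  by rewrite -/m; lra.
have [v vW] : exists v, v \in W.
  by move: (th_neq0 hW); case: (W) => // x s _; exists x; rewrite mem_head.
have [w wW vw] := md_att hc vW; have wv : w \in nb v by apply: nb_intro.
pose n := cross v w; have n0 : n != 0 by exact: (cross_nb_neq0 hW hc vW wv).
have [z zW zn] : exists2 z, z \in W & dot z n != 0.
  apply: contrapT => h; case/eqP: n0; apply: (th_span hW) => z zW.
  by apply: contrapT => /eqP nz; apply: h; exists z; rewrite // dotC.
have [w' wW' zw'] := md_att hc zW; have wz : w' \in nb z by apply: nb_intro.
pose n' := cross z w'; have n0' : n' != 0 by exact: (cross_nb_neq0 hW hc zW wz).
pose N := cross n n'.
have N0 : N != 0.
  apply/eqP => /cross_eq0 /(congr1 (dot z)); rewrite !dotZr.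
  rewrite (dotC z n') dot_crossl mulr0 => /eqP.
  by rewrite mulf_eq0 dot_eq0 (negPf n0') (negPf zn).
pose y := (enorm N)^-1 *: N.
have yy : dot y y = 1 by apply: normalize.
have yn : dot y n = 0 by rewrite dotZl dot_crossl mulr0.
have yn' : dot y n' = 0 by rewrite dotZl dot_crossr mulr0.
have Ny : N = enorm N *: y.
  by rewrite scalerA mulfV ?scale1r // sqrtr_eq0 -ltNge dot_gt0.
clearbody y.
have [p [pC m0 m2]] := near _ _ _ n0 (in_start _ _ vW wv) yy yn.
have [p' [pC' m0' m2']] := near _ _ _ n0' (in_start _ _ zW wz) yy yn'.
have [[pW pn qn] [pW' pn' qn']] := (pC, pC').
have [pp|pp] := eqVneq p p'.
  have [q qW pq] := md_att hc pW.
  have qp : q \in nb p by apply: nb_intro.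
  have par x : dot x n = 0 -> dot x n' = 0 -> dot N N *: x = dot x N *: N.
    by move=> xn xn'; rewrite cross_decomp xn xn' !scale0r !addr0.
  have ep := par p pn (etrans (congr1 (fun x => dot x n') pp) pn').
  have eq : dot N N *: q = dot q N *: N by apply/par/qn'; rewrite -?pp ?qn.
  have NN : dot N N != 0 by rewrite dot_eq0.
  have prod x x' : dot N N *: x = dot x N *: N -> dot N N *: x' = dot x' N *: N ->
      dot N N * dot x x' = dot x N * dot x' N.
    move=> ex ex'; apply: (mulfI NN).
    have := congr1 (dot x') ex; rewrite !dotZr (dotC x' x).
    by move=> ->; ring.
  have e1 := prod _ _ ep ep; have e2 := prod _ _ eq eq; have e3 := prod _ _ ep eq.
  move: e1 e2 e3; rewrite (th_unit hW pW) (th_unit hW qW) pq => e1 e2 e3.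
  have h : (dot N N * c) ^+ 2 = (dot N N) ^+ 2.
    by rewrite e3 exprMn -[in RHS](mulr1 (dot N N)) exprMn expr1n !expr2 -e1 -e2; ring.
  have : dot N N ^+ 2 * ((1 - c) * (1 + c)) = 0 by lra.
  move/eqP; rewrite mulf_eq0 sqrf_eq0 (negPf NN) mulf_eq0 /= => /orP[]/eqP; lra.
have ppc := md_max hc pW pW' pp.
pose a := p - dot y p *: y; pose b := p' - dot y p' *: y.
have aa : dot a a = 1 - dot y p ^+ 2.
  by rewrite /a !dotL yy (th_unit hW pW) (dotC p y); ring.
have bb : dot b b = 1 - dot y p' ^+ 2.
  by rewrite /b !dotL yy (th_unit hW pW') (dotC p' y); ring.
have ab : dot a b = dot p p' - dot y p * dot y p'.
  by rewrite /a /b !dotL yy (dotC p y); ring.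
have an : dot a n = 0 by rewrite /a !dotL pn yn; ring.
have bn' : dot b n' = 0 by rewrite /b !dotL pn' yn'; ring.
have ay : dot a y = 0 by rewrite /a !dotL yy (dotC p y); ring.
clearbody a b.
have mm : (1 + c) / 2 <= dot y p * dot y p'.
  rewrite -(ler_pXn2r (n := 2)) ?nnegrE //; [|lra|exact: mulr_ge0].
  rewrite [leRHS]exprMn [leLHS]expr2; apply: ler_pM; lra.
have := dot_ge0 (a + b); rewrite !dotL (dotC b a) aa bb ab => h.
have ab0 : dot (a + b) (a + b) = 0 by rewrite !dotL (dotC b a) aa bb ab; lra.
have ayb : a = - b by apply: eq_dotB; rewrite opprK.
have an' : dot a n' = 0 by rewrite ayb dotNl bn' oppr0.
have aN : dot a N = 0 by rewrite Ny dotZr ay mulr0.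
have a0 : a = 0 by apply: (eq_of_dots N0); rewrite dot0l.
by move: aa; rewrite a0 dot0l; lra.
Qed.

Section Degree3.
Hypothesis k3 : forall v, v \in W -> size (nb v) = 3%N.

(** Multiplying the relation [nb_sum] by each of the three neighbours gives three linear equations
    for their mutual inner products, whose solution is the same value three times. *)
Lemma nb3 v w x : v \in W -> w \in nb v -> x \in nb v -> w != x ->
  3 * c *: v - w - x \in nb v /\ dot w x = (3 * c ^+ 2 - 1) / 2.
Proof.
have gen a b d : v \in W -> a \in nb v -> b \in nb v -> d \in nb v ->
    a + (b + d) = 3 * c *: v ->
    [/\ dot a b = (3 * c ^+ 2 - 1) / 2, dot a d = (3 * c ^+ 2 - 1) / 2 &
        dot b d = (3 * c ^+ 2 - 1) / 2].
  move=> vW /nbP[aW va] /nbP[bW vb] /nbP[dW vd] e.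
  have := congr1 (dot a) e; have := congr1 (dot b) e; have := congr1 (dot d) e.
  rewrite !dotL !(dotC _ v) va vb vd !(th_unit hW) // (dotC b a) (dotC d a) (dotC d b).
  by split; lra.
move=> vW; have := k3 vW; have := nb_sum c hW irr vW.
case e: (nb v) => [|a [|b [|d []]]] //= sE _.
have /= [] := gen a b d vW; rewrite ?e ?inE ?eqxx ?orbT //.
  by rewrite -sE !big_cons big_nil addr0.
move=> ab ad bd; move: sE; rewrite !big_cons big_nil addr0 => <-.
move=> /or3P[]/eqP-> /or3P[]/eqP->; rewrite ?eqxx // => _;
rewrite ?(dotC b a) ?(dotC d a) ?(dotC d b); split=> //.
all: apply/or3P.
- by apply: Or33; apply/eqP/rowP => i; rewrite !mxE; ring.
- by apply: Or32; apply/eqP/rowP => i; rewrite !mxE; ring.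
- by apply: Or33; apply/eqP/rowP => i; rewrite !mxE; ring.
- by apply: Or31; apply/eqP/rowP => i; rewrite !mxE; ring.
- by apply: Or32; apply/eqP/rowP => i; rewrite !mxE; ring.
- by apply: Or31; apply/eqP/rowP => i; rewrite !mxE; ring.
Qed.

(** This is [mirror] along the edge from [b] to [d], with the third neighbour of [b] as second
    point: [a] is reflected in the bisecting plane of [b] and [d] and becomes the next vertex of a
    planar path. The factor is (c - a.d) / (1 - c) with a.d taken from [nb3]. *)
Lemma path3 a b d : b \in W -> a \in nb b -> d \in nb b -> a != d ->
  let x := a + ((1 + 3 * c) / 2) *: (d - b) in x \in nb d /\ b != x.
Proof.
have [c1 cN1 _ _] := hc.
move=> bW an dn ad x.
have [a'n dad] := nb3 bW an dn ad.
have [aW ba] := nbP an; have [dW bd] := nbP dn.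
have [[bb aa] dd] := (th_unit hW bW, th_unit hW aW, th_unit hW dW).
have da1 : dot a d < 1 by apply: unit_dot_lt1.
have xE : x = a + ((c - dot a d) / (1 - c)) *: (d - b).
  rewrite /x dad; congr (_ + _ *: _).
  by field; rewrite subr_eq0 gt_eqF.
split; last first.
  apply: contraTneq da1 => /(congr1 (dot b)); rewrite xE !dotL bb ba bd.
  have h : (c - dot a d) / (1 - c) * (1 - c) = c - dot a d by rewrite divfK //; lra.
  by rewrite -leNgt; lra.
rewrite xE; apply: (mirror hW hc bW dn an a'n).
  apply: contraTneq da1 => e.
  have := congr1 (dot a) e; rewrite !dotL aa (dotC a b) ba.
  by rewrite dad -leNgt; lra.
by rewrite !dotL dd bd dad; field.
Qed.

(** The squared distances from [p0] to [p3] and [p5] on a path are t^2 and (1 - s - s^2)^2 times the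
    least one, 2(1 - c), so each factor is zero or at least 1. What remains is t = 0, s = 0 or s^2 +
    s = 1: the path closes up after three, four or five steps. *)
Lemma degree3 : c = - (1 / 3) \/ c = 1 / 3 \/
  let s := (3 * c - 1) / 2 in 0 < s /\ s ^+ 2 + s = 1.
Proof.
have [c1 cN1 _ _] := hc.
have [v vW] : exists v, v \in W.
  by move: (th_neq0 hW); case: (W) => // x s _; exists x; rewrite mem_head.
have [p0 [p2 [p0n p2n p02]]] : exists x y, [/\ x \in nb v, y \in nb v & x != y].
  move: (k3 vW) (nb_uniq c hW v); case: (nb v) => [|x [|y s]] //= _ /andP[xs _].
  exists x, y; rewrite !inE !eqxx orbT; split=> //.
  by apply: contraNneq xs => ->; rewrite mem_head.
set t := (1 + 3 * c) / 2; pose p3 := p0 + t *: (p2 - v).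
have [p0W v0] := nbP p0n; have [p2W v2] := nbP p2n.
have [p3n p23] : p3 \in nb p2 /\ v != p3 := path3 vW p0n p2n p02.
have [p3W _] := nbP p3n.
have vn : v \in nb p2 by apply: nb_intro => //; rewrite dotC.
pose p4 := v + t *: (p3 - p2).
have [p4n p34] : p4 \in nb p3 /\ p2 != p4 := path3 p2W vn p3n p23.
have [p4W _] := nbP p4n.
have p2n3 : p2 \in nb p3 by apply: nb_intro => //; rewrite dotC; case: (nbP p3n).
pose p5 := p2 + t *: (p4 - p3).
have [p5n _] : p5 \in nb p4 /\ p3 != p5 := path3 p3W p2n3 p4n p34.
have [p5W _] := nbP p5n.
have [_ e] := nb3 vW p0n p2n p02.
have D0 : 0 < 2 * (1 - c) by lra.
have sep x : x \in W -> dot (x - p0) (x - p0) = 0 \/ 2 * (1 - c) <= dot (x - p0) (x - p0).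
  move=> xW; have [->|h] := separated hc xW p0W; first by rewrite subrr dot0l; left.
  by right; rewrite dotB !(th_unit hW) //; lra.
have [[vv d0] d2] := (th_unit hW vW, th_unit hW p0W, th_unit hW p2W).
have gram : (dot v p0 = c) * (dot p0 v = c) * (dot v p2 = c) * (dot p2 v = c) *
   (dot p0 p2 = (3 * c ^+ 2 - 1) / 2) * (dot p2 p0 = (3 * c ^+ 2 - 1) / 2) *
   (dot v v = 1) * (dot p0 p0 = 1) * (dot p2 p2 = 1).
  by rewrite !(dotC _ v) (dotC p2) v0 v2 e vv d0 d2.
have := sep _ p3W; rewrite (_ : dot _ _ = t ^+ 2 * (2 * (1 - c))); last first.
  by rewrite /p3 !dotL !gram /t; field.
have := sep _ p5W; pose s := t - 1.
rewrite (_ : dot _ _ = (1 - s - s ^+ 2) ^+ 2 * (2 * (1 - c))); last first.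
  by rewrite /p5 /p4 /p3 !dotL !gram /s /t; field.
have le1 (k : R) : 2 * (1 - c) <= k * (2 * (1 - c)) -> 1 <= k.
  by rewrite -{1}(mul1r (2 * (1 - c))) ler_pM2r.
move=> h5 [/eqP|/le1 h3].
  rewrite mulf_eq0 (gt_eqF D0) orbF sqrf_eq0 => /eqP t0; left.
  by move: t0; rewrite /t; lra.
have t1 : 1 <= t.
  have : 0 < t + 1 by rewrite /t; lra.
  by move=> t0; rewrite -subr_ge0 -(pmulr_lge0 _ t0); lra.
have sE : (3 * c - 1) / 2 = s by rewrite /s /t; lra.
right; have [s0|s0] := eqVneq s 0.
  by left; move: s0; rewrite -sE; lra.
have sp : 0 < s by rewrite lt_neqAle eq_sym s0 /s; lra.
right; rewrite sE; split=> //.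
have s1 : s < 1 by rewrite -sE; lra.
case: h5 => [/eqP|/le1 h5].
  by rewrite mulf_eq0 (gt_eqF D0) orbF sqrf_eq0 => /eqP; lra.
have s2 : s ^+ 2 < s by rewrite expr2 gtr_pMr.
have : (1 - s - s ^+ 2 - 1) * (1 - s - s ^+ 2 + 1) < 0.
  by rewrite pmulr_llt0 ?oppr_lt0; have := sqr_ge0 s; lra.
by lra.
Qed.

End Degree3.
End SmallDegree.

(** Meant for the five neighbours of a vertex, among which unique partners are impossible by
    parity. *)
Lemma perfect_matching_even (T : eqType) (r : rel T) (s : seq T) : symmetric r ->
  uniq s -> (forall x, x \in s -> exists2 y, [/\ y \in s, y != x & r x y] &
    forall z, z \in s -> z != x -> r x z -> z = y) -> ~~ odd (size s).
Proof.
move=> rsym; have [n] := ubnP (size s); elim: n s => // n IH [|x s1] //= sn.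
move=> /andP[xs u1] h.
have [|y [ys yx rxy] yu] := h x; first exact: mem_head.
have {}ys : y \in s1 by move: ys; rewrite inE (negPf yx).
have u2 : uniq (rem y s1) by apply: rem_uniq.
have mem z : (z \in rem y s1) = (z != y) && (z \in s1) by rewrite mem_rem_uniq ?inE.
have s1E : size s1 = (size (rem y s1)).+1.
  by rewrite size_rem //; case: (s1) ys.
rewrite s1E /= negbK; apply: IH => //; first by rewrite s1E in sn; apply: ltnW.
move=> z; rewrite mem => /andP[zy zs].
have zx : z != x by apply: contraNneq xs => <-.
have [|y' [ys' yz rzy] yu'] := h z; first by rewrite inE zs orbT.
have y'x : y' != x.
  apply: contraNneq zy => e; apply/eqP/yu; rewrite ?inE ?zs ?orbT //.
  by rewrite rsym -e.
have y'y : y' != y.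
  apply: contraNneq zx => e; rewrite e in rzy.
  have [|y'' _ yu''] := h y; first by rewrite inE ys orbT.
  apply/eqP; transitivity y''.
    by apply: yu''; rewrite ?inE ?zs ?orbT // rsym.
  by apply/esym/yu''; rewrite ?inE ?eqxx // 1?eq_sym // rsym.
exists y'.
  by split=> //; rewrite mem y'y /=; move: ys'; rewrite inE (negPf y'x).
move=> q; rewrite mem => /andP[qy qs] qz rzq; apply: yu' => //.
by rewrite inE qs orbT.
Qed.

(** * Vertices with four nearest neighbours *)

Section Degrees45.
Variable R : realType.
Implicit Types (u v w x y z n p q : 'rV[R]_3) (A : 'M[R]_3).
Variables (W : seq 'rV[R]_3) (c : R).
Hypotheses (hW : two_homogeneous W) (hc : min_dot W c).
Hypothesis irr : forall v q, v \in W ->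
  (forall A, symmetry_of W A -> v *m A = v -> q *m A = q) ->
  exists k, q = k *: v.

Local Notation nb := (nb W c).

Lemma nb_coplanar v x y z : v \in W -> x \in nb v -> y \in nb v -> z \in nb v ->
  dot (x - c *: v) (cross (y - c *: v) (z - c *: v)) = 0.
Proof.
move=> vW xn yn zn; have vv := th_unit hW vW.
have v0 : v != 0 by rewrite -dot_gt0 vv.
have h p : p \in nb v -> dot (p - c *: v) v = 0.
  by move=> /nbP[_ vp]; rewrite !dotL dotC vp vv; ring.
by apply: (coplanar v0); apply: h.
Qed.

(** Subtracting [c *: v] projects the neighbours to the plane orthogonal to [v], where the Gram
    determinant of three vectors vanishes; [s], [a], [b], [d] are its entries. *)
Lemma nb_gram v x y z : v \in W -> x \in nb v -> y \in nb v -> z \in nb v ->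
  let s := 1 - c ^+ 2 in
  let a := dot x y - c ^+ 2 in let b := dot x z - c ^+ 2 in let d := dot y z - c ^+ 2 in
  s ^+ 3 + 2 * a * b * d - s * (a ^+ 2 + b ^+ 2 + d ^+ 2) = 0.
Proof.
move=> vW xn yn zn s a b d.
have udot p q : p \in nb v -> q \in nb v ->
    dot (p - c *: v) (q - c *: v) = dot p q - c ^+ 2.
  move=> /nbP[_ vp] /nbP[_ vq].
  by rewrite !dotL (th_unit hW vW) (dotC p v) vp vq; ring.
have := gram3 (x - c *: v) (y - c *: v) (z - c *: v).
rewrite (nb_coplanar vW xn yn zn) !udot //.
have [[xW _] [[yW _] [zW _]]] := (nbP xn, (nbP yn, nbP zn)).
rewrite !(th_unit hW) // -/s -/a -/b -/d => e.
by rewrite expr2 mul0r in e; rewrite [RHS]e; ring.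
Qed.

Lemma nb_sigma : 0 < 1 - c ^+ 2.
Proof.
have [c1 cN1 _ _] := hc.
by have : 0 < (1 - c) * (1 + c) by [apply: mulr_gt0; lra]; lra.
Qed.

Section Degree4.
Hypothesis k4 : forall v, v \in W -> size (nb v) = 4%N.

(** Four plane vectors of equal length with sum zero form a rhombus. Algebraically, the Gram
    determinant of three of them factors, and each factor makes the projection of [a] opposite to
    that of [b], [d] or [f]. *)
Lemma antipode4 v a b d f : v \in W -> a \in nb v -> b \in nb v -> d \in nb v ->
  f \in nb v -> a + (b + (d + f)) = 4 * c *: v -> 2 * c *: v - a \in nb v.
Proof.
move=> vW an bn dn fn e.
have [[aW va] [[bW vb] [[dW vd] [fW vf]]]] := (nbP an, (nbP bn, (nbP dn, nbP fn))).
have ea := congr1 (dot a) e; have eb := congr1 (dot b) e.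
have ed := congr1 (dot d) e; have ef := congr1 (dot f) e.
have := nb_gram vW an bn dn; have s0 := nb_sigma.
move: ea eb ed ef; rewrite !dotL !(dotC _ v) va vb vd vf !(th_unit hW) //.
rewrite (dotC b a) (dotC d a) (dotC f a) (dotC d b) (dotC f b) (dotC f d).
move=> ea eb ed ef /=.
have anti x : x \in nb v -> dot a x = 2 * c ^+ 2 - 1 -> 2 * c *: v - a \in nb v.
  move=> xn ax; suff -> : 2 * c *: v - a = x by [].
  have [xW vx] := nbP xn.
  apply: eq_dotB; rewrite !dotL !(dotC _ v) va vx (dotC x a) ax !(th_unit hW) //.
  by ring.
set s := 1 - c ^+ 2; set x := dot a b - _; set y := dot a d - _; set z := dot b d - _.
have -> : z = - s - x - y by rewrite /s /x /y /z; lra.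
rewrite (_ : _ - _ = 2 * ((s + x) * (s + y) * (- x - y))); last by ring.
move/eqP; rewrite !mulf_eq0 pnatr_eq0 /= => /orP[/orP[]|]/eqP h.
- by apply: (anti b) => //; move: h; rewrite /s /x; lra.
- by apply: (anti d) => //; move: h; rewrite /s /y; lra.
- by apply: (anti f) => //; move: h; rewrite /x /y; lra.
Qed.

Lemma nb4_antipode v w : v \in W -> w \in nb v -> 2 * c *: v - w \in nb v.
Proof.
move=> vW; have [a [b [d [f e]]]] : exists a b d f, nb v = [:: a; b; d; f].
  move: (k4 vW); case: (nb v) => [|a [|b [|d [|f []]]]] // _.
  by exists a, b, d, f.
have sE := nb_sum c hW irr vW.
rewrite k4 // e !big_cons big_nil addr0 in sE.
have [an bn dn fn] : [/\ a \in nb v, b \in nb v, d \in nb v & f \in nb v].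
  by rewrite e !inE !eqxx ?orbT.
rewrite {1}e !inE => /or4P[]/eqP->.
- by apply: (@antipode4 v a b d f).
- by apply: (@antipode4 v b a d f) => //; rewrite -sE addrCA.
- by apply: (@antipode4 v d a b f) => //; rewrite -sE addrCA; congr (_ + _); rewrite addrCA.
- apply: (@antipode4 v f a b d) => //; rewrite -sE addrC -!addrA.
  by [].
Qed.

Lemma nb4_all v w w1 : v \in W -> w \in nb v -> w1 \in nb v -> w1 != w ->
  w1 != 2 * c *: v - w ->
  forall x, x \in nb v -> x \in [:: w; 2 * c *: v - w; w1; 2 * c *: v - w1].
Proof.
move=> vW wn w1n w1w w1w' x xn.
have s0 := nb_sigma.
have ne y : y \in nb v -> y != 2 * c *: v - y.
  move=> /nbP[yW vy]; apply: contraTneq s0 => /(congr1 (dot y)).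
  by rewrite !dotL (th_unit hW) // dotC vy -leNgt; lra.
set s := [:: _; _; _; _].
have us : uniq s.
  rewrite /= !inE !negb_or ne // ne // (eq_sym w) w1w /= andbT.
  rewrite (eq_sym _ w1) w1w' /=.
  have e y z : (y == 2 * c *: v - z) = (z == 2 * c *: v - y).
    by rewrite eq_sym subr_eq addrC -subr_eq eq_sym.
  by rewrite e w1w' /= (inj_eq (addrI _)) (inj_eq oppr_inj) eq_sym.
have ss : {subset s <= nb v}.
  by move=> y; rewrite !inE => /or4P[]/eqP ->; rewrite ?wn ?w1n ?nb4_antipode.
have [|_ ->] // := uniq_min_size us ss.
by rewrite k4.
Qed.

(** A symmetry exchanging [v] and [w0] sends [w1] either to its mirror image [xs] in their bisecting
    plane or to its image [xo] under the half-turn about [v + w0]. Unless the inner product is [c],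
    [xs] is too close to [w1], and so is the neighbour of [w0] opposite to [xo]. *)
Lemma rectangle4 v w0 w1 : v \in W -> w0 \in nb v -> w1 \in nb v -> w1 != w0 ->
  c ^+ 2 < dot w0 w1 -> dot w0 w1 = c.
Proof.
have [c1 cN1 _ _] := hc.
move=> vW w0n w1n ne; set e := dot w0 w1 => ce.
have [w0W v0] := nbP w0n; have [w1W v1] := nbP w1n.
have ec : e <= c by apply: md_max hc _ _ _ _ _; rewrite // eq_sym.
have e1 : e < 1 by lra.
have s0 := nb_sigma.
have [[vv d0] d1] := (th_unit hW vW, th_unit hW w0W, th_unit hW w1W).
have G : (dot v w0 = c) * (dot w0 v = c) * (dot v w1 = c) * (dot w1 v = c) *
   (dot w0 w1 = e) * (dot w1 w0 = e) * (dot v v = 1) * (dot w0 w0 = 1) * (dot w1 w1 = 1).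
  by rewrite !(dotC _ v) (dotC w1) v0 v1 vv d0 d1.
have [A [sA vA wA]] := th_swap hW vW w0W.
pose x := w1 *m A.
have xW : x \in W by apply: sA.2.
have xv : dot x v = e by rewrite /x -wA dot_orth ?G //; apply: sA.1.
have xw : dot x w0 = c by rewrite /x -vA dot_orth ?G //; apply: sA.1.
have xx := th_unit hW xW.
clearbody x.
pose t := (c - e) / (1 - c).
have c10 : 1 - c != 0 by rewrite subr_eq0 gt_eqF.
have c11 : 1 + c != 0 by rewrite gt_eqF //; lra.
have te : t * (1 - c) = c - e by rewrite divfK.
have t0 : 0 <= t by rewrite divr_ge0 //; lra.
clearbody t.
have ee : e = c - t * (1 - c) by lra.
pose xs := w1 + t *: (w0 - v).
pose xo := ((c + e) / (1 + c)) *: (v + w0) - w1.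
have n0 := cross_nb_neq0 hW hc vW w0n.
have xsv : dot xs v = e by rewrite /xs !dotL !G; lra.
have xsw : dot xs w0 = c by rewrite /xs !dotL !G; lra.
have xsx : dot xs xs = 1 by rewrite /xs !dotL !G ee; ring.
have [h|h] : dot x (cross v w0) = dot xs (cross v w0) \/
    dot x (cross v w0) = - dot xs (cross v w0).
- by apply: dot_cross_sqr_eq; rewrite ?xx ?xsx ?xv ?xsv ?xw ?xsw.
- have xE : x = xs by apply: (eq_of_dots n0); rewrite ?xv ?xw ?xsv ?xsw.
  have [e'|] := separated hc xW w1W.
    have : dot xs w0 = dot w1 w0 by rewrite -xE e'.
    by rewrite xsw G.
  rewrite xE /xs !dotL !G => l.
  have t1 : t < 1.
    rewrite -subr_gt0 -(pmulr_lgt0 (1 - t) (x := 1 - c)); last by lra.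
    by have := sqr_ge0 (1 - c); lra.
  have : 0 < (1 - t) * (1 + t) * (1 - c) by rewrite !mulr_gt0 //; lra.
  have : t * (t * (1 - c)) = t * (c - e) by rewrite te.
  by lra.
- have xE : x = xo.
    have k : (c + e) / (1 + c) * (1 + c) = c + e by rewrite divfK.
    apply: (eq_of_dots n0); rewrite ?xv ?xw ?h /xo /xs !dotL ?G; [lra|lra|].
    rewrite (dotC w0) (dotC v (cross _ _)) dot_crossl dot_crossr; ring.
  have w0n' : v \in nb w0 by apply: nb_intro; rewrite // G.
  have xn : x \in nb w0 by apply: nb_intro; rewrite // dotC.
  have x'n := nb4_antipode w0W xn; have [x'W _] := nbP x'n.
  have [e'|] := separated hc w1W x'W.
    have := congr1 (dot v) e'; have := congr1 (dot w0) e'.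
    by rewrite !dotL !G (dotC w0 x) (dotC v x) xw xv => h1 h2; lra.
  rewrite xE /xo !dotL !G => l.
  have : 0 < (1 - e) * (1 + e - 2 * c ^+ 2) by apply: mulr_gt0; lra.
  have k : (c + e) / (1 + c) * (1 + c) = c + e by rewrite divfK.
  set r := (c + e) / (1 + c) in l k.
  have cp : 0 < 1 + c by lra.
  have : (1 + c) * (2 * c * e - (r * (c + e) - 1)) <= (1 + c) * c.
    by rewrite ler_pM2l //; lra.
  have -> : (1 + c) * (2 * c * e - (r * (c + e) - 1)) =
     2 * c * e * (1 + c) - (r * (1 + c)) * (c + e) + (1 + c) by ring.
  by rewrite k !expr2; lra.
Qed.

(** If the projected neighbours form a square, [mirror] moves [w1] by too little unless it does not
    move it at all, which means c = 0. Otherwise the acute pairs are nearest neighbours by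
    [rectangle4], and a further symmetry determines [c]. *)
Lemma degree4 : exists v w0 w1, [/\ v \in W, w0 \in W, w1 \in W &
  [/\ dot v w0 = c, dot v w1 = c, dot w0 w1 = c & c = 0 \/ c = 1 / 2]].
Proof.
have [c1 cN1 _ _] := hc; have s0 := nb_sigma.
have [v vW] : exists v, v \in W.
  by move: (th_neq0 hW); case: (W) => // x s _; exists x; rewrite mem_head.
have [w0 w0W v0] := md_att hc vW; have w0n : w0 \in nb v by apply: nb_intro.
have [w1 [w1n w10 w10']] : exists x, [/\ x \in nb v, x != w0 & x != 2 * c *: v - w0].
  apply: contrapT => h.
  have : (size (nb v) <= size [:: w0; (2 * c *: v - w0)%R])%N.
    apply: uniq_leq_size (nb_uniq c hW v) _ => x xn; rewrite !inE.
    apply: contrapT => /negP; rewrite negb_or => /andP[x1 x2].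
    by apply: h; exists x.
  by rewrite k4.
have [w1W v1] := nbP w1n.
have [vv d0] := (th_unit hW vW, th_unit hW w0W); have d1 := th_unit hW w1W.
have [e|ne] := eqVneq (dot w0 w1) (c ^+ 2).
  have w1n' := nb4_antipode vW w1n.
  have t : (c - c ^+ 2) / (1 - c) = c by field; rewrite subr_eq0 gt_eqF.
  have /nbP[zW _] : w1 + c *: (w0 - v) \in nb w0.
    have := mirror hW hc vW w0n w1n w1n'; rewrite (dotC w1) e t; apply.
      apply: contraTneq s0 => /(congr1 (dot w1)).
      by rewrite !dotL d1 (dotC w1 v) v1 -leNgt; lra.
    by rewrite !dotL v0 (dotC w1) e; ring.
  have [ze|] := separated hc zW w1W.
    have : dot (w1 + c *: (w0 - v)) w0 = dot w1 w0 by rewrite ze.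
    rewrite !dotL d0 v0 (dotC w1) e => h.
    have {}h : c * (1 - c) = 0 by lra.
    move/eqP: h; rewrite mulf_eq0 subr_eq0 (gt_eqF c1) orbF => /eqP c0.
    by exists v, w0, w1; split=> //; split=> //; rewrite ?e c0 ?expr2 ?mul0r //; left.
  rewrite !dotL d1 e v1 => l.
  have : 0 < (1 - c) * (1 - c ^+ 2) by apply: mulr_gt0; lra.
  by rewrite !expr2; lra.
(* The two directions of a line through w0 are exchanged if necessary. *)
have {w1 w1n w10 w10' w1W v1 d1 ne} [w1 [w1n w10 w10' ce]] : exists x,
    [/\ x \in nb v, x != w0, x != 2 * c *: v - w0 & c ^+ 2 < dot w0 x].
  move: ne; rewrite neq_lt => /orP[ne|ne]; last by exists w1.
  exists (2 * c *: v - w1); split; first exact: nb4_antipode.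
  - by apply: contraNneq w10' => <-; rewrite opprB addrC subrK.
  - by rewrite (inj_eq (addrI _)) (inj_eq oppr_inj).
  - by rewrite !dotL (dotC w0 v) v0; lra.
have e := rectangle4 vW w0n w1n w10 ce.
have [w1W v1] := nbP w1n; have d1 := th_unit hW w1W.
exists v, w0, w1; split=> //; split=> //; right.
have c0 : 0 < c by rewrite e in ce; have := sqr_ge0 c; lra.
have G : (dot v w0 = c) * (dot w0 v = c) * (dot v w1 = c) * (dot w1 v = c) *
   (dot w0 w1 = c) * (dot w1 w0 = c) * (dot v v = 1) * (dot w0 w0 = 1) * (dot w1 w1 = 1).
  by rewrite !(dotC _ v) (dotC w1) v0 v1 vv d0 d1 e.
have step x y : x \in W -> y \in W -> dot x y = c -> 2 * c *: y - x \in W.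
  move=> xW yW xy; have xn : x \in nb y by apply: nb_intro; rewrite // dotC.
  by case: (nbP (nb4_antipode yW xn)).
pose y0 := 2 * c *: w0 - v; pose z0 := 2 * c *: w0 - w1.
have y0W : y0 \in W by apply: step; rewrite ?G.
have z0W : z0 \in W by apply: step; rewrite ?G.
(* Repeated opposites produce two vertices with equal inner products with [v]. A symmetry fixing [v]
   carries [a1] to [a2] and permutes the four neighbours; each of the sixteen possible images of
   [w0] and [w1] is contradictory or gives c = 1/2. *)
pose a1 := 2 * c *: z0 - w0; pose a2 := 2 * c *: y0 - z0.
have a1W : a1 \in W by apply: step => //; rewrite /z0 !dotL !G; ring.
have a2W : a2 \in W by apply: step => //; rewrite /z0 /y0 !dotL !G; ring.
have [|A [sA vA aA]] := th_hom hW vW a1W vW a2W _.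
  by rewrite /a1 /a2 /z0 /y0 !dotL !G; ring.
have n0 : w0 *m A \in nb v by apply: nb_sym_closed.
have n1 : w1 *m A \in nb v by apply: nb_sym_closed.
have d01 : dot (w0 *m A) (w1 *m A) = c by rewrite dot_orth ?G //; apply: sA.1.
have a1E : a1 *m A = (4 * c ^+ 2 - 1) *: (w0 *m A) - (2 * c) *: (w1 *m A).
  have -> : a1 = (4 * c ^+ 2 - 1) *: w0 - (2 * c) *: w1.
    by apply/rowP => i; rewrite !mxE; ring.
  by rewrite mulmxBl !scalemxAl.
have E0 : (4 * c ^+ 2 - 1) * dot w0 (w0 *m A) - 2 * c * dot w0 (w1 *m A) = 2 * c ^+ 2 - c.
  by have := congr1 (dot w0) (etrans (esym a1E) aA); rewrite /a2 /y0 /z0 !dotL !G => ->; ring.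
have E1 : (4 * c ^+ 2 - 1) * dot w1 (w0 *m A) - 2 * c * dot w1 (w1 *m A) =
    4 * c ^+ 3 - 4 * c ^+ 2 + 1.
  by have := congr1 (dot w1) (etrans (esym a1E) aA); rewrite /a2 /y0 /z0 !dotL !G => ->; ring.
have c1' : 1 - c != 0 by rewrite subr_eq0 gt_eqF.
have all := nb4_all vW w0n w1n w10 w10'.
have absurd r : 0 < r -> r * (1 - c) = 0 -> c = 1 / 2.
  by move=> r0 /eqP; rewrite mulf_eq0 (gt_eqF r0) (negPf c1').
move: (all _ n0) (all _ n1) d01 E0 E1; rewrite !inE.
move=> /or4P[]/eqP-> /or4P[]/eqP->; rewrite ?dotL ?G => d01 E0 E1;
  clear - c0 c1 c1' absurd d01 E0 E1.
- by apply: (absurd 1); lra.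
- by apply: (absurd (2 * c + 1)); lra.
- by apply: (absurd 1); lra.
- by apply: (absurd (2 * c)); lra.
- by apply: (absurd (2 * c + 1)); lra.
- by apply: (absurd 1); lra.
- by apply: (absurd (2 * c)); lra.
- have : (2 * c + 1) ^+ 2 * (2 * c - 1) * (1 - c) = 0 by lra.
  move/eqP; rewrite mulf_eq0 (negPf c1') orbF mulf_eq0 expf_eq0 => /orP[]/eqP; lra.
- by apply: (absurd (2 * c * (2 * c + 1))); [apply: mulr_gt0; lra | lra].
- by apply: (absurd (2 * c)); lra.
- by apply: (absurd 1); lra.
- by apply: (absurd (2 * c + 1)); lra.
- by apply: (absurd (2 * c)); lra.
- by apply: (absurd (8 * c ^+ 3)); [rewrite mulr_gt0 // exprn_gt0 | lra].
- by apply: (absurd (2 * c + 1)); lra.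
- by apply: (absurd 1); lra.
Qed.

End Degree4.
End Degrees45.

(** * Vertices with five nearest neighbours *)

Section Degree5.
Variable R : realType.
Implicit Types (u v w x y z n p q : 'rV[R]_3) (A : 'M[R]_3).
Variables (W : seq 'rV[R]_3) (c : R).
Hypotheses (hW : two_homogeneous W) (hc : min_dot W c).
Hypothesis irr : forall v q, v \in W ->
  (forall A, symmetry_of W A -> v *m A = v -> q *m A = q) ->
  exists k, q = k *: v.

Local Notation nb := (nb W c).

Hypothesis k5 : forall v, v \in W -> size (nb v) = 5%N.

Lemma nb5_transport v x y x' : v \in W -> x \in nb v -> y \in nb v -> x' \in nb v ->
  exists2 y', y' \in nb v & dot x' y' = dot x y.
Proof.
move=> vW /nbP[xW vx] yn /nbP[x'W vx'].
have [|A [sA vA xA]] := th_hom hW vW xW vW x'W _; first by rewrite vx.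
exists (y *m A); first exact: nb_sym_closed.
by rewrite -xA dot_orth //; apply: sA.1.
Qed.

(** If [y] had no such companion, then, the stabilizer of [v] being transitive on its neighbours,
    having this inner product would be a perfect matching of five points. *)
Lemma nb5_partner v x y : v \in W -> x \in nb v -> y \in nb v -> y != x ->
  exists y', [/\ y' \in nb v, y' != y, y' != x & dot x y' = dot x y].
Proof.
move=> vW xn yn yx; apply: contrapT => nex.
have xy1 : dot x y < 1.
  have [[xW _] [yW _]] := (nbP xn, nbP yn).
  by apply: unit_dot_lt1; rewrite ?(th_unit hW) // eq_sym.
have uniq_y z : z \in nb v -> z != x -> dot x z = dot x y -> z = y.
  by move=> zn zx e; apply: contrapT => /eqP zy; apply: nex; exists z.
pose r : rel 'rV[R]_3 := [rel a b | dot a b == dot x y].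
have rs : symmetric r by move=> a b; rewrite /r /= dotC.
have := perfect_matching_even rs (nb_uniq c hW v); rewrite k5 //= => ev.
suff : ~~ true by []. 
apply: ev => a an.
have [aW va] := nbP an; have [xW vx] := nbP xn.
have [b bn ab] := nb5_transport vW xn yn an.
have neq p q : p \in nb v -> dot p q = dot x y -> q != p.
  move=> /nbP[pW _] e; apply: contraTneq xy1 => qp.
  by rewrite -e qp (th_unit hW) // ltxx.
exists b; first by split; [|exact: (neq a)|rewrite /r /= ab].
have [|B [sB vB aB]] := th_hom hW vW aW vW xW _; first by rewrite va.
have mv z : z \in nb v -> dot a z = dot x y -> z *m B = y.
  move=> zn e; have e' : dot x (z *m B) = dot x y.
    by rewrite -aB dot_orth ?e ?aB //; apply: sB.1.
  by apply: uniq_y => //; [apply: nb_sym_closed | apply: (neq x)].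
move=> z zn za /eqP az; apply: (orth_inj sB.1).
by rewrite (mv z) // (mv b).
Qed.

Lemma nb5_two v x y y' z : v \in W -> x \in nb v -> y \in nb v -> y' \in nb v ->
  z \in nb v -> y != y' -> dot x y = dot x y' -> dot x z = dot x y ->
  z = y \/ z = y'.
Proof.
move=> vW xn yn y'n zn yy' e e'.
have [[xW vx] [yW vy]] := (nbP xn, nbP yn).
have [[y'W vy'] [zW vz]] := (nbP y'n, nbP zn).
apply: (nb_unique hW hc vW xn) => //; rewrite ?(th_unit hW) //.
- by rewrite dotC vy dotC vy'.
- by rewrite dotC e dotC.
- by rewrite dotC vz dotC vy'.
- by rewrite dotC e' e dotC.
Qed.

(** Seen from [x], the other neighbours form two pairs, at angles of cosine [a] and [b] in the
    projection. The zero sum gives 2a + 2b = -1, and the points of a pair are at the doubled angle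
    from each other, so 2a^2 - 1 and 2b^2 - 1 are among a and b. Only the regular pentagon is left,
    and [k] is the cosine of 72 degrees. *)
Lemma nb5_angle v x : v \in W -> x \in nb v -> exists k y y',
  [/\ 0 < k, 4 * k ^+ 2 + 2 * k = 1 & [/\ y \in nb v, y' \in nb v, y != y',
  dot x y = c ^+ 2 + (1 - c ^+ 2) * k & dot x y' = c ^+ 2 + (1 - c ^+ 2) * k]].
Proof.
move=> vW xn; have [xW vx] := nbP xn.
have s0 := nb_sigma hc.
have ex s : (size s < 5)%N -> exists2 y, y \in nb v & y \notin s.
  move=> s5; apply: contrapT => h.
  have : (size (nb v) <= size s)%N.
    apply: uniq_leq_size (nb_uniq c hW v) _ => y yn.
    by apply: contrapT => /negP ys; apply: h; exists y.
  by rewrite k5 // leqNgt s5.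
have [y yn] := ex [:: x] isT; rewrite inE => yx.
have [y' [y'n y'y y'x e1]] := nb5_partner vW xn yn yx.
have [z zn] := ex [:: x; y; y'] isT; rewrite !inE !negb_or => /and3P[zx zy zy'].
have [z' [z'n z'z z'x e2]] := nb5_partner vW xn zn zx.
have yy' : y != y' by rewrite eq_sym.
have zz' : z != z' by rewrite eq_sym.
have z'y : z' != y.
  apply: contraNneq zy => e; rewrite e in e2.
  have [->//|zE] := nb5_two vW xn yn y'n zn yy' (esym e1) (esym e2).
  by rewrite zE eqxx in zy'.
have z'y' : z' != y'.
  apply: contraNneq zy => e; rewrite e e1 in e2.
  have [->//|zE] := nb5_two vW xn yn y'n zn yy' (esym e1) (esym e2).
  by rewrite zE eqxx in zy'.
pose s := [:: x; y; y'; z; z'].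
have us : uniq s.
  rewrite /= !inE !negb_or (eq_sym x) yx (eq_sym x) y'x (eq_sym x) zx (eq_sym x) z'x.
  by rewrite yy' (eq_sym y) zy (eq_sym y) z'y (eq_sym y') zy' (eq_sym y') z'y' zz'.
have nE : nb v =i s.
  have ss : {subset s <= nb v}.
    by move=> q; rewrite !inE => /or4P[|||/orP[]] /eqP->.
  by move=> q; have [|_ ->] // := uniq_min_size us ss; rewrite k5.
have pe : perm_eq (nb v) s by apply: uniq_perm => //; apply: nb_uniq.
have := nb_sum c hW irr vW; rewrite k5 // (perm_big _ pe) /= !big_cons big_nil addr0.
move=> /(congr1 (dot x)); rewrite !dotL e1 e2 (dotC x v) vx (th_unit hW xW) => sumE.
pose sg := 1 - c ^+ 2.
pose a := (dot x y - c ^+ 2) / sg; pose b := (dot x z - c ^+ 2) / sg.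
have aE : dot x y = c ^+ 2 + sg * a by rewrite mulrC divfK ?gt_eqF //; ring.
have bE : dot x z = c ^+ 2 + sg * b by rewrite mulrC divfK ?gt_eqF //; ring.
have sgI (i j : R) : sg * i = sg * j -> i = j by apply: mulfI; rewrite gt_eqF.
have ab : 2 * a + 2 * b = -1 by apply: sgI; move: sumE; rewrite aE bE /sg; lra.
have val p q : p \in nb v -> q \in nb v -> p != q ->
    dot p q = c ^+ 2 + sg * a \/ dot p q = c ^+ 2 + sg * b.
  move=> pn qn pq; have [q' q'n e] := nb5_transport vW pn qn xn.
  have q'x : q' != x.
    have [[pW _] [qW _]] := (nbP pn, nbP qn).
    apply: contraNneq pq => q'x; apply/eqP/(unit_dot_eq1 (th_unit hW pW) (th_unit hW qW)).
    by rewrite -e q'x (th_unit hW).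
  move: q'n; rewrite nE !inE (negPf q'x) /= -e -aE -bE.
  by case/or4P => /eqP->; rewrite ?e1 ?e2; auto.
have dbl (k : R) p p' : p \in nb v -> p' \in nb v -> p != p' ->
    dot x p = c ^+ 2 + sg * k -> dot x p' = c ^+ 2 + sg * k ->
    2 * k ^+ 2 - 1 = a \/ 2 * k ^+ 2 - 1 = b.
  move=> pn p'n pp' ep ep'.
  have [[pW _] [p'W _]] := (nbP pn, nbP p'n).
  pose g := (dot p p' - c ^+ 2) / sg.
  have gE : dot p p' = c ^+ 2 + sg * g by rewrite mulrC divfK ?gt_eqF //; ring.
  have g1 : g != 1.
    apply: contraNneq pp' => g1; apply/eqP.
    apply: (unit_dot_eq1 (th_unit hW pW) (th_unit hW p'W)); rewrite gE g1 /sg; ring.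
  have := nb_gram hW vW xn pn p'n; rewrite /= ep ep' gE -/sg.
  (* With two equal entries the Gram determinant factors: either the two points coincide or [g] is
     the cosine of the doubled angle. *)
  rewrite (_ : _ - _ = sg ^+ 3 * ((1 - g) * (g - (2 * k ^+ 2 - 1)))); last by ring.
  move/eqP; rewrite mulf_eq0 expf_eq0 (gt_eqF s0) /= mulf_eq0 !subr_eq0 eq_sym.
  rewrite (negPf g1) /= => /eqP <-.
  by case: (val p p' pn p'n pp'); rewrite gE => /addrI/sgI ->; auto.
have xy1 : a != 1.
  apply: contraNneq yx => a1; apply/eqP; have [yW _] := nbP yn.
  by apply/esym/(unit_dot_eq1 (th_unit hW xW) (th_unit hW yW)); rewrite aE a1 /sg; ring.
have xz1 : b != 1.
  apply: contraNneq zx => a1; apply/eqP; have [zW _] := nbP zn.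
  by apply/esym/(unit_dot_eq1 (th_unit hW xW) (th_unit hW zW)); rewrite bE a1 /sg; ring.
have fixed (k : R) : k != 1 -> 2 * k ^+ 2 - 1 = k -> k = - (1 / 2).
  move=> k1 e; have : (k - 1) * (2 * k + 1) = 0 by lra.
  by move/eqP; rewrite mulf_eq0 subr_eq0 (negPf k1) => /eqP; lra.
have da := dbl a y y' yn y'n yy' aE (etrans e1 aE).
have db := dbl b z z' zn z'n zz' bE (etrans e2 bE).
have qa : 4 * a ^+ 2 + 2 * a = 1.
  case: da => [/(fixed _ xy1) h|]; last by lra.
  have b0 : b = 0 by lra.
  by case: db; rewrite b0 expr2 mul0r mulr0; lra.
have qb : 4 * b ^+ 2 + 2 * b = 1.
  have -> : b = - (1 / 2) - a by lra.
  by lra.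
have [a0|a0] := ltP 0 a.
  by exists a, y, y'; split=> //; split=> //; rewrite -/sg ?e1.
exists b, z, z'; split=> //.
  rewrite ltNge; apply/negP => b0; have := mulr_le0 a0 b0.
  have -> : b = - (1 / 2) - a by lra.
  by lra.
by split=> //; rewrite -/sg ?e2.
Qed.

(** Reflecting [x] in the bisecting plane of the edge from [v] to [w] moves it by t (w - v) with |t|
    < 1, less than the minimal distance, so t = 0. Hence adjacent points of the pentagon around [v]
    are themselves nearest neighbours. *)
Lemma degree5 : exists k, [/\ 0 < k, 4 * k ^+ 2 + 2 * k = 1, c = k * (1 + c) &
  forall v x, v \in W -> x \in nb v -> exists y y', [/\ y \in nb v, y' \in nb v,
    y != y', dot x y = c & dot x y' = c]].
Proof.
have [c1 cN1 _ _] := hc.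
have [v vW] : exists v, v \in W.
  by move: (th_neq0 hW); case: (W) => // x s _; exists x; rewrite mem_head.
have [w wW vw] := md_att hc vW; have wn : w \in nb v by apply: nb_intro.
have [k [x [x' [k0 k2 [xn x'n xx' e e']]]]] := nb5_angle vW wn.
have kk : k < 1 / 2 by nra.
have [[xW vx] dw] := (nbP xn, th_unit hW wW).
have ct : (c - dot x w) / (1 - c) = c - k * (1 + c).
  by rewrite dotC e; field; rewrite subr_eq0 gt_eqF.
have kc : c = k * (1 + c).
  have := mirror hW hc vW wn xn x'n xx'; rewrite !(dotC _ w) e e' => /(_ erefl)/nbP[].
  rewrite (dotC x w) e in ct; rewrite ct => zW _.
  set t := c - k * (1 + c) in zW ct.
  have h1 : 0 < (1 - c) * (1 - k) by apply: mulr_gt0; lra.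
  have h2 : 0 < (1 + c) * (1 - k) by apply: mulr_gt0; lra.
  have t1 : t < 1 by rewrite /t; lra.
  have tN : -1 < t by rewrite /t; lra.
  have te : t * (1 - c) = c - dot w x by rewrite -ct e divfK // subr_eq0 gt_eqF.
  suff : t = 0 by rewrite /t; lra.
  clearbody t.
  have [ze|] := separated hc zW xW.
    have : dot (x + t *: (w - v)) w = dot x w by rewrite ze.
    rewrite !dotL dw vw (dotC x) => h.
    have /eqP : t * (1 - c) = 0 by lra.
    by rewrite mulf_eq0 subr_eq0 (gt_eqF c1) orbF => /eqP.
  rewrite !dotL (th_unit hW xW) vx => l.
  have h : dot w x - c = - (t * (1 - c)) by lra.
  rewrite h in l.
  have : 0 < (1 - t) * (1 + t) * (1 - c) by rewrite !mulr_gt0 //; lra.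
  by lra.
exists k; split=> // u q uW qn.
have [k' [y [y' [k'0 k'2 [yn y'n yy' ey ey']]]]] := nb5_angle uW qn.
have kk' : k' = k.
  have : (k' - k) * (4 * (k' + k) + 2) = 0 by lra.
  by move/eqP; rewrite mulf_eq0 => /orP[]/eqP; lra.
have cE : c = c ^+ 2 + (1 - c ^+ 2) * k.
  have -> : c ^+ 2 + (1 - c ^+ 2) * k = c ^+ 2 + (1 - c) * (k * (1 + c)) by ring.
  by rewrite -kc; ring.
by rewrite kk' -cE in ey ey'; exists y, y'.
Qed.

(** Since 2k = 2c / (1 + c), the point is the image of [a] under the half-turn about [b + v]: the
    apex of the other triangle on the edge from [b] to [v]. It has the inner products of the two
    common neighbours of [b] and [v], so it is one of them. *)
Lemma triangle5 k a b v : 4 * k ^+ 2 + 2 * k = 1 -> c = k * (1 + c) ->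
  (forall v x, v \in W -> x \in nb v -> exists y y', [/\ y \in nb v, y' \in nb v,
    y != y', dot x y = c & dot x y' = c]) ->
  a \in W -> b \in W -> v \in W -> dot a b = c -> dot a v = c -> dot b v = c ->
  (2 * k) *: (b + v) - a \in W.
Proof.
move=> k2 kc h aW bW vW ab av bv.
have bn : b \in nb v by apply: nb_intro; rewrite // dotC.
have [y [y' [yn y'n yy' by1 by2]]] := h v b vW bn.
have [[yW vy] [y'W vy']] := (nbP yn, nbP y'n).
have [[aa bb] vv] := (th_unit hW aW, th_unit hW bW, th_unit hW vW).
set q := _ - a.
have qv : dot q v = c.
  by rewrite /q !dotL vv bv av; have := kc; lra.
have qb : dot q b = c.
  by rewrite /q !dotL bb (dotC v b) bv ab; have := kc; lra.
have qq : dot q q = 1.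
  rewrite /q !dotL aa bb vv !(dotC _ a) (dotC v b) ab av bv.
  have e : k * c = c - k by lra.
  have e2 : k * (k * c) = k * c - k ^+ 2 by rewrite {1}e; ring.
  by lra.
have [->|->] // : q = y \/ q = y'.
apply: (nb_unique hW hc vW bn yW y'W yy' _ _ qq); rewrite ?qv ?qb //.
- by rewrite dotC vy dotC vy'.
- by rewrite dotC by1 dotC by2.
- by rewrite dotC vy'.
- by rewrite dotC by2.
Qed.

End Degree5.

(** * Coordinates of the irreducible configurations *)

Section Frames.
Variable R : realType.
Implicit Types (u v w x y z : 'rV[R]_3) (A F : 'M[R]_3).

Definition rows3 u v w : 'M[R]_3 := \matrix_i [:: u; v; w]`_i.

Lemma mul_rows3 x u v w : x *m (rows3 u v w)^T = vec (dot x u) (dot x v) (dot x w).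
Proof.
apply/rowP => i; rewrite [RHS]mxE !mxE.
by case: i => -[|[|[|]]] //= lt; apply: eq_bigr => j _; rewrite !mxE.
Qed.

(** Bases with equal Gram matrices differ by the orthogonal matrix [invmx S *m T]. *)
Lemma frame3 u v w u' v' w' :
  (forall x, dot x u = 0 -> dot x v = 0 -> dot x w = 0 -> x = 0) ->
  [/\ dot u' u' = dot u u, dot v' v' = dot v v & dot w' w' = dot w w] ->
  [/\ dot u' v' = dot u v, dot u' w' = dot u w & dot v' w' = dot v w] ->
  exists F, [/\ orthogonal F, u *m F = u', v *m F = v' & w *m F = w'].
Proof.
move=> free [uu vv ww] [uv uw vw].
pose S := rows3 u v w; pose T := rows3 u' v' w'.
have uS : S \in unitmx.
  rewrite -unitmx_tr -row_free_unit; apply: inj_row_free => x.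
  by rewrite mul_rows3 -[X in _ = X]vec0 => /vec_inj[h1 h2 h3]; apply: free.
have rowS i : row i S = [:: u; v; w]`_i by rewrite rowK.
have rowT i : row i T = [:: u'; v'; w']`_i by rewrite rowK.
have ST : S *m S^T = T *m T^T.
  apply/row_matrixP => i; rewrite !row_mul !mul_rows3 rowS rowT.
  have [vu wu wv] : [/\ dot v' u' = dot v u, dot w' u' = dot w u & dot w' v' = dot w v].
    by rewrite !(dotC w') !(dotC w) (dotC v') (dotC v).
  case: i => -[|[|[|//]]] lt; apply: vec_eq; rewrite /= ?uu ?vv ?ww ?uv ?uw //.
pose F := invmx S *m T.
have SF : S *m F = T by rewrite mulKVmx.
have im (i : 'I_3) : ([:: u; v; w]`_i : 'rV[R]_3) *m F = [:: u'; v'; w']`_i.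
  by rewrite -rowS -row_mul SF rowT.
exists F; split; [|exact: (im 0)|exact: (im 1)|exact: (im 2)].
rewrite /orthogonal /F trmx_mul -mulmxA (mulmxA T) -ST trmx_inv -!mulmxA.
by rewrite mulmxV ?unitmx_tr // mulmx1 mulVmx.
Qed.

Definition modelled (W std : seq 'rV[R]_3) := exists F (l : R),
  [/\ orthogonal F, 0 < l & W =i [seq l *: (p *m F) | p <- std]].

(** The last premise is the covering condition on the sphere of squared radius [rho]: a vertex
    outside the model, scaled back, would keep the minimal distance from all points of [std]. *)
Lemma modelledI W c std F l rho : two_homogeneous W -> min_dot W c ->
  orthogonal F -> 0 < l -> l ^+ 2 * rho = 1 ->
  (forall p, p \in std -> l *: (p *m F) \in W) ->
  (forall x, dot x x = rho -> (forall p, p \in std -> dot x p <= rho * c) -> False) ->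
  modelled W std.
Proof.
move=> hW hc oF l0 lr stdW ex; exists F, l; split=> // y.
apply/idP/mapP => [yW|[p ps ->]]; last exact: stdW.
have l0' := lt0r_neq0 l0.
have rl : rho = l^-1 * l^-1.
  by apply: (mulfI (expf_neq0 2 l0')); rewrite lr expr2; field.
pose x := l^-1 *: (y *m F^T).
have dx p : dot x p = rho * dot y (l *: (p *m F)).
  rewrite /x dotZl dot_mxl trmxK dotZr rl -!mulrA; congr (_ * _).
  by rewrite mulrA mulVf // mul1r.
apply: contrapT => ny; apply: (ex x) => [|p ps].
  rewrite dx /x; have -> : l *: ((l^-1 *: (y *m F^T)) *m F) = y.
    by rewrite -scalemxAl orthVK // scalerA mulfV // scale1r.
  by rewrite (th_unit hW yW) mulr1.
have [yp|h] := separated hc yW (stdW _ ps); first by case: ny; exists p.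
by rewrite dx rl ler_pM2l // mulr_gt0 ?invr_gt0.
Qed.

End Frames.

Section ListMembership.
Variable T : eqType.
Implicit Types (x y : T) (s : seq T).

Lemma forall_in_cons (Q : T -> Prop) y s :
  (forall x, x \in y :: s -> Q x) -> Q y /\ forall x, x \in s -> Q x.
Proof. by move=> h; split=> [|x xs]; apply: h; rewrite inE ?eqxx ?xs ?orbT. Qed.

Lemma in_cons_case x y s (G : Prop) :
  (x = y -> G) -> (x \in s -> G) -> x \in y :: s -> G.
Proof. by move=> h1 h2; rewrite inE => /orP[/eqP|]. Qed.

End ListMembership.

Ltac in_list := solve [rewrite /in_mem /= ?eqxx; repeat match goal with
  | |- is_true (true || _) => exact isT
  | |- is_true (_ || _) => apply/orP; right end].

Ltac each_point := repeat (refine (in_cons_case _ _); [|]); last by [].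

(** * Coordinate models, their generation and their covering radii *)

Section Models.
Variable R : realType.
Implicit Types (u v w x y z : 'rV[R]_3).

Definition golden : R := (1 + Num.sqrt 5) / 2.

Local Notation f := golden.

Lemma golden_sqr : f ^+ 2 = f + 1.
Proof.
have : Num.sqrt 5 ^+ 2 = 5 :> R by rewrite sqr_sqrtr // ler0n.
by rewrite /golden; set s := Num.sqrt _ => e; lra.
Qed.

Lemma golden_bounds : 3 / 2 < f < 7 / 4.
Proof.
have f1 : 1 / 2 <= f by rewrite /golden; have := sqrtr_ge0 (5 : R); lra.
have e := golden_sqr; apply/andP; split; rewrite ltNge; apply/negP => h; nra.
Qed.

Lemma golden_unique (k : R) : 0 < k -> k ^+ 2 + k = 1 -> k = f - 1.
Proof.
move=> k0 e; have e' := golden_sqr; have /andP[f1 _] := golden_bounds.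
have : (k - (f - 1)) * (k + f) = 0 by lra.
by move/eqP; rewrite mulf_eq0 => /orP[]/eqP; lra.
Qed.

Definition octahedron_pts : seq 'rV[R]_3 :=
  [:: vec 1 0 0; vec 0 1 0; vec 0 0 1; vec (- 1) 0 0; vec 0 (- 1) 0; vec 0 0 (- 1)].

Definition cube_pts : seq 'rV[R]_3 :=
  [:: vec 1 1 1; vec (- 1) 1 1; vec 1 (- 1) 1; vec 1 1 (- 1);
      vec (- 1) (- 1) 1; vec (- 1) 1 (- 1); vec 1 (- 1) (- 1); vec (- 1) (- 1) (- 1)].

Definition cuboctahedron_pts : seq 'rV[R]_3 :=
  [:: vec 0 1 1; vec 0 1 (- 1); vec 0 (- 1) 1; vec 0 (- 1) (- 1);
      vec 1 0 1; vec 1 0 (- 1); vec (- 1) 0 1; vec (- 1) 0 (- 1);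
      vec 1 1 0; vec 1 (- 1) 0; vec (- 1) 1 0; vec (- 1) (- 1) 0].

(** In the order in which [icosahedron_gen] reaches the points from the first three, a triangle. *)
Definition icosahedron_pts : seq 'rV[R]_3 :=
  [:: vec 0 1 f;
      vec 0 (- 1) f;
      vec f 0 1;
      vec 1 (- f) 0;
      vec 1 f 0;
      vec f 0 (- 1);
      vec (- f) 0 1;
      vec (- 1) (- f) 0;
      vec (- 1) f 0;
      vec 0 1 (- f);
      vec (- f) 0 (- 1);
      vec 0 (- 1) (- f)].

(** In the order in which [dodecahedron_gen] reaches the points from the first four, a vertex and
    its neighbours. *)
Definition dodecahedron_pts : seq 'rV[R]_3 :=
  [:: vec 1 1 1;
      vec 0 f (f - 1);
      vec (f - 1) 0 f;
      vec f (f - 1) 0;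
      vec (1 - f) 0 f;
      vec (- 1) 1 1;
      vec 1 1 (- 1);
      vec 0 f (1 - f);
      vec f (1 - f) 0;
      vec 1 (- 1) 1;
      vec 0 (- f) (f - 1);
      vec (- 1) (- 1) 1;
      vec (- 1) 1 (- 1);
      vec (- f) (f - 1) 0;
      vec (- f) (1 - f) 0;
      vec 1 (- 1) (- 1);
      vec (f - 1) 0 (- f);
      vec (1 - f) 0 (- f);
      vec 0 (- f) (1 - f);
      vec (- 1) (- 1) (- 1)].

(** The rule is [triangle5] in coordinates, with 2k = f - 1: it crosses an edge of a triangle. The
    squared norm is f + 2 and edges have inner product [f]. *)
Lemma icosahedron_gen (M : 'rV[R]_3 -> Prop) :
  (forall a b v, M a -> M b -> M v -> dot a b = f -> dot a v = f -> dot b v = f ->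
    M ((f - 1) *: (b + v) - a)) ->
  M (vec 0 1 f) -> M (vec 0 (- 1) f) -> M (vec f 0 1) ->
  forall p, p \in icosahedron_pts -> M p.
Proof.
move=> rule h0 h1 h2; have e := golden_sqr.
have step (a1 a2 a3 b1 b2 b3 v1 v2 v3 x1 x2 x3 : R) :
    M (vec a1 a2 a3) -> M (vec b1 b2 b3) -> M (vec v1 v2 v3) ->
    a1 * b1 + a2 * b2 + a3 * b3 = f -> a1 * v1 + a2 * v2 + a3 * v3 = f ->
    b1 * v1 + b2 * v2 + b3 * v3 = f ->
    x1 = (f - 1) * (b1 + v1) - a1 -> x2 = (f - 1) * (b2 + v2) - a2 ->
    x3 = (f - 1) * (b3 + v3) - a3 -> M (vec x1 x2 x3).
  move=> ha hb hv d1 d2 d3 -> -> ->.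
  by have := rule _ _ _ ha hb hv; rewrite !dot_vec !vecL; apply.
have h3 : M (vec 1 (- f) 0) by apply: (step _ _ _ _ _ _ _ _ _ _ _ _ h0 h1 h2); lra.
have h4 : M (vec 1 f 0) by apply: (step _ _ _ _ _ _ _ _ _ _ _ _ h1 h0 h2); lra.
have h5 : M (vec f 0 (- 1)) by apply: (step _ _ _ _ _ _ _ _ _ _ _ _ h0 h2 h4); lra.
have h6 : M (vec (- f) 0 1) by apply: (step _ _ _ _ _ _ _ _ _ _ _ _ h2 h0 h1); lra.
have h7 : M (vec (- 1) (- f) 0) by apply: (step _ _ _ _ _ _ _ _ _ _ _ _ h0 h1 h6); lra.
have h8 : M (vec (- 1) f 0) by apply: (step _ _ _ _ _ _ _ _ _ _ _ _ h1 h0 h6); lra.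
have h9 : M (vec 0 1 (- f)) by apply: (step _ _ _ _ _ _ _ _ _ _ _ _ h0 h4 h8); lra.
have h10 : M (vec (- f) 0 (- 1)) by apply: (step _ _ _ _ _ _ _ _ _ _ _ _ h0 h6 h8); lra.
have h11 : M (vec 0 (- 1) (- f)) by apply: (step _ _ _ _ _ _ _ _ _ _ _ _ h1 h3 h7); lra.
move=> p; rewrite !inE; do ?[case/orP => [/eqP -> //|]]; by move/eqP->.
Qed.

(** The rule is [path3] in coordinates, with (1 + 3c) / 2 = f: it moves on along a pentagon. Edges
    have inner product 2f - 1, the square root of 5; the bound 3 is the squared norm and keeps the
    ends distinct. *)
Lemma dodecahedron_gen (M : 'rV[R]_3 -> Prop) :
  (forall a b d, M a -> M b -> M d -> dot a b = 2 * f - 1 -> dot b d = 2 * f - 1 ->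
    dot a d < 3 -> M (a + f *: (d - b))) ->
  M (vec 1 1 1) -> M (vec 0 f (f - 1)) -> M (vec (f - 1) 0 f) -> M (vec f (f - 1) 0) ->
  forall p, p \in dodecahedron_pts -> M p.
Proof.
move=> rule h0 h1 h2 h3; have e := golden_sqr; have /andP[f1 f2] := golden_bounds.
have step (a1 a2 a3 b1 b2 b3 d1 d2 d3 x1 x2 x3 : R) :
    M (vec a1 a2 a3) -> M (vec b1 b2 b3) -> M (vec d1 d2 d3) ->
    a1 * b1 + a2 * b2 + a3 * b3 = 2 * f - 1 ->
    b1 * d1 + b2 * d2 + b3 * d3 = 2 * f - 1 -> a1 * d1 + a2 * d2 + a3 * d3 < 3 ->
    x1 = a1 + f * (d1 - b1) -> x2 = a2 + f * (d2 - b2) ->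
    x3 = a3 + f * (d3 - b3) -> M (vec x1 x2 x3).
  move=> ha hb hd e1 e2 e3 -> -> ->.
  by have := rule _ _ _ ha hb hd; rewrite !dot_vec !vecL; apply.
have h4 : M (vec (1 - f) 0 f) by apply: (step _ _ _ _ _ _ _ _ _ _ _ _ h1 h0 h2); lra.
have h5 : M (vec (- 1) 1 1) by apply: (step _ _ _ _ _ _ _ _ _ _ _ _ h0 h2 h4); lra.
have h6 : M (vec 1 1 (- 1)) by apply: (step _ _ _ _ _ _ _ _ _ _ _ _ h1 h0 h3); lra.
have h7 : M (vec 0 f (1 - f)) by apply: (step _ _ _ _ _ _ _ _ _ _ _ _ h0 h3 h6); lra.
have h8 : M (vec f (1 - f) 0) by apply: (step _ _ _ _ _ _ _ _ _ _ _ _ h2 h0 h3); lra.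
have h9 : M (vec 1 (- 1) 1) by apply: (step _ _ _ _ _ _ _ _ _ _ _ _ h0 h3 h8); lra.
have h10 : M (vec 0 (- f) (f - 1)) by apply: (step _ _ _ _ _ _ _ _ _ _ _ _ h4 h2 h9); lra.
have h11 : M (vec (- 1) (- 1) 1) by apply: (step _ _ _ _ _ _ _ _ _ _ _ _ h2 h9 h10); lra.
have h12 : M (vec (- 1) 1 (- 1)) by apply: (step _ _ _ _ _ _ _ _ _ _ _ _ h5 h1 h7); lra.
have h13 : M (vec (- f) (f - 1) 0) by apply: (step _ _ _ _ _ _ _ _ _ _ _ _ h1 h7 h12); lra.
have h14 : M (vec (- f) (1 - f) 0) by apply: (step _ _ _ _ _ _ _ _ _ _ _ _ h4 h5 h13); lra.
have h15 : M (vec 1 (- 1) (- 1)) by apply: (step _ _ _ _ _ _ _ _ _ _ _ _ h6 h3 h8); lra.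
have h16 : M (vec (f - 1) 0 (- f)) by apply: (step _ _ _ _ _ _ _ _ _ _ _ _ h3 h8 h15); lra.
have h17 : M (vec (1 - f) 0 (- f)) by apply: (step _ _ _ _ _ _ _ _ _ _ _ _ h6 h7 h12); lra.
have h18 : M (vec 0 (- f) (1 - f)) by apply: (step _ _ _ _ _ _ _ _ _ _ _ _ h8 h9 h10); lra.
have h19 : M (vec (- 1) (- 1) (- 1)) by apply: (step _ _ _ _ _ _ _ _ _ _ _ _ h10 h11 h14); lra.
move=> p; rewrite !inE; do ?[case/orP => [/eqP -> //|]]; by move/eqP->.
Qed.

Lemma octahedron_cover x : dot x x = 1 ->
  (forall p, p \in octahedron_pts -> dot x p <= 0) -> False.
Proof.
rewrite (vecE x); move: (x 0 0) (x 0 1) (x 0 2) => {x} a b d.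
rewrite dot_vec => n h.
have l p : p \in octahedron_pts -> dot (vec a b d) p <= 0 by apply: h.
have h1 := l (vec 1 0 0); have h2 := l (vec (- 1) 0 0); have h3 := l (vec 0 1 0).
have h4 := l (vec 0 (- 1) 0); have h5 := l (vec 0 0 1); have h6 := l (vec 0 0 (- 1)).
move: h1 h2 h3 h4 h5 h6; rewrite !inE !eqxx ?orbT !dot_vec.
move=> /(_ isT) h1 /(_ isT) h2 /(_ isT) h3 /(_ isT) h4 /(_ isT) h5 /(_ isT) h6.
have a0 : a = 0 by lra.
have b0 : b = 0 by lra.
have d0 : d = 0 by lra.
by move: n; rewrite a0 b0 d0; lra.
Qed.

(** Opposite points bound the square of an inner product, which prepares the moment identities
    below. *)
Let antipodal_bound (S : seq 'rV[R]_3) a b d (m : R) :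
  (forall p, p \in S -> dot (vec a b d) p <= m) -> forall i j k : R,
  vec i j k \in S -> vec (- i) (- j) (- k) \in S -> (a * i + b * j + d * k) ^+ 2 <= m ^+ 2.
Proof.
move=> h i j k /h h1 /h; rewrite -vecN dotNr => h2; rewrite dot_vec in h1 h2.
by rewrite -subr_ge0 subr_sqr; apply: mulr_ge0; lra.
Qed.

Ltac in_list_up_to_sign := rewrite ?opprB ?opprK ?oppr0; in_list.

(** The squared inner products with the four diagonals add up to 4 |x|^2 = 12, while each is at most
    1. *)
Lemma cube_cover x : dot x x = 3 ->
  (forall p, p \in cube_pts -> dot x p <= 1) -> False.
Proof.
rewrite (vecE x); move: (x 0 0) (x 0 1) (x 0 2) => {x} a b d.
rewrite dot_vec => n h.
have {h} q := antipodal_bound h.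
have q0 := q 1 1 1 ltac:(in_list) ltac:(in_list_up_to_sign).
have q1 := q (- 1) 1 1 ltac:(in_list) ltac:(in_list_up_to_sign).
have q2 := q 1 (- 1) 1 ltac:(in_list) ltac:(in_list_up_to_sign).
have q3 := q 1 1 (- 1) ltac:(in_list) ltac:(in_list_up_to_sign).
by lra.
Qed.

(** Over the six axes the squares add up to 4 |x|^2 = 8, while each is at most 1. *)
Lemma cuboctahedron_cover x : dot x x = 2 ->
  (forall p, p \in cuboctahedron_pts -> dot x p <= 1) -> False.
Proof.
rewrite (vecE x); move: (x 0 0) (x 0 1) (x 0 2) => {x} a b d.
rewrite dot_vec => n h.
have {h} q := antipodal_bound h.
have q0 := q 0 1 1 ltac:(in_list) ltac:(in_list_up_to_sign).
have q1 := q 0 1 (- 1) ltac:(in_list) ltac:(in_list_up_to_sign).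
have q4 := q 1 0 1 ltac:(in_list) ltac:(in_list_up_to_sign).
have q5 := q 1 0 (- 1) ltac:(in_list) ltac:(in_list_up_to_sign).
have q8 := q 1 1 0 ltac:(in_list) ltac:(in_list_up_to_sign).
have q9 := q 1 (- 1) 0 ltac:(in_list) ltac:(in_list_up_to_sign).
by lra.
Qed.

(** Over the six axes the squares add up to 2 (f + 2)^2 = 10 f^2, while each is at most f^2. *)
Lemma icosahedron_cover x : dot x x = f + 2 ->
  (forall p, p \in icosahedron_pts -> dot x p <= f) -> False.
Proof.
rewrite (vecE x); move: (x 0 0) (x 0 1) (x 0 2) => {x} a b d.
rewrite dot_vec => n h.
have e := golden_sqr; have /andP[f1 f2] := golden_bounds.
have {h} q := antipodal_bound h.
have q0 := q 0 1 f ltac:(in_list) ltac:(in_list_up_to_sign).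
have q1 := q 0 (- 1) f ltac:(in_list) ltac:(in_list_up_to_sign).
have q2 := q f 0 1 ltac:(in_list) ltac:(in_list_up_to_sign).
have q3 := q 1 (- f) 0 ltac:(in_list) ltac:(in_list_up_to_sign).
have q4 := q 1 f 0 ltac:(in_list) ltac:(in_list_up_to_sign).
have q5 := q f 0 (- 1) ltac:(in_list) ltac:(in_list_up_to_sign).
have ff : f * f = f + 1 by rewrite -expr2.
have key (i j : R) : (i * 1 + j * f) ^+ 2 + (i * 1 - j * f) ^+ 2 = 2 * i ^+ 2 + 2 * (f + 1) * j ^+ 2.
  by rewrite -golden_sqr; ring.
have kbd := key b d; have kda := key d a; have kab := key a b.
have tot : 2 * (f + 2) * (a * a + b * b + d * d) <= 6 * f ^+ 2 by lra.
by move: tot; rewrite n; lra.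
Qed.

(** Second moments do not suffice here: over the ten axes the squares add up to 30, against a bound
    of 50. The fourth powers add up to 162, while y^4 <= 5 y^2 bounds them by 150. *)
Lemma dodecahedron_cover x : dot x x = 3 ->
  (forall p, p \in dodecahedron_pts -> dot x p <= 2 * f - 1) -> False.
Proof.
rewrite (vecE x); move: (x 0 0) (x 0 1) (x 0 2) => {x} a b d.
rewrite dot_vec => n h.
have e := golden_sqr; have /andP[f1 f2] := golden_bounds.
have {h} q := antipodal_bound h.
have q0 := q 1 1 1 ltac:(in_list) ltac:(in_list_up_to_sign).
have q1 := q 0 f (f - 1) ltac:(in_list) ltac:(in_list_up_to_sign).
have q2 := q (f - 1) 0 f ltac:(in_list) ltac:(in_list_up_to_sign).
have q3 := q f (f - 1) 0 ltac:(in_list) ltac:(in_list_up_to_sign).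
have q4 := q (1 - f) 0 f ltac:(in_list) ltac:(in_list_up_to_sign).
have q5 := q (- 1) 1 1 ltac:(in_list) ltac:(in_list_up_to_sign).
have q6 := q 1 1 (- 1) ltac:(in_list) ltac:(in_list_up_to_sign).
have q7 := q 0 f (1 - f) ltac:(in_list) ltac:(in_list_up_to_sign).
have q8 := q f (1 - f) 0 ltac:(in_list) ltac:(in_list_up_to_sign).
have q9 := q 1 (- 1) 1 ltac:(in_list) ltac:(in_list_up_to_sign).
have m5 : (2 * f - 1) ^+ 2 = 5 by lra.
have quart (k : R) : k ^+ 2 <= (2 * f - 1) ^+ 2 -> k ^+ 4 <= 5 * k ^+ 2.
  by rewrite m5 => h5; rewrite (exprM k 2 2) expr2 ler_wpM2r // sqr_ge0.
repeat match goal with H : is_true (_ ^+ 2 <= (2 * f - 1) ^+ 2) |- _ => move/quart: H => H end.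
have f2E : (f - 1) ^+ 2 = 2 - f by lra.
have fg : f * (f - 1) = 1 by lra.
have f4E : (f + 1) ^+ 2 = 3 * f + 2 by lra.
have g4E : (2 - f) ^+ 2 = 5 - 3 * f by lra.
have key2 (i j : R) : (i * f + j * (f - 1)) ^+ 2 + (i * f - j * (f - 1)) ^+ 2 =
    2 * (f + 1) * i ^+ 2 + 2 * (2 - f) * j ^+ 2.
  by rewrite -e -f2E; ring.
have key4 (i j : R) : (i * f + j * (f - 1)) ^+ 4 + (i * f - j * (f - 1)) ^+ 4 =
    2 * (3 * f + 2) * i ^+ 4 + 12 * i ^+ 2 * j ^+ 2 + 2 * (5 - 3 * f) * j ^+ 4.
  rewrite -f4E -g4E -e -f2E.
  have -> : 12 * i ^+ 2 * j ^+ 2 = 12 * i ^+ 2 * j ^+ 2 * (f * (f - 1)) ^+ 2.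
    by rewrite fg expr1n mulr1.
  by ring.
have n2 : (a * a + b * b + d * d) ^+ 2 = 9 by rewrite n; ring.
have kbd := key2 b d; have kda := key2 d a; have kab := key2 a b.
have kbd4 := key4 b d; have kda4 := key4 d a; have kab4 := key4 a b.
have cube2 : (a + b + d) ^+ 2 + (- a + b + d) ^+ 2 + (a - b + d) ^+ 2 +
  (a + b - d) ^+ 2 = 4 * (a * a + b * b + d * d) by ring.
have cube4 : (a + b + d) ^+ 4 + (- a + b + d) ^+ 4 + (a - b + d) ^+ 4 +
  (a + b - d) ^+ 4 = 12 * (a * a + b * b + d * d) ^+ 2 -
    8 * (a ^+ 4 + b ^+ 4 + d ^+ 4) by ring.
lra.
Qed.

End Models.

(** * Fitting the models to the irreducible configurations *)

Section Irreducible.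
Variable R : realType.
Implicit Types (u v w x y z : 'rV[R]_3) (F A : 'M[R]_3).

Lemma model_frame (rho : R) u v w u' v' w' : 0 < rho ->
  (forall x, dot x u = 0 -> dot x v = 0 -> dot x w = 0 -> x = 0) ->
  [/\ dot u u = rho * dot u' u', dot v v = rho * dot v' v' & dot w w = rho * dot w' w'] ->
  [/\ dot u v = rho * dot u' v', dot u w = rho * dot u' w' & dot v w = rho * dot v' w'] ->
  exists F (l : R), [/\ orthogonal F, 0 < l, l ^+ 2 * rho = 1 &
    [/\ l *: (u *m F) = u', l *: (v *m F) = v' & l *: (w *m F) = w']].
Proof.
move=> r0 free [uu vv ww] [uv uw vw].
pose k := Num.sqrt rho.
have k0 : 0 < k by rewrite sqrtr_gt0.
have k2 : k * k = rho by rewrite -expr2 sqr_sqrtr // ltW.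
have d x y : dot (k *: x) (k *: y) = rho * dot x y by rewrite dotZl dotZr mulrA k2.
have [||F [oF Fu Fv Fw]] := frame3 (u' := k *: u') (v' := k *: v') (w' := k *: w') free.
- by rewrite !d.
- by rewrite !d.
exists F, k^-1; split=> //; rewrite ?invr_gt0 //.
  by rewrite -k2; field; rewrite lt0r_neq0.
by rewrite Fu Fv Fw !scalerA mulVf ?scale1r ?lt0r_neq0.
Qed.

Variables (W : seq 'rV[R]_3) (c : R).
Hypotheses (hW : two_homogeneous W) (hc : min_dot W c).
Hypothesis irr : forall v q, v \in W ->
  (forall A, symmetry_of W A -> v *m A = v -> q *m A = q) ->
  exists k, q = k *: v.

Local Notation nb := (nb W c).
Local Notation f := (golden R).

Section Scaled.
Variables (F : 'M[R]_3) (l rho : R).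
Hypotheses (oF : orthogonal F) (l2 : l ^+ 2 * rho = 1).

Let M p := l *: (p *m F) \in W.

Lemma scaled_dot p q (k : R) : dot p q = rho * k -> dot (l *: (p *m F)) (l *: (q *m F)) = k.
Proof. by move=> e; rewrite dotZl dotZr dot_orth // e mulrA -expr2 mulrA l2 mul1r. Qed.

Lemma scaled_neq p q : 0 < rho -> dot p p = rho -> dot p q < rho ->
  l *: (p *m F) != l *: (q *m F).
Proof.
move=> r0 pp pq; have r0' := lt0r_neq0 r0.
have h1 : dot (l *: (p *m F)) (l *: (p *m F)) = 1 by apply: scaled_dot; rewrite mulr1.
have h2 : dot (l *: (p *m F)) (l *: (q *m F)) = dot p q / rho.
  by apply: scaled_dot; rewrite mulrC divfK.
apply: contraTneq pq => e; rewrite -leNgt -[leLHS]mul1r -ler_pdivlMr // -h2 -e h1.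
by [].
Qed.

End Scaled.

Lemma nb3_exists : (forall v, v \in W -> size (nb v) = 3%N) -> exists v a b,
  [/\ v \in W, a \in nb v, b \in nb v & a != b].
Proof.
move=> k3; have [v vW] : exists v, v \in W.
  by move: (th_neq0 hW); case: (W) => // x s _; exists x; rewrite mem_head.
move: (k3 v vW) (nb_uniq c hW v); case e : (nb v) => [|a [|b s]] //= _ /andP[an _].
exists v, a, b; rewrite e !inE !eqxx orbT; split=> //.
by apply: contraNneq an => ->; rewrite mem_head.
Qed.

(** With c = -1/3 the neighbours of [v] sum to [- v]. For a further point [x], the products with
    them sum to at most -1, yet to - x.v, which is at least 1/3. *)
Lemma tetrahedron_size : (forall v, v \in W -> size (nb v) = 3%N) ->
  c = - (1 / 3) -> size W = 4%N.
Proof.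
move=> k3 cE; have [v [_ [_ [vW _ _ _]]]] := nb3_exists k3.
have vv := th_unit hW vW.
have us : uniq (v :: nb v).
  rewrite /= nb_uniq // andbT; apply/negP => /nbP[_]; rewrite vv cE => ?; lra.
have -> : 4%N = size (v :: nb v) by rewrite /= k3.
apply/perm_size/uniq_perm => //; first exact: (th_uniq hW).
move=> x; apply/idP/idP => [xW|]; last by rewrite inE => /orP[/eqP->|/nbP[]].
rewrite inE; have [//|xv] := eqVneq x v.
apply: contrapT => /negP xn.
have := congr1 (dot x) (nb_sum c hW irr vW); rewrite k3 // dotZr dot_sumr.
have xvc := md_max hc xW vW xv.
have : \sum_(w <- nb v) dot x w <= \sum_(w <- nb v) c.
  rewrite big_seq [leRHS]big_seq; apply: ler_sum => w wn.
  apply: (md_max hc xW (nbP wn).1); apply: contraNneq xn => ->; exact: wn.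
have := nb_size; move: (k3 v vW); case: (nb v) => [|a [|b [|d []]]] //= _ _.
rewrite !big_cons !big_nil => h1 h2; rewrite h2 in h1.
by move: h1 xvc; rewrite cE; lra.
Qed.

Lemma cube_model : (forall v, v \in W -> size (nb v) = 3%N) ->
  c = 1 / 3 -> modelled W (cube_pts R).
Proof.
move=> k3 cE; have [v [a [b [vW an bn ab]]]] := nb3_exists k3.
have [c'n e] := nb3 hW irr k3 vW an bn ab.
have [[aW va] [bW vb]] := (nbP an, nbP bn).
have [F [l [oF l0 l2 [Fv Fa Fb]]]] : exists F (l : R), [/\ orthogonal F, 0 < l,
    l ^+ 2 * 3 = 1 & [/\ l *: (vec 1 1 1 *m F) = v, l *: (vec (- 1) 1 1 *m F) = a &
    l *: (vec 1 (- 1) 1 *m F) = b]].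
  apply: model_frame => //.
  - move=> x; rewrite (vecE x) !dot_vec => h1 h2 h3.
    by rewrite -vec0; apply: vec_eq; lra.
  - by rewrite !dot_vec !(th_unit hW) //; split; ring.
  - by rewrite !dot_vec va vb e cE; split; field.
pose M p := l *: (p *m F) \in W.
apply: (modelledI hW hc oF l0 l2) => [p|x xx h]; last first.
  by apply: (cube_cover xx) => p /h; rewrite cE; lra.
have h0 : M (vec 1 1 1) by rewrite /M Fv.
have h1 : M (vec (- 1) 1 1) by rewrite /M Fa.
have h2 : M (vec 1 (- 1) 1) by rewrite /M Fb.
have Meq (a1 a2 a3 b1 b2 b3 : R) : M (vec a1 a2 a3) -> a1 = b1 -> a2 = b2 ->
  a3 = b3 -> M (vec b1 b2 b3) by move=> h <- <- <-.
have h3 : M (vec 1 1 (- 1)).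
  have := (nbP c'n).1; rewrite /M -Fv -Fa -Fb cE.
  rewrite scalerA -scalerA (_ : 3 * (1 / 3) = 1); last by field.
  rewrite scale1r -!scalerBr -!mulmxBl !vecL.
  by move=> h; apply: (Meq _ _ _ _ _ _ h); ring.
(* For c = 1/3 the factor in [path3] is 1, so the rule completes parallelograms. *)
have step (a1 a2 a3 b1 b2 b3 d1 d2 d3 x1 x2 x3 : R) :
    M (vec a1 a2 a3) -> M (vec b1 b2 b3) -> M (vec d1 d2 d3) ->
    a1 * b1 + a2 * b2 + a3 * b3 = 1 -> b1 * d1 + b2 * d2 + b3 * d3 = 1 ->
    a1 * a1 + a2 * a2 + a3 * a3 = 3 -> a1 * d1 + a2 * d2 + a3 * d3 < 3 ->
    x1 = a1 + (d1 - b1) -> x2 = a2 + (d2 - b2) -> x3 = a3 + (d3 - b3) ->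
    M (vec x1 x2 x3).
  move=> ha hb hd e1 e2 e3 e4 -> -> ->.
  have [|||/nbP[+ _] _] := path3 hW hc irr k3 hb (a := l *: (vec a1 a2 a3 *m F))
    (d := l *: (vec d1 d2 d3 *m F)).
  - by apply: nb_intro => //; apply: (scaled_dot oF l2); rewrite dot_vec cE; lra.
  - by apply: nb_intro => //; apply: (scaled_dot oF l2); rewrite dot_vec cE; lra.
  - by apply: (scaled_neq oF l2); rewrite ?dot_vec //; lra.
  rewrite (_ : (1 + 3 * c) / 2 = 1); last by rewrite cE; field.
  by rewrite scale1r -!scalerBr -scalerDr -mulmxBl -mulmxDl !vecL.
have h4 : M (vec (- 1) (- 1) 1) by apply: (step _ _ _ _ _ _ _ _ _ _ _ _ h1 h0 h2); lra.
have h5 : M (vec (- 1) 1 (- 1)) by apply: (step _ _ _ _ _ _ _ _ _ _ _ _ h1 h0 h3); lra.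
have h6 : M (vec 1 (- 1) (- 1)) by apply: (step _ _ _ _ _ _ _ _ _ _ _ _ h2 h0 h3); lra.
have h7 : M (vec (- 1) (- 1) (- 1)) by apply: (step _ _ _ _ _ _ _ _ _ _ _ _ h4 h1 h5); lra.
by rewrite !inE; do ?[case/orP => [/eqP -> //|]]; move/eqP->.
Qed.

Lemma dodecahedron_model : (forall v, v \in W -> size (nb v) = 3%N) ->
  3 * c = 2 * f - 1 -> modelled W (dodecahedron_pts R).
Proof.
move=> k3 cE; have [v [a [b [vW an bn ab]]]] := nb3_exists k3.
have [c'n e] := nb3 hW irr k3 vW an bn ab.
have [[aW va] [bW vb]] := (nbP an, nbP bn).
have g2 := golden_sqr R; have /andP[g1 g1'] := golden_bounds R.
have [F [l [oF l0 l2 [Fv Fa Fb]]]] : exists F (l : R), [/\ orthogonal F, 0 < l,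
    l ^+ 2 * 3 = 1 & [/\ l *: (vec 1 1 1 *m F) = v, l *: (vec 0 f (f - 1) *m F) = a &
    l *: (vec (f - 1) 0 f *m F) = b]].
  apply: model_frame => //.
  - move=> x; rewrite (vecE x) !dot_vec => h1 h2 h3.
    have h2' := congr1 (fun t => (f - 1) * t) h2.
    have h3' := congr1 (fun t => f * t) h3.
    move: h2' h3'; rewrite /= !mulr0.
    rewrite (_ : (f - 1) * _ = x 0 1 * (f ^+ 2 - f) + x 0 2 * (f ^+ 2 - 2 * f + 1)); last by ring.
    rewrite (_ : f * _ = x 0 0 * (f ^+ 2 - f) + x 0 2 * f ^+ 2); last by ring.
    rewrite g2 => h2' h3'.
    have z0 : x 0 2 = 0 by lra.
    rewrite z0 in h1 h2' h3' *.
    by rewrite -vec0; apply: vec_eq; lra.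
  - by rewrite !dot_vec !(th_unit hW) //; split; lra.
  - rewrite !dot_vec va vb e; split; [lra|lra|].
    have : (3 * c) ^+ 2 = 5 by rewrite cE; lra.
    by rewrite exprMn; lra.
pose M p := l *: (p *m F) \in W.
apply: (modelledI hW hc oF l0 l2) => [p|x xx h]; last first.
  by apply: (dodecahedron_cover xx) => p /h; rewrite cE; lra.
have Meq (a1 a2 a3 b1 b2 b3 : R) : M (vec a1 a2 a3) -> a1 = b1 -> a2 = b2 ->
  a3 = b3 -> M (vec b1 b2 b3) by move=> h <- <- <-.
apply: (@dodecahedron_gen _ M).
- move=> a1 b1 d1 ha hb hd e1 e2 e3.
  have aa : dot a1 a1 = 3.
    have := th_unit hW ha; rewrite dotZl dotZr dot_orth // mulrA -expr2 => h.
    by apply: (mulfI (expf_neq0 2 (lt0r_neq0 l0))); rewrite h l2.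
  have [|||/nbP[+ _] _] := path3 hW hc irr k3 hb (a := l *: (a1 *m F))
    (d := l *: (d1 *m F)).
  - by apply: nb_intro => //; apply: (scaled_dot oF l2); rewrite dotC e1; lra.
  - by apply: nb_intro => //; apply: (scaled_dot oF l2); rewrite e2; lra.
  - by apply: (scaled_neq oF l2); lra.
  rewrite (_ : (1 + 3 * c) / 2 = f); last by lra.
  by move=> h; rewrite /M mulmxDl -scalemxAl scalerDr scalerA (mulrC l) -scalerA mulmxBl scalerBr.
- by rewrite /M Fv.
- by rewrite /M Fa.
- by rewrite /M Fb.
- have := (nbP c'n).1; rewrite /M -Fv -Fa -Fb cE.
  rewrite scalerA (mulrC _ l) -scalerA scalemxAl -!scalerBr -!mulmxBl !vecL.
  by move=> h; apply: (Meq _ _ _ _ _ _ h); ring.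
Qed.

Lemma octahedron_model : (forall v, v \in W -> size (nb v) = 4%N) -> c = 0 ->
  forall v a b, v \in W -> a \in W -> b \in W -> dot v a = 0 -> dot v b = 0 ->
  dot a b = 0 -> modelled W (octahedron_pts R).
Proof.
move=> k4 c0 v a b vW aW bW va vb ab.
have [F [l [oF l0 l2 [Fv Fa Fb]]]] : exists F (l : R), [/\ orthogonal F, 0 < l,
    l ^+ 2 * 1 = 1 & [/\ l *: (vec 1 0 0 *m F) = v, l *: (vec 0 1 0 *m F) = a &
    l *: (vec 0 0 1 *m F) = b]].
  apply: model_frame => //.
  - move=> x; rewrite (vecE x) !dot_vec => h1 h2 h3.
    by rewrite -vec0; apply: vec_eq; lra.
  - by rewrite !dot_vec !(th_unit hW) //; split; ring.
  - by rewrite !dot_vec va vb ab; split; ring.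
have opp x y : x \in W -> y \in W -> dot x y = 0 -> - y \in W.
  move=> xW yW xy; have yn : y \in nb x by apply: nb_intro; rewrite // c0.
  by have /nbP[] := nb4_antipode hW hc irr k4 xW yn; rewrite c0 mulr0 scale0r sub0r.
have neg (p q : 'rV[R]_3) : l *: (p *m F) \in W -> (- (l *: (p *m F)) \in W) -> q = - p ->
    l *: (q *m F) \in W.
  by move=> _ h ->; rewrite mulNmx scalerN.
apply: (modelledI hW hc oF l0 l2) => [p|x xx h]; last first.
  by apply: (octahedron_cover xx) => p /h; rewrite c0; lra.
rewrite !inE => /or4P[|||/or3P[]] /eqP ->; rewrite ?Fv ?Fa ?Fb //.
- apply: (neg (vec 1 0 0)); rewrite ?Fv //; last by rewrite vecN oppr0.
  by apply: (opp a) => //; rewrite dotC.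
- apply: (neg (vec 0 1 0)); rewrite ?Fa //; last by rewrite vecN oppr0.
  exact: (opp v).
- apply: (neg (vec 0 0 1)); rewrite ?Fb //; last by rewrite vecN oppr0.
  exact: (opp v).
Qed.

Lemma cuboctahedron_model : (forall v, v \in W -> size (nb v) = 4%N) -> c = 1 / 2 ->
  forall v a b, v \in W -> a \in W -> b \in W -> dot v a = c -> dot v b = c ->
  dot a b = c -> modelled W (cuboctahedron_pts R).
Proof.
move=> k4 cE v a b vW aW bW va vb ab.
have [F [l [oF l0 l2 [Fv Fa Fb]]]] : exists F (l : R), [/\ orthogonal F, 0 < l,
    l ^+ 2 * 2 = 1 & [/\ l *: (vec 0 1 1 *m F) = v, l *: (vec 1 0 1 *m F) = a &
    l *: (vec 1 1 0 *m F) = b]].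
  apply: model_frame => //.
  - move=> x; rewrite (vecE x) !dot_vec => h1 h2 h3.
    by rewrite -vec0; apply: vec_eq; lra.
  - by rewrite !dot_vec !(th_unit hW) //; split; ring.
  - by rewrite !dot_vec va vb ab cE; split; field.
pose M p := l *: (p *m F) \in W.
have step (a1 a2 a3 b1 b2 b3 x1 x2 x3 : R) :
    M (vec a1 a2 a3) -> M (vec b1 b2 b3) -> a1 * b1 + a2 * b2 + a3 * b3 = 1 ->
    x1 = b1 - a1 -> x2 = b2 - a2 -> x3 = b3 - a3 -> M (vec x1 x2 x3).
  move=> ha hb e -> -> ->.
  have an : l *: (vec a1 a2 a3 *m F) \in nb (l *: (vec b1 b2 b3 *m F)).
    apply: nb_intro => //; rewrite dotC; apply: (scaled_dot oF l2).
    by rewrite dot_vec e cE; field.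
  have /nbP[] := nb4_antipode hW hc irr k4 hb an.
  rewrite cE (_ : 2 * (1 / 2) = 1); last by field.
  by rewrite scale1r -scalerBr -mulmxBl !vecL.
have hv : M (vec 0 1 1) by rewrite /M Fv.
have ha : M (vec 1 0 1) by rewrite /M Fa.
have hb : M (vec 1 1 0) by rewrite /M Fb.
have h1 : M (vec (- 1) 1 0) by apply: (step _ _ _ _ _ _ _ _ _ ha hv); ring.
have h2 : M (vec 1 (- 1) 0) by apply: (step _ _ _ _ _ _ _ _ _ hv ha); ring.
have h3 : M (vec (- 1) 0 1) by apply: (step _ _ _ _ _ _ _ _ _ hb hv); ring.
have h4 : M (vec 1 0 (- 1)) by apply: (step _ _ _ _ _ _ _ _ _ hv hb); ring.
have h5 : M (vec 0 (- 1) 1) by apply: (step _ _ _ _ _ _ _ _ _ hb ha); ring.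
have h6 : M (vec 0 1 (- 1)) by apply: (step _ _ _ _ _ _ _ _ _ ha hb); ring.
have h7 : M (vec 0 (- 1) (- 1)) by apply: (step _ _ _ _ _ _ _ _ _ ha h2); ring.
have h8 : M (vec (- 1) 0 (- 1)) by apply: (step _ _ _ _ _ _ _ _ _ hv h1); ring.
have h9 : M (vec (- 1) (- 1) 0) by apply: (step _ _ _ _ _ _ _ _ _ hv h3); ring.
apply: (modelledI hW hc oF l0 l2) => [p|x xx h]; last first.
  by apply: (cuboctahedron_cover xx) => p /h; rewrite cE; lra.
by rewrite !inE; do ?[case/orP => [/eqP -> //|]]; move/eqP->.
Qed.

Lemma icosahedron_model : (forall v, v \in W -> size (nb v) = 5%N) ->
  modelled W (icosahedron_pts R).
Proof.
move=> k5; have [k [k0 k2 kc two]] := degree5 hW hc irr k5.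
have tri a b v := @triangle5 _ W c hW hc k a b v k2 kc two.
have kE : 2 * k = f - 1 by apply: golden_unique; rewrite ?mulr_gt0 //; lra.
have g2 := golden_sqr R; have /andP[g1 g1'] := golden_bounds R.
have cE : (f + 2) * c = f.
  have k3 : c * (3 - f) = f - 1.
    have : 2 * k * (1 + c) = (f - 1) * (1 + c) by rewrite kE.
    by lra.
  have f3 : 0 < 3 - f by lra.
  apply: (mulIf (lt0r_neq0 f3)); rewrite -mulrA k3.
  by lra.
have [v vW] : exists v, v \in W.
  by move: (th_neq0 hW); case: (W) => // x s _; exists x; rewrite mem_head.
have [a aW va] := md_att hc vW; have an : a \in nb v by apply: nb_intro.
have [b [_ [/nbP[bW vb] _ _ ab _]]] := two v a vW an.
have [F [l [oF l0 l2 [Fa Fb Fv]]]] : exists F (l : R), [/\ orthogonal F, 0 < l,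
    l ^+ 2 * (f + 2) = 1 & [/\ l *: (vec 0 1 f *m F) = a, l *: (vec 0 (- 1) f *m F) = b &
    l *: (vec f 0 1 *m F) = v]].
  apply: model_frame.
  - by lra.
  - move=> x; rewrite (vecE x) !dot_vec => h1 h2 h3.
    have f0 : f != 0 by rewrite gt_eqF //; lra.
    have z0 : x 0 2 = 0.
      by apply: (mulIf f0); rewrite mul0r; lra.
    have x0 : x 0 0 = 0 by apply: (mulIf f0); rewrite mul0r; lra.
    by rewrite -vec0; apply: vec_eq; lra.
  - by rewrite !dot_vec !(th_unit hW) //; split; lra.
  - by rewrite !dot_vec (dotC a v) (dotC b v) va vb ab cE; split; lra.
pose M p := l *: (p *m F) \in W.
apply: (modelledI hW hc oF l0 l2) => [p|x xx h]; last first.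
  by apply: (icosahedron_cover xx) => p /h; rewrite cE.
apply: (@icosahedron_gen _ M); rewrite /M ?Fa ?Fb ?Fv //.
move=> a1 b1 d1 ha hb hd e1 e2 e3.
rewrite /M mulmxBl -scalemxAl scalerBr scalerA (mulrC l) -scalerA mulmxDl scalerDr -kE.
by apply: tri => //; apply: (scaled_dot oF l2); rewrite cE.
Qed.

Lemma irreducible_classification :
  size W = 4%N \/ modelled W (cube_pts R) \/ modelled W (octahedron_pts R) \/
  modelled W (icosahedron_pts R) \/ modelled W (dodecahedron_pts R) \/
  modelled W (cuboctahedron_pts R).
Proof.
have [v vW] : exists v, v \in W.
  by move: (th_neq0 hW); case: (W) => // x s _; exists x; rewrite mem_head.
have const k : size (nb v) = k -> forall w, w \in W -> size (nb w) = k.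
  by move=> <- w wW; apply: nb_size.
have := nb_size_le5 hW hc vW; have [w wW vw] := md_att hc vW.
have : w \in nb v by apply: nb_intro.
case e : (size (nb v)) => [|[|[|[|[|[|//]]]]]] wn _.
- by move/size0nil: e wn => ->.
- by case: (nb_sizeN1 hW hc irr vW).
- by case: (nb_sizeN2 hW hc irr); apply: const.
- have [c3|[c3|/= [s0 s2]]] := degree3 hW hc irr (const _ e).
  + by left; apply: tetrahedron_size; first exact: const.
  + by right; left; apply: cube_model; first exact: const.
  + do 4 right; left; apply: dodecahedron_model; first exact: const.
    by have := golden_unique s0 s2; lra.
- have [x [a [b [xW aW bW [xa xb ab [c0|c0]]]]]] := degree4 hW hc irr (const _ e).
  + do 2 right; left; rewrite c0 in xa xb ab.
    by apply: (octahedron_model (const _ e) c0 xW aW bW).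
  + do 5 right.
    by apply: (cuboctahedron_model (const _ e) c0 xW aW bW).
- by do 3 right; left; apply: icosahedron_model; apply: const.
Qed.

End Irreducible.

(** * Configurations with an invariant line *)

Section Coordinates.
Variable R : realType.
Implicit Types (u v w x y z : 'rV[R]_3) (F A : 'M[R]_3).

Lemma vec_rows3 (i j k : R) u v w : vec i j k *m rows3 u v w = i *: u + j *: v + k *: w.
Proof.
apply/rowP => m; rewrite !mxE sum3E !mxE /=.
by [].
Qed.

Lemma orth_rows3 u v w : orthonormal2 u v -> dot w w = 1 -> dot u w = 0 ->
  dot v w = 0 -> orthogonal (rows3 u v w).
Proof.
move=> [uu vv uv] ww uw vw; apply/row_matrixP => i.
rewrite row_mul mul_rows3 rowK row1.
apply/rowP => j; rewrite !mxE eqxx /=.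
by case: i => -[|[|[|//]]] li; case: j => -[|[|[|//]]] lj;
   rewrite /= ?uu ?vv ?ww ?uv ?uw ?vw // dotC ?uv ?uw ?vw.
Qed.

End Coordinates.

Section Reducible.
Variable R : realType.

Let sum_diff n (p q : 'rV[R]_n) s : dot p p = s -> dot q q = s ->
  [/\ dot (p + q) (p - q) = 0, dot (p + q) p = dot (p + q) (p + q) / 2
    & dot (p - q) p = dot (p - q) (p - q) / 2].
Proof.
move=> pp qq; rewrite !dotL (dotC q p) pp qq.
by split; field.
Qed.

Let dotDD n (u v : 'rV[R]_n) : dot (u + v) (u + v) = dot u u + dot v v + 2 * dot u v.
Proof. by rewrite !dotL (dotC v u); ring. Qed.

Implicit Types (u v w x y z p q : 'rV[R]_3) (F A : 'M[R]_3).

(** The axis is [row 2 F]. The polygon at height [h] starts at angle 0 and the one at [- h] at angle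
    [phi], so [phi] tells prisms from antiprisms. *)
Definition two_ngons (W : seq 'rV[R]_3) F n (r h phi : R) := forall y, y \in W <->
  exists2 j, (j < n)%N &
    y = vec (r * cos (2 * pi * j%:R / n%:R)) (r * sin (2 * pi * j%:R / n%:R)) h *m F \/
    y = vec (r * cos (phi + 2 * pi * j%:R / n%:R))
            (r * sin (phi + 2 * pi * j%:R / n%:R)) (- h) *m F.

Definition box_pts (i j k : R) : seq 'rV[R]_3 :=
  [:: vec i j k; vec (- i) j k; vec i (- j) k; vec i j (- k);
      vec (- i) (- j) k; vec (- i) j (- k); vec i (- j) (- k);
      vec (- i) (- j) (- k)].

(** The symmetry carrying [x], [y] to [z], [w] multiplies all heights by one sign, so equal heights
    go to equal heights; if these are also opposite, they vanish. *)
Lemma separate_levels W a : two_homogeneous W ->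
  (forall A, symmetry_of W A -> a *m A = a \/ a *m A = - a) ->
  forall x y z w, x \in W -> y \in W -> z \in W -> w \in W ->
  dot x a = dot y a -> dot z a = - dot w a -> dot x y = dot z w -> dot z a = 0.
Proof.
move=> hW ha x y z w xW yW zW wW xya zwa e.
have [A [sA xA yA]] := th_hom hW xW yW zW wW e.
have := dot_orth x a sA.1; have := dot_orth y a sA.1.
by rewrite xA yA; case: (ha A sA) => ->; rewrite ?dotNr; lra.
Qed.

Variables (W : seq 'rV[R]_3) (a : 'rV[R]_3).
Hypotheses (hW : two_homogeneous W) (aa : dot a a = 1).
Hypothesis ha : forall A, symmetry_of W A -> a *m A = a \/ a *m A = - a.

Variable h : R.
Hypotheses (h0 : (0 : R) < h) (hE : forall w, w \in W -> dot w a = h \/ dot w a = - h).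

Let Wp := [seq w <- W | dot w a == h].
Let Wm := [seq w <- W | dot w a == - h].

Let WpP w : w \in Wp -> w \in W /\ dot w a = h.
Proof. by rewrite mem_filter => /andP[/eqP]. Qed.

Let WmP w : w \in Wm -> w \in W /\ dot w a = - h.
Proof. by rewrite mem_filter => /andP[/eqP]. Qed.

Let WpI w : w \in W -> dot w a = h -> w \in Wp.
Proof. by rewrite mem_filter => -> ->; rewrite eqxx. Qed.

Let WmI w : w \in W -> dot w a = - h -> w \in Wm.
Proof. by rewrite mem_filter => -> ->; rewrite eqxx. Qed.

Let stab_axis A x : symmetry_of W A -> x \in Wp -> x *m A \in Wp -> a *m A = a.
Proof.
have hp := h0.
move=> sA /WpP[_ xh] /WpP[_ xAh]; case: (ha sA) => // e; exfalso.
by have := dot_orth x a sA.1; rewrite e dotNr xAh xh; lra.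
Qed.

Let flip_axis A x : symmetry_of W A -> x \in Wp -> x *m A \in Wm -> a *m A = - a.
Proof.
have hp := h0.
move=> sA /WpP[_ xh] /WmP[_ xAh]; case: (ha sA) => // e; exfalso.
by have := dot_orth x a sA.1; rewrite e xAh xh; lra.
Qed.

Let stab_Wp A w : symmetry_of W A -> a *m A = a -> w \in Wp -> w *m A \in Wp.
Proof.
by move=> sA aA /WpP[wW wh]; apply: WpI; [apply: sA.2 | rewrite -aA dot_orth //; apply: sA.1].
Qed.

Let stab_Wm A w : symmetry_of W A -> a *m A = a -> w \in Wm -> w *m A \in Wm.
Proof.
by move=> sA aA /WmP[wW wh]; apply: WmI; [apply: sA.2 | rewrite -aA dot_orth //; apply: sA.1].
Qed.

Let flip_Wp A w : symmetry_of W A -> a *m A = - a -> w \in Wp -> w *m A \in Wm.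
Proof.
move=> sA aA /WpP[wW wh]; apply: WmI; first exact: sA.2.
by rewrite -(opprK a) -aA dotNr dot_orth ?wh //; apply: sA.1.
Qed.

Let flip_Wm A w : symmetry_of W A -> a *m A = - a -> w \in Wm -> w *m A \in Wp.
Proof.
move=> sA aA /WmP[wW wh]; apply: WpI; first exact: sA.2.
by rewrite -(opprK a) -aA dotNr dot_orth ?wh ?opprK //; apply: sA.1.
Qed.

Let level_total w : w \in W -> w \in Wp \/ w \in Wm.
Proof. by move=> wW; case: (hE wW) => e; [left; apply: WpI | right; apply: WmI]. Qed.

(** The heights sum to zero, so they cannot all have the same sign. *)
Let Wp_Wm : (exists x, x \in Wp) /\ (exists y, y \in Wm).
Proof.
have hp := h0.
have s0 : \sum_(w <- W) dot w a = 0 by rewrite -dot_suml th_sum ?dot0l.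
have [v vW] : exists v, v \in W.
  by move: (th_neq0 hW); case: (W) => // x s _; exists x; rewrite mem_head.
have ne (s : R) : (forall w, w \in W -> dot w a = s) -> s = 0.
  move=> e; have := s0; rewrite big_seq (eq_bigr (fun=> s)); last by move=> w /e.
  rewrite -big_seq big_const_seq count_predT iter_addr_0 => /eqP.
  rewrite mulrn_eq0 size_eq0 => /orP[/eqP W0|/eqP //].
  by move: vW; rewrite W0.
split; apply: contrapT => nx.
- have := ne (- h); have -> : (- h = 0) = False by apply/propext; split => //; lra.
  apply=> w wW; case: (level_total wW) => [wp|/WmP[] //].
  by case: nx; exists w.
- have := ne h; have -> : (h = 0) = False by apply/propext; split => //; lra.
  apply=> w wW; case: (level_total wW) => [/WpP[] //|wm].
  by case: nx; exists w.
Qed.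

Let flip_exists : exists2 B, symmetry_of W B & a *m B = - a.
Proof.
have [[x xp] [y ym]] := Wp_Wm.
have [B sB xB] := th_trans hW (WpP xp).1 (WmP ym).1.
by exists B => //; apply: (flip_axis sB xp); rewrite xB.
Qed.

Let size_levels : size W = (2 * size Wp)%N.
Proof.
have hp := h0.
have [B sB aB] := flip_exists.
have le1 : (size Wp <= size Wm)%N.
  rewrite -(size_map (mulmx^~ B)); apply: uniq_leq_size.
    by rewrite map_inj_uniq ?filter_uniq ?(th_uniq hW) //; apply: orth_inj sB.1.
  by move=> _ /mapP[w ws ->]; apply: flip_Wp.
have le2 : (size Wm <= size Wp)%N.
  rewrite -(size_map (mulmx^~ B)); apply: uniq_leq_size.
    by rewrite map_inj_uniq ?filter_uniq ?(th_uniq hW) //; apply: orth_inj sB.1.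
  by move=> _ /mapP[w ws ->]; apply: flip_Wm.
have e : size Wp = size Wm by apply/eqP; rewrite eqn_leq le1.
rewrite mul2n -addnn {2}e !size_filter -(count_predC (fun w => dot w a == h) W).
congr addn; apply: eq_in_count => w wW /=.
by case: (hE wW) => ->; [have -> : h == - h = false by apply/eqP; lra | rewrite eqxx];
   rewrite ?eqxx //; apply/eqP; lra.
Qed.

Let flat w := w - dot w a *: a.

Let flat_axis w : dot (flat w) a = 0.
Proof. by rewrite /flat !dotL aa; ring. Qed.

Let dot_flat x y : dot (flat x) (flat y) = dot x y - dot x a * dot y a.
Proof. by rewrite /flat !dotL aa (dotC a y); ring. Qed.

Let flat_sym A w : symmetry_of W A -> flat (w *m A) = flat w *m A.
Proof.
move=> sA; rewrite /flat mulmxBl -scalemxAl; congr (_ - _).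
have := dot_orth w a sA.1.
by case: (ha sA) => ->; rewrite ?dotNr => <-; rewrite ?scaleNr ?scalerN ?opprK.
Qed.

Let s2 := 1 - h ^+ 2.

Let dot_flatW w : w \in W -> dot (flat w) (flat w) = s2.
Proof.
by move=> wW; rewrite dot_flat (th_unit hW) // /s2; case: (hE wW) => ->; ring.
Qed.

Let flatp_inj : {in Wp &, injective flat}.
Proof.
move=> x y /WpP[_ xh] /WpP[_ yh]; rewrite /flat xh yh.
exact: addIr.
Qed.

(** Gives access from outside to the size of a level, on which the case of four vertices is split
    off. *)
Lemma size_levels_even : exists2 k, size W = (2 * k)%N & k = size Wp.
Proof. by exists (size Wp) => //; apply: size_levels. Qed.

Hypothesis Wp3 : (2 < size Wp)%N.

Let avoid (s : seq 'rV[R]_3) : (size s <= 2)%N -> exists2 x, x \in Wp & x \notin s.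
Proof.
move=> s2'; apply: contrapT => nx.
have : (size Wp <= size s)%N.
  apply: uniq_leq_size => [|x xp]; first exact/filter_uniq/(th_uniq hW).
  by apply: contrapT => /negP xs; apply: nx; exists x.
by rewrite leqNgt (leq_ltn_trans s2' Wp3).
Qed.

Let s20 : 0 < s2.
Proof.
have [[v vp] _] := Wp_Wm; have [w wp] := avoid (s := [:: v]) isT.
rewrite inE => wv; rewrite lt_neqAle -(dot_flatW (WpP vp).1) dot_ge0 andbT.
apply: contraNneq wv => e; apply/eqP/flatp_inj => //.
have z x : x \in Wp -> flat x = 0.
  move=> /WpP[xW _]; apply/eqP; rewrite -dot_eq0 dot_flatW // -(dot_flatW (WpP vp).1).
  by rewrite -e.
by rewrite !z.
Qed.

Let flatp_trans x y : x \in Wp -> y \in Wp -> exists A,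
  [/\ symmetry_of W A, a *m A = a & x *m A = y].
Proof.
move=> xp yp; have [A sA xA] := th_trans hW (WpP xp).1 (WpP yp).1.
by exists A; split=> //; apply: (stab_axis sA xp); rewrite xA.
Qed.

Let cmax_exists : exists c, [/\ forall x y, x \in Wp -> y \in Wp -> x != y ->
    dot (flat x) (flat y) <= c,
  forall x, x \in Wp -> exists2 y, y \in Wp & y != x /\ dot (flat x) (flat y) = c &
  c < s2].
Proof.
have hp := h0.
have [[v vp] _] := Wp_Wm; have [w wp] := avoid (s := [:: v]) isT; rewrite inE => wv.
pose s := [seq w <- Wp | w != v].
have s0 : s != [::].
  have : w \in s by rewrite mem_filter wv.
  by apply: contraTneq => ->.
have [m ms mmax] := seq_argmax (fun y => dot (flat v) (flat y)) s0.
move: ms; rewrite mem_filter => /andP[mv mp].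
exists (dot (flat v) (flat m)); split.
- move=> x y xp yp xy; have [A [sA aA xA]] := flatp_trans xp vp.
  rewrite -(dot_orth _ _ sA.1) -!flat_sym // xA; apply: mmax.
  rewrite mem_filter stab_Wp // andbT -xA eq_sym.
  by apply: contra_neq xy => /(orth_inj sA.1).
- move=> x xp; have [A [sA aA vA]] := flatp_trans vp xp.
  exists (m *m A); first exact: stab_Wp.
  split; first by rewrite -vA (inj_eq (orth_inj sA.1)).
  by rewrite -vA !flat_sym // dot_orth //; apply: sA.1.
- have : 0 < dot (flat v - flat m) (flat v - flat m).
    rewrite dot_gt0 subr_eq0; apply: contra_neq mv => e.
    by apply/esym/flatp_inj.
  by rewrite dotB !dot_flatW ?(WpP vp).1 ?(WpP mp).1 //; lra.
Qed.

Section RegularLevels.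
Variable c : R.
Hypothesis cmax : forall x y, x \in Wp -> y \in Wp -> x != y ->
    dot (flat x) (flat y) <= c.
Hypothesis two : forall x, x \in Wp -> exists y y', [/\ y \in Wp, y' \in Wp, y != y',
  dot (flat x) (flat y) = c & dot (flat x) (flat y') = c].

Let r := Num.sqrt s2.
Let r0 : 0 < r. Proof. by rewrite sqrtr_gt0. Qed.
Let r2 : r ^+ 2 = s2. Proof. by rewrite sqr_sqrtr // ltW. Qed.

Lemma regular_levels : exists F n (r h phi : R), [/\ orthogonal F, (3 <= n)%N,
  0 < r /\ 0 < h, phi = 0 \/ phi = pi / n%:R & two_ngons W F n r h phi /\
  (forall A, symmetry_of W A -> row 2 F *m A = row 2 F \/ row 2 F *m A = - row 2 F)].
Proof.
have hp := h0.
have [[v vp] _] := Wp_Wm.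
pose e1 := r^-1 *: flat v.
have e11 : dot e1 e1 = 1.
  rewrite dotZl dotZr dot_flatW ?(WpP vp).1 // -r2; field.
  exact: lt0r_neq0.
have e1a : dot e1 a = 0 by rewrite dotZl flat_axis mulr0.
have [e2 o e2a] := complete_frame aa e11 e1a.
have a0 : a != 0 by rewrite -dot_gt0 aa.
have ve1 : flat v = r *: circle_pt e1 e2 0.
  rewrite /circle_pt cos0 sin0 scale1r scale0r addr0 /e1 scalerA mulfV ?scale1r //.
  exact: lt0r_neq0.
have pol w : w \in W -> exists2 t, 0 <= t < 2 * pi & flat w = r *: circle_pt e1 e2 t.
  move=> wW; apply: (plane_polar o a0); rewrite ?(dotC a) ?flat_axis //.
  by rewrite dot_flatW // r2.
have [B sB aB] := flip_exists.
have Bm y : y \in Wm -> exists2 x, x \in Wp & y = x *m B.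
  move=> ym; have sT := sym_tr hW sB.
  exists (y *m B^T); last by rewrite orthVK //; apply: sB.1.
  apply: flip_Wm => //; rewrite -[RHS](orthK _ sB.1) mulNmx aB opprK.
  by [].
pose T := map flat Wp; pose T' := map flat Wm.
have [n [n3 cE TE]] : exists n, [/\ (3 <= n)%N, c = r ^+ 2 * cos (2 * pi / n%:R) &
    forall t, r *: circle_pt e1 e2 t \in T -> forall x,
    x \in T <-> exists2 j : nat, (j < n)%N &
      x = r *: circle_pt e1 e2 (t + 2 * pi * j%:R / n%:R)].
  apply: regular_polygon => //.
  - by rewrite -size_eq0 size_map -lt0n (ltn_trans _ Wp3).
  - by move=> _ /mapP[w wp ->]; apply/pol/(WpP wp).1.
  - move=> _ _ /mapP[x xp ->] /mapP[y yp ->] xy; apply: cmax => //.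
    by apply: contra_neq xy => ->.
  - move=> _ /mapP[x xp ->]; have [y [y' [yp y'p yy' xy xy']]] := two xp.
    exists (flat y), (flat y'); split; rewrite ?map_f //.
    by apply: contra_neq yy'; apply: flatp_inj.
have cmax' x y : x \in Wm -> y \in Wm -> flat x != flat y -> dot (flat x) (flat y) <= c.
  move=> /Bm[x' xp ->] /Bm[y' yp ->]; rewrite !flat_sym // dot_orth; last exact: sB.1.
  by move=> xy; apply: cmax => //; apply: contra_neq xy => ->.
have [n' [n3' cE' TE']] : exists n, [/\ (3 <= n)%N, c = r ^+ 2 * cos (2 * pi / n%:R) &
    forall t, r *: circle_pt e1 e2 t \in T' -> forall x,
    x \in T' <-> exists2 j : nat, (j < n)%N &
      x = r *: circle_pt e1 e2 (t + 2 * pi * j%:R / n%:R)].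
  apply: regular_polygon => //.
  - have [_ [y ym]] := Wp_Wm; apply/eqP => T0.
    by have : flat y \in T' by [apply: map_f]; rewrite T0.
  - by move=> _ /mapP[w wp ->]; apply/pol/(WmP wp).1.
  - by move=> _ _ /mapP[x xp ->] /mapP[y yp ->] xy; apply: cmax'.
  - move=> _ /mapP[x' /Bm[x xp ->] ->]; have [y [y' [yp y'p yy' xy xy']]] := two xp.
    exists (flat (y *m B)), (flat (y' *m B)); split.
    + by apply/map_f/flip_Wp.
    + by apply/map_f/flip_Wp.
    + by rewrite !flat_sym // (inj_eq (orth_inj sB.1)); apply: contra_neq yy'; apply: flatp_inj.
    + by rewrite !flat_sym // dot_orth //; apply: sB.1.
    + by rewrite !flat_sym // dot_orth //; apply: sB.1.
have p0 := pi_gt0 R.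
have angle m : (3 <= m)%N -> 0 < (2 * pi / m%:R : R) < pi.
  move=> m3; have m0 : 0 < m%:R :> R by rewrite ltr0n (leq_trans _ m3).
  apply/andP; split; first by apply: divr_gt0 => //; apply: mulr_gt0.
  by rewrite ltr_pdivrMr // (mulrC pi) ltr_pM2r // ltr_nat.
have n0R : n%:R != 0 :> R by rewrite pnatr_eq0 -lt0n (leq_trans _ n3).
(* Both polygons have the same radius and the same largest inner product [c], and cosine is
   injective on [0, pi]. *)
have nn' : n' = n.
  have n0R' : n'%:R != 0 :> R by rewrite pnatr_eq0 -lt0n (leq_trans _ n3').
  move: cE; rewrite cE' => /(mulfI (lt0r_neq0 (exprn_gt0 2 r0))).
  have /andP[g1 g2] := angle _ n3; have /andP[g1' g2'] := angle _ n3'.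
  move/cos_inj; rewrite !in_itv /= (ltW g1) (ltW g2) (ltW g1') (ltW g2').
  move=> /(_ isT isT)/(mulfI _) e; apply/eqP; rewrite -(eqr_nat R).
  by apply/eqP/invr_inj/e; rewrite mulf_neq0 ?pnatr_eq0 // lt0r_neq0.
rewrite {}nn' in n3' cE' TE'.
set th := 2 * pi / n%:R in cE.
have /andP[th0 thp] : 0 < th < pi := angle _ n3.
have thE j : 2 * pi * j%:R / n%:R = j%:R * th by rewrite /th mulrAC [RHS]mulrC.
have thn : n%:R * th = 2 * pi by rewrite /th mulrC divfK.
have rI : injective (fun x : 'rV[R]_3 => r *: x) by apply/scalerI/lt0r_neq0.
have dotp s t : dot (r *: circle_pt e1 e2 s) (r *: circle_pt e1 e2 t) =
    r ^+ 2 * cos (s - t).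
  by rewrite dotZl dotZr dot_circle_pt // mulrA expr2.
have [psi [/andP[psi0 psith] psiT]] : exists psi, 0 <= psi < th /\
    r *: circle_pt e1 e2 psi \in T'.
  have [_ [y ym]] := Wp_Wm; have [s /andP[s0 s2'] sE] := pol _ (WmP ym).1.
  have sT : r *: circle_pt e1 e2 s \in T' by rewrite -sE map_f.
  have [k /andP[k1 k2]] : exists k : nat, k%:R * th <= s < k.+1%:R * th.
    exists (Num.truncn (s / th)); rewrite -ler_pdivlMr // -ltr_pdivrMr //.
    by apply: truncn_itv; rewrite divr_ge0 // ltW.
  have kn : (k < n)%N by rewrite -(ltr_nat R) -(ltr_pM2r th0) thn; lra.
  exists (s - k%:R * th); split.
    by move: k2; rewrite -(natr1 k) mulrDl mul1r => k2; apply/andP; split; lra.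
  apply/(TE' s sT); have [k0|k0] := posnP k.
    exists 0%N; first exact: leq_trans n3.
    by rewrite k0 mul0r subr0 mulr0 mul0r addr0.
  exists (n - k)%N; first by rewrite ltn_subrL k0 (leq_trans _ n3).
  rewrite thE natrB 1?ltnW // mulrBl thn; congr (_ *: _).
  by rewrite -[LHS]circle_ptD2; congr (circle_pt _ _ _); lra.
(* Fixing [v] and carrying one nearest neighbour on its circle to the other gives a symmetry that
   moves a point of the level; on the plane of the circle it must then be the reflection in the line
   of [e1]. *)
have [A [sA aA vA nA]] : exists A, [/\ symmetry_of W A, a *m A = a, v *m A = v &
    exists2 y, y \in Wp & y *m A != y].
  have [y [y' [yp y'p yy' xy xy']]] := two vp.
  have [|A [sA vA yA]] := th_hom hW (WpP vp).1 (WpP yp).1 (WpP vp).1 (WpP y'p).1.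
    have := xy; rewrite -xy' !dot_flat (WpP yp).2 (WpP y'p).2; lra.
  exists A; split=> //; first by apply: (stab_axis sA vp); rewrite vA.
  by exists y => //; rewrite yA eq_sym.
have e1A : e1 *m A = e1 by rewrite /e1 -scalemxAl -flat_sym // vA.
clearbody e1.
have e2A : e2 *m A = - e2.
  have [q1 q2 q12] := o.
  have d1 : dot (e2 *m A) e1 = 0 by rewrite -e1A dot_orth ?(dotC e2) //; apply: sA.1.
  have d2 : dot (e2 *m A) a = 0 by rewrite -aA dot_orth //; apply: sA.1.
  have dd : dot (e2 *m A) (e2 *m A) = 1 by rewrite dot_orth //; apply: sA.1.
  have eA := plane_decomp o a0 (etrans (dotC _ _) e1a) (etrans (dotC _ _) e2a) d2.
  rewrite d1 scale0r add0r in eA; move: dd; rewrite eA dotZl dotZr q2 mulr1 -expr2.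
  move/eqP; rewrite sqrf_eq1 => /orP[]/eqP k; last by rewrite k scaleN1r.
  have [y yp /eqP []] := nA; rewrite k scale1r in eA.
  have [t _ yE] := pol _ (WpP yp).1.
  apply: flatp_inj => //; first exact: stab_Wp.
  by rewrite flat_sym // yE -scalemxAl /circle_pt mulmxDl -!scalemxAl e1A eA.
have ptA t : circle_pt e1 e2 t *m A = circle_pt e1 e2 (- t).
  by rewrite /circle_pt mulmxDl -!scalemxAl e1A e2A cosN sinN scalerN scaleNr.
have psiA : r *: circle_pt e1 e2 (- psi) \in T'.
  case/mapP: psiT => w wm wE; apply/mapP; exists (w *m A); first exact: stab_Wm.
  by rewrite flat_sym // -wE -scalemxAl ptA.
(* The reflection puts [- psi], hence [- psi + th], into the lower polygon. For 0 < psi < th this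
   point is less than [th] away from [psi], so the two coincide. *)
have psiE : psi = 0 \/ psi = pi / n%:R.
  have [->|ps0] := eqVneq psi 0; first by left.
  right; have {}ps0 : 0 < psi by rewrite lt_neqAle eq_sym ps0.
  have h1 : r *: circle_pt e1 e2 (- psi + th) \in T'.
    apply/(TE' _ psiA); exists 1%N; first exact: leq_trans n3.
    by rewrite mulr1.
  have e : circle_pt e1 e2 psi = circle_pt e1 e2 (- psi + th).
    apply: contrapT => ne.
    case/mapP: psiT => x xm xE; case/mapP: h1 => y ym yE.
    have : dot (flat x) (flat y) <= c.
      by apply: cmax' => //; rewrite -xE -yE; apply/eqP => /rI /ne.
    rewrite -xE -yE dotp cE ler_pM2l ?exprn_gt0 // leNgt.
    by rewrite cos_gt_close //; lra.
  have : cos (psi - (- psi + th)) = cos 0.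
    by rewrite -(dot_circle_pt _ _ o) e dot_circle_pt // subrr.
  rewrite -cos_norm; move/cos_inj; rewrite !in_itv /= => g.
  have /eqP : `|psi - (- psi + th)| = 0.
    apply: g; rewrite ?lexx ?(ltW p0) // normr_ge0 /= ler_norml.
    by apply/andP; split; lra.
  rewrite normr_eq0 => /eqP g'; have -> : psi = th / 2 by lra.
  by rewrite /th; field.
exists (rows3 e1 e2 a), n, r, h, psi; split=> //.
- by apply: orth_rows3; rewrite // dotC.
- split; last by move=> A' sA'; rewrite rowK /=; apply: ha.
  have T0 : r *: circle_pt e1 e2 0 \in T by rewrite -ve1 map_f.
  have vr t (k : R) : vec (r * cos t) (r * sin t) k *m rows3 e1 e2 a =
      r *: circle_pt e1 e2 t + k *: a.
    by rewrite vec_rows3 /circle_pt scalerDr !scalerA.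
  move=> y; split=> [yW|[j jn]].
    case: (level_total yW) => [yp|ym].
      have /(TE 0 T0)[j jn e] : flat y \in T by apply: map_f.
      exists j => //; left; rewrite vr; rewrite add0r in e; rewrite -e /flat (WpP yp).2.
      by rewrite subrK.
    have /(TE' psi psiT)[j jn e] : flat y \in T' by apply: map_f.
    exists j => //; right; rewrite vr -e /flat (WmP ym).2.
    by rewrite subrK.
  rewrite !vr => -[->|->].
    have /(TE 0 T0)/mapP[w wp ->] : exists2 j0, (j0 < n)%N & r *: circle_pt e1 e2
        (2 * pi * j%:R / n%:R) = r *: circle_pt e1 e2 (0 + 2 * pi * j0%:R / n%:R).
      by exists j; rewrite ?add0r.
    by rewrite /flat (WpP wp).2 subrK; apply: (WpP wp).1.
  have /(TE' psi psiT)/mapP[w wm ->] : exists2 j0, (j0 < n)%N & r *: circle_pt e1 e2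
        (psi + 2 * pi * j%:R / n%:R) = r *: circle_pt e1 e2 (psi + 2 * pi * j0%:R / n%:R).
    by exists j.
  by rewrite /flat (WmP wm).2 subrK; apply: (WmP wm).1.
Qed.

End RegularLevels.

Section UniqueNearest.
Variable c : R.
Hypothesis cmax : forall x y, x \in Wp -> y \in Wp -> x != y ->
    dot (flat x) (flat y) <= c.
Variables v m : 'rV[R]_3.
Hypotheses (vp : v \in Wp) (mp : m \in Wp) (mv : m != v)
  (vm : dot (flat v) (flat m) = c).
Hypothesis near_m : forall y, y \in Wp -> y != v -> dot (flat v) (flat y) = c -> y = m.

(** Otherwise [m] is diametrically opposite to [v], at the least possible inner product; as [c] is
    also the largest one, a third point of the level would coincide with [m]. *)
Let indep : cross (flat v) (flat m) != 0.
Proof.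
have hp := h0; have sp := s20.
have [vW mW] := ((WpP vp).1, (WpP mp).1).
rewrite -dot_gt0 dot_cross2 !dot_flatW //.
have e (x y : 'rV[R]_3) : x \in W -> y \in W ->
    0 <= s2 - dot (flat x) (flat y) /\ 0 <= s2 + dot (flat x) (flat y).
  move=> xW yW; have := dot_ge0 (flat x - flat y); have := dot_ge0 (flat x + flat y).
  by rewrite dotB dotDD !dot_flatW //; lra.
have d1 : dot (flat v) (flat m) < s2.
  rewrite lt_neqAle; have [g _] := e v m vW mW; apply/andP; split; last by lra.
  apply: contra_neq mv => g'; apply/esym/flatp_inj => //; apply: eq_dotB.
  by rewrite dotB !dot_flatW // g'; lra.
have d2 : - s2 < dot (flat v) (flat m).
  rewrite lt_neqAle; have [_ g] := e v m vW mW; apply/andP; split; last by lra.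
  apply/eqP => g'.
  have opp x : x \in Wp -> dot (flat v) (flat x) = - s2 -> flat x = - flat v.
    move=> xp x'; apply: eq_dotB; rewrite opprK dotDD (dotC (flat x)) x'.
    by rewrite !dot_flatW ?(WpP xp).1 //; lra.
  have [t tp] := avoid (s := [:: v; m]) isT; rewrite !inE negb_or => /andP[tv tm].
  have [_ g2] := e v t vW (WpP tp).1.
  have := cmax vp tp; rewrite eq_sym tv -vm -g' => /(_ isT) g3.
  have g4 : dot (flat v) (flat t) = - s2 by lra.
  by case/eqP: tm; apply: flatp_inj => //; rewrite (opp t tp g4) (opp m mp (esym g')).
have : 0 < (s2 - dot (flat v) (flat m)) * (s2 + dot (flat v) (flat m)).
  by apply: mulr_gt0; lra.
by lra.
Qed.

Let a_neq0 : a != 0.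
Proof. by rewrite -dot_gt0 aa. Qed.

(** Being unique, [m] is fixed along with [v] and the axis; together they span the space. *)
Let stab_v A : symmetry_of W A -> v *m A = v -> A = 1%:M.
Proof.
move=> sA vA; have aA : a *m A = a by apply: (stab_axis sA vp); rewrite vA.
have fv : flat v *m A = flat v by rewrite -flat_sym // vA.
have mA : m *m A = m.
  apply: near_m; first exact: stab_Wp.
    by rewrite -vA (inj_eq (orth_inj sA.1)).
  by rewrite -{1}fv flat_sym // dot_orth //; apply: sA.1.
have fm : flat m *m A = flat m by rewrite -flat_sym // mA.
apply: (span_mx hW) => x _; rewrite mulmx1; apply/eqP; rewrite -subr_eq0; apply/eqP.
have fixed y : y *m A = y -> dot (x *m A - x) y = 0.
  by move=> yA; rewrite dotDl dotNl -{1}yA dot_orth ?subrr //; apply: sA.1.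
apply: (eq_of_dots indep); rewrite dot0l; [exact: fixed | exact: fixed |].
by apply: (coplanar a_neq0); rewrite ?flat_axis ?fixed.
Qed.

(** With a trivial stabilizer, the symmetry carrying [v] to a given vertex is unique, so it is the
    one exchanging the two. *)
Let involution A : symmetry_of W A -> A *m A = 1%:M.
Proof.
move=> sA; have vW := (WpP vp).1; have zW := sA.2 _ vW.
have [B [sB vB zB]] := th_swap hW vW zW.
have e : A *m B^T = 1%:M.
  apply: stab_v; first by apply: sym_mul => //; apply: sym_tr.
  by rewrite mulmxA -vB orthK //; apply: sB.1.
have AB : A = B by rewrite -[A]mulmx1 -(orthV sB.1) mulmxA e mul1mx.
by apply: stab_v; [apply: sym_mul | rewrite mulmxA {2}AB zB].
Qed.

Let commute A B : symmetry_of W A -> symmetry_of W B -> A *m B = B *m A.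
Proof.
move=> sA sB; have e := involution (sym_mul sA sB).
have h2 : A *m B *m A = B.
  by rewrite -[LHS]mulmx1 -(involution sB) !mulmxA -(mulmxA (A *m B)) e mul1mx.
by rewrite -[LHS]mulmx1 -(involution sA) mulmxA h2.
Qed.

Lemma box_levels : exists X Y Z : R, [/\ 0 < X, 0 < Y, 0 < Z,
  [/\ X ^+ 2 + Y ^+ 2 != Z ^+ 2, Y ^+ 2 + Z ^+ 2 != X ^+ 2 & X ^+ 2 + Z ^+ 2 != Y ^+ 2]
  & modelled W (box_pts X Y Z)].
Proof.
have hp := h0; have sp := s20.
(* The second point to avoid is diametrically opposite to [v] on its circle; for it the fixed
   direction [g] would vanish. *)
have [z zp] := avoid (s := [:: v; 2 * h *: a - v]) isT.
rewrite !inE negb_or => /andP[zv zv'].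
have [[vW va] [zW za]] := (WpP vp, WpP zp).
have [R1 [sR vR zR]] := th_swap hW vW zW.
have aR : a *m R1 = a by apply: (stab_axis sR vp); rewrite vR.
pose g := flat v + flat z; pose k := flat v - flat z.
have gg : 0 < dot g g.
  rewrite dot_gt0; apply: contra_neq zv' => /eqP; rewrite addr_eq0 => /eqP e.
  apply/eqP; rewrite -subr_eq0; apply/eqP.
  have -> : z - (2 * h *: a - v) = flat z + flat v.
    by rewrite /flat va za; apply/rowP => i; rewrite !mxE; ring.
  by rewrite e subrr.
have kk : 0 < dot k k.
  by rewrite dot_gt0 subr_eq0; apply: contra_neq zv => /flatp_inj ->.
have [gk gv kv] := sum_diff (dot_flatW vW) (dot_flatW zW).
rewrite -/g -/k in gk gv kv.
have {}gv : 0 < dot g (flat v) by rewrite gv; lra.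
have {}kv : 0 < dot k (flat v) by rewrite kv; lra.
have ga : dot g a = 0 by rewrite /g dotDl (flat_axis v) (flat_axis z) addr0.
have ka : dot k a = 0 by rewrite /k dotDl dotNl (flat_axis v) (flat_axis z) subr0.
have fvR : flat v *m R1 = flat z by rewrite -flat_sym // vR.
have fzR : flat z *m R1 = flat v by rewrite -flat_sym // zR.
have gR : g *m R1 = g by rewrite /g mulmxDl fvR fzR [LHS]addrC.
have kR : k *m R1 = - k by rewrite /k mulmxBl fvR fzR -[LHS]opprB.
clearbody g k.
pose f1 := (enorm g)^-1 *: g; pose f2 := (enorm k)^-1 *: k.
have ng : 0 < (enorm g)^-1 by rewrite invr_gt0 sqrtr_gt0.
have nk : 0 < (enorm k)^-1 by rewrite invr_gt0 sqrtr_gt0.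
have f11 : dot f1 f1 = 1 by apply: normalize; rewrite -dot_gt0.
have f22 : dot f2 f2 = 1 by apply: normalize; rewrite -dot_gt0.
have f12 : dot f1 f2 = 0 by rewrite dotZl dotZr gk !mulr0.
have f1a : dot f1 a = 0 by rewrite dotZl ga mulr0.
have f2a : dot f2 a = 0 by rewrite dotZl ka mulr0.
have f1R : f1 *m R1 = f1 by rewrite -scalemxAl gR.
have f2R : f2 *m R1 = - f2 by rewrite -scalemxAl kR scalerN.
have X0 : 0 < dot (flat v) f1 by rewrite dotC dotZl mulr_gt0.
have Y0 : 0 < dot (flat v) f2 by rewrite dotC dotZl mulr_gt0.
clearbody f1 f2.
set X := dot _ f1 in X0; set Y := dot _ f2 in Y0.
have o12 : orthonormal2 f1 f2 by [].
have dec x : dot x a = 0 -> x = dot x f1 *: f1 + dot x f2 *: f2.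
  by apply: (plane_decomp o12 a_neq0); rewrite dotC.
have unit_pm (i : R) : i * i = 1 -> i = 1 \/ i = -1.
  by move/eqP; rewrite -expr2 sqrf_eq1 => /orP[]/eqP; [left | right].
(* Every symmetry commutes with [R1], which fixes [f1] and negates [f2], so it preserves both
   lines. *)
have diag A : symmetry_of W A -> (f1 *m A = f1 \/ f1 *m A = - f1) /\
    (f2 *m A = f2 \/ f2 *m A = - f2).
  move=> sA; have cA := commute sA sR.
  have axis x : dot x a = 0 -> dot (x *m A) a = 0.
    move=> xa; have := dot_orth x a sA.1; rewrite xa.
    by case: (ha sA) => ->; rewrite ?dotNr //; move/eqP; rewrite oppr_eq0 => /eqP.
  have cross0 : dot (f1 *m A) f2 = 0.
    have : dot (f1 *m A *m R1) (f2 *m R1) = dot (f1 *m A) f2 by rewrite dot_orth //; apply: sR.1.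
    by rewrite -mulmxA cA mulmxA f1R f2R dotNr; lra.
  have cross0' : dot (f2 *m A) f1 = 0.
    have : dot (f2 *m A *m R1) (f1 *m R1) = dot (f2 *m A) f1 by rewrite dot_orth //; apply: sR.1.
    by rewrite -mulmxA cA mulmxA f1R f2R mulNmx dotNl; lra.
  have e1 := dec _ (axis _ f1a); have e2 := dec _ (axis _ f2a).
  rewrite cross0 scale0r addr0 in e1; rewrite cross0' scale0r add0r in e2.
  split.
    have : dot (f1 *m A) (f1 *m A) = 1 by rewrite dot_orth //; apply: sA.1.
    rewrite e1 dotZl dotZr f11 mulr1 => /unit_pm[] ->; rewrite ?scale1r ?scaleN1r; auto.
  have : dot (f2 *m A) (f2 *m A) = 1 by rewrite dot_orth //; apply: sA.1.
  rewrite e2 dotZl dotZr f22 mulr1 => /unit_pm[] ->; rewrite ?scale1r ?scaleN1r; auto.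
pose F := rows3 f1 f2 a.
have oF : orthogonal F by apply: orth_rows3.
have vF : v = vec X Y h *m F.
  by rewrite vec_rows3 -dec ?flat_axis // /flat va subrK.
pose M (i j l : R) := vec i j l *m F \in W.
have MA A (i j l : R) : symmetry_of W A -> vec i j l *m F *m A =
    i *: (f1 *m A) + j *: (f2 *m A) + l *: (a *m A).
  by move=> sA; rewrite vec_rows3 !mulmxDl !scalemxAl.
have MR (i j l : R) : M i j l -> M i (- j) l.
  move=> m1; have := sR.2 _ m1; rewrite MA // f1R f2R aR scalerN -scaleNr.
  by rewrite /M vec_rows3.
have [t tp] := avoid (s := [:: v; z]) isT.
rewrite !inE negb_or => /andP[tv tz]; have [tW ta] := WpP tp.
have zF : z = vec X (- Y) h *m F.
  by rewrite -vR vF MA // f1R f2R aR vec_rows3 scalerN scaleNr.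
have MD (i j l : R) : M i j l -> M (- i) j l.
  have [D sD vD] := th_trans hW vW tW.
  have aD : a *m D = a by apply: (stab_axis sD vp); rewrite vD.
  have [d1 d2] := diag D sD.
  have {}d1 : f1 *m D = - f1.
    case: d1 => // d1; case: d2 => d2; move: vD; rewrite vF MA // d1 d2 aD => e.
      by case/eqP: tv; rewrite -e vF vec_rows3.
    by case/eqP: tz; rewrite -e zF vec_rows3 scalerN scaleNr.
  move=> m1; have := sD.2 _ m1; rewrite MA // d1 aD scalerN -scaleNr.
  by case: d2 => ->; rewrite ?scalerN -?scaleNr -vec_rows3 // => /MR; rewrite opprK.
have MB (i j l : R) : M i j l -> M i j (- l).
  have [B sB aB] := flip_exists; have [d1 d2] := diag B sB.
  move=> m1; have := sB.2 _ m1; rewrite MA // aB.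
  case: d1 => ->; case: d2 => ->; rewrite ?scalerN -?scaleNr -vec_rows3 //.
  - by move/MR; rewrite opprK.
  - by move/MD; rewrite opprK.
  - by move/MD/MR; rewrite !opprK.
have m0 : M X Y h by rewrite /M -vF.
have vdot (i j l i' j' l' : R) : dot (vec i j l *m F) (vec i' j' l' *m F) =
  i * i' + j * j' + l * l' by rewrite dot_orth // dot_vec.
(* With a trivial stabilizer, the inner product with [v] identifies a vertex. A forbidden relation
   such as X^2 + Y^2 = h^2 would give the opposite vertices (-X, -Y, h) and (X, Y, -h) the same
   inner product. *)
have distinct p q : p \in W -> q \in W -> dot v p = dot v q -> p = q.
  move=> pW qW e; have [A [sA vA <-]] := th_hom hW vW pW vW qW e.
  by rewrite (stab_v sA vA) mulmx1.
have FI := orth_inj oF.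
exists X, Y, h; split=> //.
- split; apply/eqP => e.
  + have := distinct _ _ (MD _ _ _ (MR _ _ _ m0)) (MB _ _ _ m0).
    rewrite {1 2}vF !vdot => /(_ _)/FI/vec_inj[|]; lra.
  + have := distinct _ _ (MR _ _ _ (MB _ _ _ m0)) (MD _ _ _ m0).
    rewrite {1 2}vF !vdot => /(_ _)/FI/vec_inj[|]; lra.
  + have := distinct _ _ (MD _ _ _ (MB _ _ _ m0)) (MR _ _ _ m0).
    rewrite {1 2}vF !vdot => /(_ _)/FI/vec_inj[|]; lra.
- exists F, 1; split=> // y; apply/idP/mapP => [yW|].
    have [A sA <-] := th_trans hW vW yW; have [d1 d2] := diag A sA.
    rewrite vF MA //; case: d1 => ->; case: d2 => ->; case: (ha sA) => ->;
    rewrite ?scalerN -?scaleNr -vec_rows3 -[vec _ _ _ *m _]scale1r; eexists; try reflexivity;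
    by rewrite !inE eqxx ?orbT.
  move=> [p ps ->]; rewrite scale1r; move: ps; rewrite !inE.
  do ?[case/orP => [/eqP->|]]; last move/eqP->.
  + exact: m0.
  + exact: (MD _ _ _ m0).
  + exact: (MR _ _ _ m0).
  + exact: (MB _ _ _ m0).
  + exact: (MD _ _ _ (MR _ _ _ m0)).
  + exact: (MD _ _ _ (MB _ _ _ m0)).
  + exact: (MR _ _ _ (MB _ _ _ m0)).
  + exact: (MD _ _ _ (MR _ _ _ (MB _ _ _ m0))).
Qed.

End UniqueNearest.
Lemma levels_classification :
  (exists F n (r h phi : R), [/\ orthogonal F, (3 <= n)%N,
    0 < r /\ 0 < h, phi = 0 \/ phi = pi / n%:R & two_ngons W F n r h phi /\
    (forall A, symmetry_of W A -> row 2 F *m A = row 2 F \/ row 2 F *m A = - row 2 F)]) \/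
  (exists X Y Z : R, [/\ 0 < X, 0 < Y, 0 < Z,
    [/\ X ^+ 2 + Y ^+ 2 != Z ^+ 2, Y ^+ 2 + Z ^+ 2 != X ^+ 2 & X ^+ 2 + Z ^+ 2 != Y ^+ 2]
    & modelled W (box_pts X Y Z)]).
Proof.
have [c [cmax catt _]] := cmax_exists.
have [two|ntwo] := pselect (forall x, x \in Wp -> exists y y',
  [/\ y \in Wp, y' \in Wp, y != y',
  dot (flat x) (flat y) = c & dot (flat x) (flat y') = c]).
  by left; apply: (regular_levels cmax two).
right; have [v vp nv] : exists2 v, v \in Wp & ~ exists y y',
  [/\ y \in Wp, y' \in Wp, y != y',
  dot (flat v) (flat y) = c & dot (flat v) (flat y') = c].
  apply: contrapT => nv; apply: ntwo => x xp; apply: contrapT => nx.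
  by apply: nv; exists x.
have [m mp [mv vm]] := catt v vp.
apply: (box_levels cmax vp mp mv vm) => y yp yv vy.
by apply: contrapT => /eqP ym; apply: nv; exists y, m.
Qed.

End Reducible.

Section ReducibleClassification.
Variable R : realType.

Lemma reducible_classification (W : seq 'rV[R]_3) (a : 'rV[R]_3) :
  two_homogeneous W -> dot a a = 1 ->
  (forall A, symmetry_of W A -> a *m A = a \/ a *m A = - a) ->
  size W = 4%N \/
  (exists F n (r h phi : R), [/\ orthogonal F, (3 <= n)%N,
    0 < r /\ 0 < h, phi = 0 \/ phi = pi / n%:R & two_ngons W F n r h phi /\
    (forall A, symmetry_of W A -> row 2 F *m A = row 2 F \/ row 2 F *m A = - row 2 F)]) \/
  (exists X Y Z : R, [/\ 0 < X, 0 < Y, 0 < Z,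
    [/\ X ^+ 2 + Y ^+ 2 != Z ^+ 2, Y ^+ 2 + Z ^+ 2 != X ^+ 2 & X ^+ 2 + Z ^+ 2 != Y ^+ 2]
    & modelled W (box_pts X Y Z)]).
Proof.
move=> hW aa ha.
have [v vW] : exists v, v \in W.
  by move: (th_neq0 hW); case: (W) => // x s _; exists x; rewrite mem_head.
pose h := `|dot v a|.
have hE w : w \in W -> dot w a = h \/ dot w a = - h.
  move=> wW; have [A sA vA] := th_trans hW vW wW.
  have : dot w a = dot v a \/ dot w a = - dot v a.
    have := dot_orth v a sA.1; rewrite vA.
    by case: (ha A sA) => ->; rewrite ?dotNr => <-; rewrite ?opprK; auto.
  by rewrite /h; case: (ler0P (dot v a)) => _ [->|->]; rewrite ?opprK; auto.
have h0 : 0 < h.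
  rewrite normr_gt0; apply/eqP => va0.
  have a0 : a = 0.
    by apply: (th_span hW) => w /hE; rewrite /h va0 normr0 oppr0 dotC => -[].
  by move: aa; rewrite a0 dot0l => /eqP; rewrite eq_sym oner_eq0.
have [k sk kE] := size_levels_even hW ha h0 hE.
have [k3|k3] := leqP 3 k.
  by right; apply: (levels_classification hW aa ha h0 hE); rewrite -kE.
(* Levels with fewer than three points: none is excluded, one each would make [W] a pair of opposite
   points, and two each give four vertices. *)
left; case: k k3 sk {kE} => [|[|[|//]]] _ sk.
- by have := th_neq0 hW; rewrite -size_eq0 sk.
- have [w wW [wv wv']] := th_not_line v hW; case: wv'.
  have us : uniq [:: v; w] by rewrite /= inE eq_sym; case: eqP.
  have ss : {subset [:: v; w] <= W} by move=> x; rewrite !inE => /orP[]/eqP->.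
  have sz : (size W <= size [:: v; w])%N by rewrite sk.
  have [_ e] := uniq_min_size us ss sz.
  have pe : perm_eq W [:: v; w].
    by apply: uniq_perm; rewrite ?(th_uniq hW) // => x; rewrite e.
  have := th_sum hW; rewrite (perm_big _ pe) /= !big_cons big_nil addr0.
  by move/eqP; rewrite addrC addr_eq0 => /eqP.
- exact: sk.
Qed.

End ReducibleClassification.

(** * Convex polytopes *)

Section Convexity.
Variable R : realType.

Definition convexS n (A : set 'rV[R]_n) := forall x y (t : R), A x -> A y ->
  0 < t < 1 -> A (t *: x + (1 - t) *: y).

Lemma convex_setP n (A : set 'rV[R]_n) : @convex_set R 'rV[R]_n A <-> convexS A.
Proof.
split=> [cA x y t Ax Ay /andP[t0 t1]|cA].
  have := cA x y (Itv01 (ltW t0) (ltW t1)) (mem_set Ax) (mem_set Ay).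
  by move/set_mem.
apply/convex_setW => x y /set_mem Ax /set_mem Ay k k0 k1; apply/mem_set.
by apply: (cA x y k%:num) => //; rewrite k0.
Qed.

Lemma conv_sub n (S : set 'rV[R]_n) : S `<=` conv_hull S.
Proof. exact: sub_gen_smallest. Qed.

Lemma conv_min n (S A : set 'rV[R]_n) : convexS A -> S `<=` A -> conv_hull S `<=` A.
Proof. by move=> /convex_setP cA SA; apply: smallest_sub. Qed.

Lemma conv_convex n (S : set 'rV[R]_n) : convexS (conv_hull S).
Proof.
move=> x y t Sx Sy t01 A [cA SA].
by move/convex_setP: (cA); apply => //; [apply: Sx | apply: Sy].
Qed.

Lemma conv_convex_le n (S : set 'rV[R]_n) x y t : conv_hull S x -> conv_hull S y ->
  0 <= t <= 1 -> conv_hull S (t *: x + (1 - t) *: y).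
Proof.
move=> Sx Sy /andP[t0 t1].
have [->|tn0] := eqVneq t 0; first by rewrite scale0r add0r subr0 scale1r.
have [->|tn1] := eqVneq t 1; first by rewrite subrr scale0r addr0 scale1r.
by apply: conv_convex => //; rewrite !lt_neqAle t0 t1 tn1 eq_sym tn0.
Qed.

Lemma conv_mono n (S T : set 'rV[R]_n) : S `<=` T -> conv_hull S `<=` conv_hull T.
Proof.
by move=> ST; apply: conv_min; [apply: conv_convex | move=> x /ST; apply: conv_sub].
Qed.

Lemma conv_eq n (S T : set 'rV[R]_n) : S `<=` conv_hull T -> T `<=` conv_hull S ->
  conv_hull S = conv_hull T.
Proof.
by move=> h1 h2; apply/seteqP; split; apply: conv_min => //; apply: conv_convex.
Qed.

Lemma conv_affine m n (f : 'rV[R]_m -> 'rV[R]_n) (S : set 'rV[R]_m) :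
  (forall x y t, f (t *: x + (1 - t) *: y) = t *: f x + (1 - t) *: f y) ->
  f @` conv_hull S = conv_hull (f @` S).
Proof.
move=> fa; apply/seteqP; split.
  move=> _ [x Sx <-]; suff : conv_hull S `<=` [set x | conv_hull (f @` S) (f x)] by apply.
  apply: conv_min => [{Sx}x y t /= hx hy t01|y Sy].
    by rewrite fa; apply: conv_convex.
  by apply: conv_sub; exists y.
apply: conv_min => [_ _ t [x Sx <-] [y Sy <-] t01|_ [x Sx <-]].
  by exists (t *: x + (1 - t) *: y); [apply: conv_convex | rewrite fa].
by exists x => //; apply: conv_sub.
Qed.

Lemma halfspace_convex n (u : 'rV[R]_n) b : convexS [set x | dot u x <= b].
Proof.
move=> x y t /= ux uy /andP[t0 t1]; rewrite dotDr !dotZr.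
have : t * dot u x <= t * b by rewrite ler_pM2l.
have : (1 - t) * dot u y <= (1 - t) * b by rewrite ler_pM2l // subr_gt0.
by lra.
Qed.

Lemma hyperplane_convex n (u : 'rV[R]_n) b : convexS [set x | dot u x = b].
Proof. by move=> x y t /= ux uy t01; rewrite dotDr !dotZr ux uy; ring. Qed.

Lemma conv_cons n (p : 'rV[R]_n) (T : set 'rV[R]_n) x : T !=set0 ->
  conv_hull (p |` T) x ->
  exists a y, [/\ 0 <= a <= 1, conv_hull T y & x = a *: p + (1 - a) *: y].
Proof.
move=> [q Tq]; move: x; apply: conv_min => [x y t|x [->|Tx]].
- move=> [a [x' [/andP[a0 a1] Tx' ->]]] [b [y' [/andP[b0 b1] Ty' ->]]] /andP[t0 t1].
  (* The total weight of [p] and the weights of the two points of the hull of [T], which merge into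
     one point unless both weights vanish. *)
  pose s := t * a + (1 - t) * b; pose m := t * (1 - a); pose k := (1 - t) * (1 - b).
  have ms : m + k = 1 - s by rewrite /m /k /s; ring.
  have m0 : 0 <= m by rewrite mulr_ge0 //; lra.
  have k0 : 0 <= k by rewrite mulr_ge0 //; lra.
  have s0 : 0 <= s by rewrite addr_ge0 // mulr_ge0 //; lra.
  have [e|ne] := eqVneq (m + k) 0.
    exists s, x'; split=> //; first by apply/andP; split; lra.
    have m00 : m = 0 by lra.
    have k00 : k = 0 by lra.
    rewrite -ms e scale0r addr0 !scalerDr !scalerA -/m -/k m00 k00 !scale0r !addr0.
    by rewrite -scalerDl.
  exists s, ((m / (m + k)) *: x' + (1 - m / (m + k)) *: y'); split.
  + by apply/andP; split; lra.
  + apply: conv_convex_le => //; rewrite divr_ge0 //=; last by lra.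
    by rewrite ler_pdivrMr ?mul1r; lra.
  + rewrite -ms; apply/rowP => i; rewrite !mxE.
    have -> : (m + k) * (m / (m + k) * x' 0 i + (1 - m / (m + k)) * y' 0 i) =
      m * x' 0 i + k * y' 0 i by field.
    by rewrite /s /m /k; ring.
- exists 1, q; split; first by rewrite ler01 lexx.
    exact: conv_sub.
  by rewrite scale1r subrr scale0r addr0.
- exists 0, x; split; first by rewrite ler01 lexx.
    exact: conv_sub.
  by rewrite scale0r add0r subr0 scale1r.
Qed.

(** Removing an extreme point leaves the hull convex; if the point were not in [S], the smaller set
    would still contain [S]. *)
Lemma vertices_conv_sub n (S : set 'rV[R]_n) : vertices (conv_hull S) `<=` S.
Proof.
move=> x [xS ext]; apply: contrapT => nx.
suff : conv_hull S `<=` [set y | conv_hull S y /\ y <> x] by move=> /(_ x xS)[].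
apply: conv_min => [y z t /= [Sy yx] [Sz zx] t01|y Sy].
  split; first exact: conv_convex.
  by move=> /esym e; case: yx; case: (ext y z t Sy Sz t01 e).
by split; [apply: conv_sub | move=> yx; apply: nx; rewrite -yx].
Qed.

Lemma conv_set1 n (p : 'rV[R]_n) : conv_hull [set p] = [set p].
Proof.
apply/seteqP; split; last exact: conv_sub.
by apply: conv_min => // x y t -> -> _ /=; rewrite -scalerDl addrC subrK scale1r.
Qed.

(** Write [p] as a combination that shows it is not extreme and expand both ends by [conv_cons]. The
    contribution of [p] itself is less than 1, since otherwise both ends are [p]; subtracting it
    leaves [p] in the hull of [T]. *)
Lemma not_vertex_redundant n (p : 'rV[R]_n) (T : set 'rV[R]_n) :
  ~ vertices (conv_hull (p |` T)) p -> conv_hull T p.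
Proof.
move=> nv; have [T0|T0] := pselect (T !=set0); last first.
  case: nv; have -> : p |` T = [set p].
    by apply/seteqP; split=> x; [case=> // Tx; case: T0; exists x | left].
  by rewrite conv_set1; split=> // y z t -> -> _ _; split.
have Pp : conv_hull (p |` T) p by apply: conv_sub; left.
have [y [z [t [Py Pz t01 pE ne]]]] : exists y z t, [/\ conv_hull (p |` T) y,
    conv_hull (p |` T) z, 0 < t < 1, p = t *: y + (1 - t) *: z & ~ (y = p /\ z = p)].
  apply: contrapT => h; apply: nv; split=> // y z t Py Pz t01 pE.
  by apply: contrapT => ne; apply: h; exists y, z, t.
have [a [y' [/andP[a0 a1] Ty' yE]]] := conv_cons T0 Py.
have [b [z' [/andP[b0 b1] Tz' zE]]] := conv_cons T0 Pz.
move: t01 => /andP[t0 t1].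
pose m := t * (1 - a); pose k := (1 - t) * (1 - b).
have m0 : 0 <= m by rewrite mulr_ge0 //; lra.
have k0 : 0 <= k by rewrite mulr_ge0 //; lra.
have pE' : (m + k) *: p = m *: y' + k *: z'.
  have -> : (m + k) *: p = p - (t * a + (1 - t) * b) *: p.
    by apply/rowP => i; rewrite !mxE /m /k; ring.
  by rewrite {1}pE yE zE; apply/rowP => i; rewrite !mxE /m /k; ring.
have [e|mk] := eqVneq (m + k) 0.
  have t10 : 0 < 1 - t by lra.
  have a1' : 1 - a = 0.
    by apply: (mulfI (lt0r_neq0 t0)); rewrite mulr0 -/m; lra.
  have b1' : 1 - b = 0.
    by apply: (mulfI (lt0r_neq0 t10)); rewrite mulr0 -/k; lra.
  case: ne; rewrite yE zE a1' b1' !scale0r !addr0.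
  have -> : a = 1 by lra.
  have -> : b = 1 by lra.
  by rewrite !scale1r.
have -> : p = (m / (m + k)) *: y' + (1 - m / (m + k)) *: z'.
  apply: (scalerI mk); rewrite pE'; apply/rowP => i; rewrite !mxE; field.
  exact: mk.
apply: conv_convex_le => //; rewrite divr_ge0 //=; last by lra.
by rewrite ler_pdivrMr ?mul1r; lra.
Qed.

(** Minkowski's theorem for finite sets, by discarding non-extreme points one at a time. *)
Lemma conv_vertices n (s : seq 'rV[R]_n) :
  conv_hull [set` s] = conv_hull (vertices (conv_hull [set` s])).
Proof.
have [k] := ubnP (size s); elim: k s => // k IH s sk.
have [allv|] := pselect (forall p, p \in s -> vertices (conv_hull [set` s]) p).
  apply: conv_eq => x xs; last by apply: conv_sub; apply: vertices_conv_sub xs.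
  by apply: conv_sub; apply: allv.
move=> /existsNP[p /not_implyP[ps pv]].
pose t := rem p s.
have sE : [set` s] = p |` [set` t].
  apply/seteqP; split=> x /=; rewrite (perm_mem (perm_to_rem ps)) inE.
    by move=> /orP[/eqP->|]; [left | right].
  by move=> [->|xt]; rewrite ?eqxx // xt orbT.
have e : conv_hull [set` s] = conv_hull [set` t].
  apply: conv_eq => x; rewrite sE.
    case=> [->|]; last exact: conv_sub.
    by apply: not_vertex_redundant; rewrite -sE.
  by move=> xt; apply: conv_sub; right.
rewrite e; apply: IH; rewrite size_rem //; move: sk; case: (s) ps => //= ? ? _.
Qed.

Lemma polytope_vertices n (P : set 'rV[R]_n) : polytope P ->
  exists2 vs : seq 'rV[R]_n, uniq vs & vertices P = [set` vs] /\ P = conv_hull [set` vs].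
Proof.
move=> [S fS PS]; have [s sE] := (finite_seqP S).1 fS.
have vS : vertices P `<=` [set` s] by rewrite PS -sE; apply: vertices_conv_sub.
exists (undup [seq x <- s | `[< vertices P x >]]); first exact: undup_uniq.
have e : vertices P = [set` undup [seq x <- s | `[< vertices P x >]]].
  apply/seteqP; split=> x /=; rewrite mem_undup mem_filter.
    by move=> vx; apply/andP; split; [apply/asboolP | apply: vS].
  by move=> /andP[/asboolP].
by split=> //; rewrite -e {1}PS sE conv_vertices -sE -PS.
Qed.

(** The bound has to be carried along: a combination attains [b] only if both ends do. *)
Lemma face_conv n (V : set 'rV[R]_n) u b : (forall x, V x -> dot u x <= b) ->
  [set x | conv_hull V x /\ dot u x = b] = conv_hull [set x | V x /\ dot u x = b].
Proof.
move=> Vb; apply/seteqP; split=> [x [Vx ux]|x]; last first.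
  move=> h; split.
    by apply: conv_mono h => y [].
  by apply: (conv_min (hyperplane_convex (u := u) (b := b))) h => y [].
suff : conv_hull V `<=` [set x | dot u x <= b /\
    (dot u x = b -> conv_hull [set x | V x /\ dot u x = b] x)] by move=> /(_ x Vx)[_]; apply.
apply: conv_min => [{Vx ux}x y t [ux hx] [uy hy] t01|y Vy]; last first.
  by split=> [|uy]; [apply: Vb | apply: conv_sub].
split; first exact: halfspace_convex.
move: t01 => /andP[t0 t1]; rewrite dotDr !dotZr => e.
have ux' : dot u x = b.
  apply/eqP; rewrite eq_le ux /= -(ler_pM2l t0).
  have : (1 - t) * dot u y <= (1 - t) * b by rewrite ler_pM2l // subr_gt0.
  by lra.
have uy' : dot u y = b.
  have t10 : 0 < 1 - t by lra.
  apply/eqP; rewrite eq_le uy /= -(ler_pM2l t10).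
  by rewrite ux' in e; lra.
by apply: conv_convex; [apply: hx | apply: hy | rewrite t0].
Qed.

Lemma interior_not_flat n (P : set 'rV[R]_n.+1) u b : interior P !=set0 ->
  (forall x, P x -> dot u x = b) -> u = 0.
Proof.
move=> [x xi] flat; apply/eqP; apply: contrapT => /negP u0.
have /nbhs_ballP[e e0 eP] : nbhs x P by [].
have nu : 0 < `|u| by rewrite normr_gt0.
(* The ball is one of the sup norm, and so is the norm of [u] here; the step has half the radius. *)
pose d := e / (2 * `|u|).
have e0' : 0 < e := e0.
have d0 : 0 < d by rewrite divr_gt0 // mulr_gt0.
have Px : P x by apply: eP; apply: ballxx.
have Py : P (x + d *: u).
  apply: eP; rewrite -ball_normE /ball_ /= opprD addrA subrr sub0r normrN normrZ.
  rewrite gtr0_norm // (_ : d * `|u| = e / 2); first by lra.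
  by rewrite /d; field; rewrite gt_eqF.
have := flat _ Py; rewrite dotDr dotZr (flat _ Px) => h.
have /eqP : d * dot u u = 0 by lra.
by rewrite mulf_eq0 gt_eqF //= dot_eq0 (negPf u0).
Qed.

End Convexity.

(** * From isometries of the vertex set to orthogonal symmetries *)

Section Extension.
Variable R : realType.
Implicit Types (u v w x y z : 'rV[R]_3) (A : 'M[R]_3).

Lemma mul_gram (W : seq 'rV[R]_3) x (F : 'rV[R]_3 -> 'rV[R]_3) :
  x *m (\sum_(z <- W) z^T *m F z) = \sum_(z <- W) dot x z *: F z.
Proof.
rewrite mulmx_sumr; apply: eq_bigr => z _.
by rewrite mulmxA [_ *m _^T]mx11_scalar mul_scalar_mx -dotE.
Qed.

Lemma gram_unit (W : seq 'rV[R]_3) :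
  (forall u, (forall w, w \in W -> dot u w = 0) -> u = 0) ->
  \sum_(z <- W) z^T *m z \in unitmx.
Proof.
move=> sp; rewrite -row_free_unit; apply: inj_row_free => x xS.
apply: sp => w wW.
have := mul_gram W x id; rewrite xS => /(congr1 (dot x))/esym/eqP.
rewrite dot0r dot_sumr psumr_eq0 => [/allP/(_ w wW)|z _]; last first.
  by rewrite dotZr -expr2 sqr_ge0.
by rewrite dotZr mulf_eq0 orbb => /eqP.
Qed.

(** Inverting the Gram operator writes each [w] as a combination of [W], and [A] applies [g]
    termwise. Since [g] preserves inner products, [w *m A - g w] is orthogonal to all [g y], which
    exhaust [W]. *)
Lemma gram_extension (W : seq 'rV[R]_3) (g : 'rV[R]_3 -> 'rV[R]_3) :
  (forall u, (forall w, w \in W -> dot u w = 0) -> u = 0) ->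
  (forall w, w \in W -> g w \in W) ->
  (forall w, w \in W -> exists2 z, z \in W & g z = w) ->
  (forall x y, x \in W -> y \in W -> dot (g x) (g y) = dot x y) ->
  exists2 A, symmetry_of W A & forall w, w \in W -> w *m A = g w.
Proof.
move=> sp gW gS gd; set S := \sum_(z <- W) z^T *m z.
have uS : S \in unitmx := gram_unit sp.
pose A := invmx S *m \sum_(z <- W) z^T *m g z.
have Ag w : w \in W -> w *m A = g w.
  move=> wW; rewrite /A mulmxA mul_gram; set c := w *m invmx S.
  have cw : \sum_(z <- W) dot c z *: z = w.
    by rewrite -(mul_gram W c id) -/S mulmxKV.
  apply/eqP; rewrite -subr_eq0; apply/eqP/sp => _ /gS[y yW <-].
  rewrite dotDl dotNl dot_suml.
  have -> : \sum_(i <- W) dot (dot c i *: g i) (g y) = dot w y.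
    rewrite -[in RHS]cw dot_suml big_seq [RHS]big_seq; apply: eq_bigr => i iW.
    by rewrite !dotZl gd.
  by rewrite gd // subrr.
exists A => //; split; last by move=> w wW; rewrite Ag //; apply: gW.
have ext (B C : 'M[R]_3) : (forall z, z \in W -> z *m B = z *m C) -> B = C.
  move=> BC; apply/row_matrixP => i; rewrite !rowE.
  have {2}-> : delta_mx 0 i = \sum_(z <- W) dot (delta_mx 0 i *m invmx S) z *: z.
    by rewrite -(mul_gram W _ id) -/S mulmxKV.
  have {1}-> : delta_mx 0 i = \sum_(z <- W) dot (delta_mx 0 i *m invmx S) z *: z.
    by rewrite -(mul_gram W _ id) -/S mulmxKV.
  rewrite !mulmx_suml big_seq [RHS]big_seq; apply: eq_bigr => z zW.
  by rewrite -!scalemxAl BC.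
apply: ext => z zW; apply/eqP; rewrite -subr_eq0; apply/eqP/sp => y yW.
by rewrite dotDl dotNl mulmx1 mulmxA dot_mxl trmxK !Ag // gd // subrr.
Qed.

End Extension.

Section Configuration.
Variable R : realType.
Implicit Types (u v w x y z : 'rV[R]_3) (A : 'M[R]_3).

Definition sqdist x y : R := dot (x - y) (x - y).

Lemma sqdistC x y : sqdist x y = sqdist y x.
Proof. by rewrite /sqdist -opprB dotNl dotNr opprK. Qed.

Definition centroid (s : seq 'rV[R]_3) := (size s)%:R^-1 *: \sum_(x <- s) x.

Lemma sum_centered s : s != [::] -> \sum_(x <- s) (x - centroid s) = 0.
Proof.
move=> s0; rewrite sumrB big_const_seq count_predT iter_addr_0.
rewrite -scaler_nat /centroid scalerA mulfV ?scale1r ?subrr //.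
by rewrite pnatr_eq0 size_eq0.
Qed.

(** The parallel axis identity. *)
Lemma centroid_dist s x : s != [::] ->
  \sum_(z <- s) sqdist x z =
  (size s)%:R * dot (x - centroid s) (x - centroid s) +
  \sum_(z <- s) dot (z - centroid s) (z - centroid s).
Proof.
move=> s0; set o := centroid s.
have e z : sqdist x z = dot (x - o) (x - o) + dot (z - o) (z - o) - 2 * dot (x - o) (z - o).
  by rewrite -dotB /sqdist; congr dot; rewrite opprB addrA subrK.
under eq_bigr do rewrite e.
have sc := sum_centered s0; rewrite -/o in sc.
rewrite sumrB big_split /= -mulr_sumr -(dot_sumr s (fun z => z - o) (x - o)) sc dot0r mulr0 subr0.
by rewrite big_const_seq count_predT iter_addr_0 -[RHS]addr0 mulr_natl addr0.
Qed.

(** An isometry preserves the sum of squared distances to all points, hence by [centroid_dist] the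
    distance to the centroid; inner products follow by polarization. *)
Lemma isometry_centroid (s : seq 'rV[R]_3) f : uniq s -> isometry [set` s] [set` s] f ->
  [/\ forall x, x \in s -> f x \in s,
      forall y, y \in s -> exists2 x, x \in s & f x = y &
      forall x y, x \in s -> y \in s ->
        dot (f x - centroid s) (f y - centroid s) = dot (x - centroid s) (y - centroid s)].
Proof.
move=> us [[fs fi fsur] fd].
have f1 x : x \in s -> f x \in s by move=> xs; apply: fs.
have f2 y : y \in s -> exists2 x, x \in s & f x = y by move=> ys; apply: fsur.
split=> //.
have d x y : x \in s -> y \in s -> sqdist (f x) (f y) = sqdist x y.
  by move=> xs ys; apply/edist_eq/fd.
have pf : perm_eq (map f s) s.
  apply: uniq_perm => //.
    by rewrite map_inj_in_uniq // => x y xs ys; apply: fi; rewrite inE.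
  move=> y; apply/mapP/idP => [[x xs ->]|/f2[x xs <-]]; first exact: f1.
  by exists x.
have nrm x : x \in s -> dot (f x - centroid s) (f x - centroid s) =
    dot (x - centroid s) (x - centroid s).
  move=> xs; have s0 : s != [::] by apply: contraTneq xs => ->.
  have n0 : (size s)%:R != 0 :> R by rewrite pnatr_eq0 size_eq0.
  apply: (mulfI n0); apply: (addIr (\sum_(z <- s) dot (z - centroid s) (z - centroid s))).
  rewrite -!centroid_dist // -(perm_big _ pf) big_map big_seq [RHS]big_seq.
  by apply: eq_bigr => z zs; apply: d.
move=> x y xs ys; have := d x y xs ys.
have e a b : sqdist a b = dot (a - centroid s) (a - centroid s) +
    dot (b - centroid s) (b - centroid s) - 2 * dot (a - centroid s) (b - centroid s).
  by rewrite -dotB /sqdist; congr dot; rewrite opprB addrA subrK.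
rewrite !e nrm // nrm //; lra.
Qed.

Lemma polyhedron_config (P : set 'rV[R]_3) : nondegenerate_polyhedron P ->
  point_homogeneous 2 P -> exists W o (k : R), [/\ two_homogeneous W, 0 < k &
    P = conv_hull (vertices P) /\ vertices P = [set o + k *: w | w in [set` W]]].
Proof.
move=> [pP iP] h2; have [vs us [vE PE]] := polytope_vertices pP.
have flat u b : (forall v, v \in vs -> dot u v = b) -> u = 0.
  move=> ub; apply: (interior_not_flat iP (b := b)) => x; rewrite PE.
  by apply: (conv_min (hyperplane_convex (u := u) (b := b))) => y /= /ub.
have v0 : vs != [::].
  apply/eqP => e; have : vec 1 0 0 = 0 :> 'rV[R]_3.
    by apply: (flat _ 0) => v; rewrite e.
  by rewrite -vec0 => /vec_inj[/eqP]; rewrite oner_eq0.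
set o := centroid vs.
have hom a b a' b' : a \in vs -> b \in vs -> a' \in vs -> b' \in vs ->
    edist a b = edist a' b' -> exists f, [/\ f a = a', f b = b' & isometry [set` vs] [set` vs] f].
  move=> av bv av' bv' e.
  have [|||f fi fe] := h2 (fun i : 'I_2 => if i == ord0 then a else b)
      (fun i : 'I_2 => if i == ord0 then a' else b').
  - by move=> i; rewrite vE; case: ifP.
  - by move=> i; rewrite vE; case: ifP.
  - move=> i j; case: ifP => _; case: ifP => _ //.
    + by rewrite !edistE !subrr !dot0l.
    + by rewrite !edistE -/(sqdist b a) -/(sqdist b' a') sqdistC -(sqdistC a') //; apply: e.
    + by rewrite !edistE !subrr !dot0l.
  exists f; split; [exact: (fe ord0) | exact: (fe (lift ord0 ord0)) |].
  by rewrite -vE.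
have [p pv] : exists p, p \in vs.
  by case: (vs) v0 => // x s _; exists x; rewrite mem_head.
(* The common squared distance of the vertices from their centroid; [k] below is its square root. *)
pose rho := dot (p - o) (p - o).
have nrm v : v \in vs -> dot (v - o) (v - o) = rho.
  move=> vv; have [|f [fp _ fi]] := hom p p v v pv pv vv vv.
    by rewrite !edistE !subrr.
  by have [_ _ fd] := isometry_centroid us fi; rewrite /rho -(fd p p) // fp.
have dotoo v w : v \in vs -> w \in vs ->
    sqdist v w = 2 * rho - 2 * dot (v - o) (w - o).
  move=> vv wv; rewrite (_ : sqdist v w = dot ((v - o) - (w - o)) ((v - o) - (w - o))).
    by rewrite dotB !nrm //; ring.
  by rewrite opprB addrA subrK.
have r0 : 0 < rho.
  rewrite lt_neqAle dot_ge0 andbT; apply/eqP => r0.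
  have e v : v \in vs -> v = o by move=> /nrm; rewrite -r0; apply: eq_dotB.
  have : vec 1 0 0 = 0 :> 'rV[R]_3.
    by apply: (flat _ (dot (vec 1 0 0) o)) => v /e ->.
  by rewrite -vec0 => /vec_inj[/eqP]; rewrite oner_eq0.
pose k := Num.sqrt rho.
have k0 : 0 < k by rewrite sqrtr_gt0.
have k2 : k * k = rho by rewrite -expr2 sqr_sqrtr // ltW.
have kn : k != 0 by rewrite lt0r_neq0.
pose nz v := k^-1 *: (v - o); pose un w := o + k *: w.
have nzK : cancel nz un.
  by move=> v; rewrite /un /nz scalerA mulfV // scale1r addrC subrK.
have unK : cancel un nz.
  by move=> w; rewrite /un /nz addrC addKr scalerA mulVf // scale1r.
pose W := map nz vs.
have WE w : (w \in W) = (un w \in vs).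
  by rewrite -{1}(unK w) mem_map //; apply: can_inj nzK.
have dotnz v w : dot (nz v) (nz w) = rho^-1 * dot (v - o) (w - o).
  by rewrite dotZl dotZr mulrA -invfM k2.
have spW u : (forall w, w \in W -> dot u w = 0) -> u = 0.
  move=> uw; apply: (flat u (dot u o)) => v vv.
  have := uw (nz v); rewrite WE nzK => /(_ vv).
  rewrite dotZr dotDr dotNr => /eqP; rewrite mulf_eq0 invr_eq0 (negPf kn) /=.
  by rewrite subr_eq0 => /eqP.
exists W, o, k; split=> //; last first.
  split; first by rewrite vE.
  rewrite vE; apply/seteqP; split=> [v vv|_ [w wW <-]] /=.
    by exists (nz v); [rewrite /= WE nzK | exact: nzK].
  by move: wW; rewrite /= WE.
split=> //.
- by rewrite map_inj_uniq //; apply: can_inj nzK.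
- move=> w; rewrite WE => wv; rewrite -(unK w) dotnz nrm // mulVf //.
  exact: lt0r_neq0.
- by rewrite big_map -scaler_sumr sum_centered // scaler0.
- move=> a b a' b'; rewrite !WE => av bv av' bv' e.
  have [|f [fa fb fi]] := hom (un a) (un b) (un a') (un b') av bv av' bv'.
    apply/edist_eq; rewrite -!/(sqdist _ _) !dotoo //.
    move: e; rewrite -{1}(unK a) -{1}(unK b) -{1}(unK a') -{1}(unK b') !dotnz.
    by move=> /(mulfI (invr_neq0 (lt0r_neq0 r0))) ->.
  have [f1 f2 fd] := isometry_centroid us fi.
  pose g w := nz (f (un w)).
  have gW w : w \in W -> g w \in W by rewrite !WE nzK => /f1.
  have [||A sA Ag] := gram_extension spW gW.
  + move=> w; rewrite WE => /f2[z zv fz]; exists (nz z); first by rewrite WE nzK.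
    by rewrite /g nzK fz unK.
  + move=> x y; rewrite !WE => xv yv; rewrite /g dotnz fd //.
    by rewrite -[in RHS](unK x) -[in RHS](unK y) dotnz.
  + exists A; split=> //.
    * by rewrite Ag ?WE // /g fa unK.
    * by rewrite Ag ?WE // /g fb unK.
Qed.

End Configuration.

(** * Boxes and cuboctahedra *)

Section Similarity.
Variable R : realType.
Implicit Types (o u v w x y z : 'rV[R]_3) (F : 'M[R]_3) (S P : set 'rV[R]_3).

Definition simil o (k : R) F x : 'rV[R]_3 := o + k *: (x *m F).

Lemma simil_affine o k F x y t :
  simil o k F (t *: x + (1 - t) *: y) = t *: simil o k F x + (1 - t) *: simil o k F y.
Proof.
rewrite /simil mulmxDl -!scalemxAl; apply/rowP => i; rewrite !mxE; ring.
Qed.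

Lemma simil_conv o k F S : simil o k F @` conv_hull S = conv_hull (simil o k F @` S).
Proof. exact/conv_affine/simil_affine. Qed.

Lemma simil_sub o k F x y : simil o k F x - simil o k F y = k *: ((x - y) *m F).
Proof. by rewrite /simil opprD addrACA subrr add0r -scalerBr -mulmxBl. Qed.

Lemma simil_edist o k F x y : orthogonal F -> 0 < k ->
  edist (simil o k F x) (simil o k F y) = k * edist x y.
Proof.
move=> oF k0; rewrite !edistE simil_sub dotZl dotZr dot_orth // mulrA -expr2.
by rewrite sqrtrM ?sqr_ge0 // sqrtr_sqr gtr0_norm.
Qed.

Definition simil_inv o (k : R) F x : 'rV[R]_3 := k^-1 *: ((x - o) *m F^T).

Lemma similK o k F : orthogonal F -> k != 0 -> cancel (simil o k F) (simil_inv o k F).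
Proof.
move=> oF k0 x; rewrite /simil /simil_inv addrC addKr -scalemxAl scalerA mulVf //.
by rewrite scale1r orthK.
Qed.

Lemma simil_invK o k F : orthogonal F -> k != 0 -> cancel (simil_inv o k F) (simil o k F).
Proof.
move=> oF k0 x; rewrite /simil /simil_inv -scalemxAl scalerA mulfV //.
by rewrite scale1r orthVK // addrC subrK.
Qed.

Lemma simil_invE o k F : k != 0 -> orthogonal F ->
  simil_inv o k F = simil (- (k^-1 *: (o *m F^T))) k^-1 F^T.
Proof.
move=> k0 oF; apply/funext => x; rewrite /simil /simil_inv mulmxBl scalerBr addrC.
by [].
Qed.

Lemma modelled_polytope P W std o k : 0 < k -> modelled W std ->
  P = conv_hull (vertices P) -> vertices P = [set o + k *: w | w in [set` W]] ->
  exists F l, [/\ orthogonal F, 0 < l,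
    vertices P = simil o l F @` [set` std] & P = simil o l F @` conv_hull [set` std]].
Proof.
move=> k0 [F [l [oF l0 WE]]] PE VE; exists F, (k * l).
have e : vertices P = simil o (k * l) F @` [set` std].
  rewrite VE; apply/seteqP; split=> [_ [w /= wW <-]|_ [p ps <-]].
    move: wW; rewrite WE => /mapP[p ps ->]; exists p => //.
    by rewrite /simil scalerA.
  exists (l *: (p *m F)); last by rewrite /simil scalerA.
  by rewrite /= WE; apply/mapP; exists p.
by split=> //; rewrite ?mulr_gt0 // {1}PE e simil_conv.
Qed.

End Similarity.

Section Boxes.
Variable R : realType.

Lemma itv_convex (a b x y t : R) : a <= x <= b -> a <= y <= b -> 0 < t < 1 ->
  a <= t * x + (1 - t) * y <= b.
Proof.
move=> /andP[x1 x2] /andP[y1 y2] /andP[t0 t1].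
have t10 : 0 < 1 - t by lra.
have : t * a <= t * x by rewrite ler_pM2l.
have : t * x <= t * b by rewrite ler_pM2l.
have : (1 - t) * a <= (1 - t) * y by rewrite ler_pM2l.
have : (1 - t) * y <= (1 - t) * b by rewrite ler_pM2l.
by move=> *; apply/andP; split; lra.
Qed.

Lemma vec_coord0 (i j l : R) : vec i j l 0 0 = i. Proof. by rewrite mxE. Qed.
Lemma vec_coord1 (i j l : R) : vec i j l 0 1 = j. Proof. by rewrite mxE. Qed.
Lemma vec_coord2 (i j l : R) : vec i j l 0 2 = l. Proof. by rewrite mxE. Qed.

Lemma conv_box (X Y Z : R) : 0 < X -> 0 < Y -> 0 < Z ->
  conv_hull [set` box_pts X Y Z] =
  [set p | [/\ - X <= p 0 0 <= X, - Y <= p 0 1 <= Y & - Z <= p 0 2 <= Z]].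
Proof.
move=> X0 Y0 Z0; apply/seteqP; split.
{ apply: conv_min => [x y t [x1 x2 x3] [y1 y2 y3] t01|p].
    by rewrite /= !mxE; split; apply: itv_convex.
  rewrite /= !inE; do ?[case/orP => [/eqP->|]]; last move/eqP->.
  all: by rewrite !vec_coord0 !vec_coord1 !vec_coord2; split; apply/andP; split; lra. }
move=> p; rewrite (vecE p); move: (p 0 0) (p 0 1) (p 0 2) => {p} i j l.
rewrite /= !vec_coord0 !vec_coord1 !vec_coord2 => -[i1 j1 l1].
have seg (C : R -> Prop) (a s : R) : 0 < a -> - a <= s <= a ->
    (forall x y t, C x -> C y -> 0 <= t <= 1 -> C (t * x + (1 - t) * y)) ->
    C a -> C (- a) -> C s.
  move=> a0 /andP[s1 s2] Cc Ca Ca'.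
  have -> : s = (s + a) / (2 * a) * a + (1 - (s + a) / (2 * a)) * (- a).
    by field; rewrite gt_eqF.
  apply: Cc => //; have a20 : 0 < 2 * a by lra.
  apply/andP; split; first by apply: divr_ge0; lra.
  by rewrite ler_pdivrMr // mul1r; lra.
pose C := conv_hull [set` box_pts X Y Z].
have vecc (a b d a' b' d' t : R) : C (vec a b d) -> C (vec a' b' d') -> 0 <= t <= 1 ->
    C (vec (t * a + (1 - t) * a') (t * b + (1 - t) * b') (t * d + (1 - t) * d')).
  by move=> h1 h2 t01; have := conv_convex_le h1 h2 t01; rewrite !vecL.
have same (t a : R) : t * a + (1 - t) * a = a by ring.
have corner (p : 'rV[R]_3) : p \in box_pts X Y Z -> C p by move=> ps; apply: conv_sub.
have h1 (b d : R) : C (vec X b d) -> C (vec (- X) b d) -> C (vec i b d).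
  apply: (seg (fun a => C (vec a b d)) X i X0 i1) => x y t hx hy t01.
  by have := vecc _ _ _ _ _ _ _ hx hy t01; rewrite !same.
have h2 (a d : R) : C (vec a Y d) -> C (vec a (- Y) d) -> C (vec a j d).
  apply: (seg (fun b => C (vec a b d)) Y j Y0 j1) => x y t hx hy t01.
  by have := vecc _ _ _ _ _ _ _ hx hy t01; rewrite !same.
have h3 (a b : R) : C (vec a b Z) -> C (vec a b (- Z)) -> C (vec a b l).
  apply: (seg (fun d => C (vec a b d)) Z l Z0 l1) => x y t hx hy t01.
  by have := vecc _ _ _ _ _ _ _ hx hy t01; rewrite !same.
by apply: h1; apply: h2; apply: h3; apply: corner; rewrite !inE eqxx ?orbT.
Qed.

Lemma box_parallelepiped (P : set 'rV[R]_3) o F (k X Y Z : R) : orthogonal F ->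
  0 < k -> 0 < X -> 0 < Y -> 0 < Z ->
  P = simil o k F @` conv_hull [set` box_pts X Y Z] ->
  rectangular_parallelepiped (2 * k * X) (2 * k * Y) (2 * k * Z) P.
Proof.
move=> oF k0 X0 Y0 Z0 PE; have kn := lt0r_neq0 k0.
split; rewrite ?mulr_gt0 //.
(* Undoes the rotation but keeps the scale, and moves a corner of the centred box to the origin. *)
pose f x := k *: (vec X Y Z + simil_inv o k F x).
have fs p : f (simil o k F p) = k *: (vec X Y Z + p) by rewrite /f similK.
have boxE p : box (2 * k * X) (2 * k * Y) (2 * k * Z) (k *: (vec X Y Z + p)) <->
    [/\ - X <= p 0 0 <= X, - Y <= p 0 1 <= Y & - Z <= p 0 2 <= Z].
  have e (a s : R) : (0 <= k * (a + s) <= 2 * k * a) = (- a <= s <= a).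
    rewrite (_ : 2 * k * a = k * (2 * a)); last by ring.
    rewrite pmulr_rge0 // ler_pM2l //.
    by congr (_ && _); apply/idP/idP; lra.
  split=> [h|[h0 h1 h2] i].
    have := h 0; have := h 1; have := h 2; rewrite !mxE /= !e.
    by split.
  rewrite !mxE; case: i => -[|[|[|//]]] lt /=; rewrite e.
  - by rewrite (_ : Ordinal lt = 0) //; apply: val_inj.
  - by rewrite (_ : Ordinal lt = 1) //; apply: val_inj.
  - by rewrite (_ : Ordinal lt = 2) //; apply: val_inj.
rewrite conv_box // in PE.
exists f; split; last first.
  move=> x y _ _; rewrite !edistE /f -scalerBr opprD addrACA subrr add0r.
  rewrite /simil_inv -scalerBr -mulmxBl scalerA mulfV // scale1r.
  rewrite dot_orth; last exact: orth_tr.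
  by rewrite opprB addrA subrK.
split.
- by move=> x; rewrite PE => -[p ps <-]; rewrite fs; apply/boxE.
- move=> x y; rewrite PE !inE => -[p _ <-] [q _ <-]; rewrite !fs.
  by move=> /(scalerI kn)/addrI ->.
- move=> y yb; have yE : y = k *: (vec X Y Z + (k^-1 *: y - vec X Y Z)).
    by rewrite addrC subrK scalerA mulfV // scale1r.
  exists (simil o k F (k^-1 *: y - vec X Y Z)); last by rewrite fs -yE.
  rewrite PE; exists (k^-1 *: y - vec X Y Z) => //.
  by apply/boxE; rewrite -yE.
Qed.

(** These two transpositions generate all orders of the half-sides, so that [box_case] can sort
    them. *)
Lemma box_permute (W : seq 'rV[R]_3) (X Y Z : R) : modelled W (box_pts X Y Z) ->
  modelled W (box_pts Y X Z) /\ modelled W (box_pts X Z Y).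
Proof.
move=> [F [l [oF l0 WE]]].
have std (i j k : R) : vec i j k = i *: vec 1 0 0 + j *: vec 0 1 0 + k *: vec 0 0 1.
  by rewrite !vecL; apply: vec_eq; ring.
have oS (u v w : 'rV[R]_3) : orthonormal2 u v -> dot w w = 1 -> dot u w = 0 ->
    dot v w = 0 -> orthogonal (rows3 u v w *m F).
  by move=> *; apply: orth_mul => //; apply: orth_rows3.
split.
- exists (rows3 (vec 0 1 0) (vec 1 0 0) (vec 0 0 1) *m F), l; split=> //.
    by apply: oS; rewrite /orthonormal2 ?dot_vec; try split; rewrite ?dot_vec; ring.
  move=> y; rewrite WE; rewrite /= !mulmxA !vec_rows3 !vecL !inE.
  rewrite !(mulr0, mulr1, addr0, add0r).
  by do 8 (case: (y == _) => //=).
- exists (rows3 (vec 1 0 0) (vec 0 0 1) (vec 0 1 0) *m F), l; split=> //.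
    by apply: oS; rewrite /orthonormal2 ?dot_vec; try split; rewrite ?dot_vec; ring.
  move=> y; rewrite WE; rewrite /= !mulmxA !vec_rows3 !vecL !inE.
  rewrite !(mulr0, mulr1, addr0, add0r).
  by do 8 (case: (y == _) => //=).
Qed.

Lemma box_case (P : set 'rV[R]_3) W o k (X Y Z : R) : 0 < k ->
  P = conv_hull (vertices P) -> vertices P = [set o + k *: w | w in [set` W]] ->
  0 < X -> 0 < Y -> 0 < Z ->
  [/\ X ^+ 2 + Y ^+ 2 != Z ^+ 2, Y ^+ 2 + Z ^+ 2 != X ^+ 2 & X ^+ 2 + Z ^+ 2 != Y ^+ 2] ->
  modelled W (box_pts X Y Z) ->
  exists a b c : R, a <= b /\ b <= c /\ a ^+ 2 + b ^+ 2 != c ^+ 2 /\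
     rectangular_parallelepiped a b c P.
Proof.
move=> k0 PE VE X0 Y0 Z0 [n1 n2 n3] m.
have sorted (a b c : R) : 0 < a -> 0 < b -> 0 < c -> a <= b -> b <= c ->
    a ^+ 2 + b ^+ 2 != c ^+ 2 -> modelled W (box_pts a b c) ->
    exists a b c : R, a <= b /\ b <= c /\ a ^+ 2 + b ^+ 2 != c ^+ 2 /\
     rectangular_parallelepiped a b c P.
  move=> a0 b0 c0 ab bc ne ma; have [F [l [oF l0 _ PF]]] := modelled_polytope k0 ma PE VE.
  exists (2 * l * a), (2 * l * b), (2 * l * c).
  have l20 : 0 < 2 * l by rewrite mulr_gt0.
  rewrite !ler_pM2l //; do 3 split=> //; last exact: box_parallelepiped PF.
  rewrite !exprMn -mulrDr; apply: contra_neq ne; apply: mulfI.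
  by rewrite mulf_neq0 // expf_neq0 // lt0r_neq0.
have [m1 m2] := box_permute m; have [m3 m4] := box_permute m1.
have [m5 m6] := box_permute m2; have [m7 _] := box_permute m4.
have [XY|YX] := leP X Y; have [YZ|ZY] := leP Y Z; have [XZ|ZX] := leP X Z; try lra.
- exact: (sorted X Y Z).
- by apply: (sorted X Z Y) => //; apply: ltW.
- by apply: (sorted Z X Y) => //; rewrite 1?ltW // addrC.
- by apply: (sorted Y X Z) => //; rewrite 1?ltW // addrC.
- by apply: (sorted Y Z X) => //; rewrite ltW.
- by apply: (sorted Z Y X) => //; rewrite 1?ltW // addrC.
Qed.

End Boxes.

Section Cuboctahedra.
Variable R : realType.

Lemma cuboctahedron_ptsE : [set` cuboctahedron_pts R] =
  [set x : 'rV[R]_3 | exists i, x 0 i = 0 /\ forall j, j != i -> x 0 j = 1 \/ x 0 j = - 1].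
Proof.
apply/seteqP; split=> x.
{ rewrite /= !inE.
  do ?[case/orP => [/eqP->|]]; last move/eqP->.
  all: match goal with
    | |- context [vec 0 _ _] => exists 0
    | |- context [vec _ 0 _] => exists 1
    | |- context [vec _ _ 0] => exists 2 end.
  all: split; [by rewrite mxE | move=> -[[|[|[|//]]] lt] //= ne; rewrite mxE /=; auto]. }
move=> [i [xi h]]; rewrite (vecE x) /= .
case: i xi h => -[|[|[|//]]] lt xi h.
- have e : x 0 0 = 0 by rewrite -xi; congr (x _ _); apply: val_inj.
  rewrite e; have [] := h 1 isT; have [] := h 2 isT => -> ->; rewrite !inE eqxx ?orbT //.
- have e : x 0 1 = 0 by rewrite -xi; congr (x _ _); apply: val_inj.
  rewrite e; have [] := h 0 isT; have [] := h 2 isT => -> ->; rewrite !inE eqxx ?orbT //.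
- have e : x 0 2 = 0 by rewrite -xi; congr (x _ _); apply: val_inj.
  rewrite e; have [] := h 0 isT; have [] := h 1 isT => -> ->; rewrite !inE eqxx ?orbT //.
Qed.

Lemma cuboctahedron_case (P : set 'rV[R]_3) o F k : orthogonal F -> 0 < k ->
  P = simil o k F @` conv_hull [set` cuboctahedron_pts R] -> cuboctahedron P.
Proof.
move=> oF k0 PE; rewrite /cuboctahedron -cuboctahedron_ptsE.
have kn := lt0r_neq0 k0.
exists k^-1, (simil_inv o k F); split; first by rewrite invr_gt0.
- rewrite PE; split.
  + by move=> _ [p ps <-]; rewrite similK.
  + by move=> x y _ _; exact: (can_inj (@simil_invK _ o k F oF kn)).
  + by move=> p ps; exists (simil o k F p); [exists p | rewrite similK].
- move=> x y _ _; rewrite -[in RHS](@simil_invK _ o k F oF kn x) -[in RHS](@simil_invK _ o k F oF kn y).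
  by rewrite simil_edist // mulKf.
Qed.

End Cuboctahedra.

(** * Prisms and antiprisms *)

Section TwoNgons.
Variable R : realType.
Implicit Types (o u v w x y z : 'rV[R]_3) (F : 'M[R]_3) (S P : set 'rV[R]_3).

Lemma rows_mul F i : row i F = vec (i == 0)%:R (i == 1)%:R (i == 2)%:R *m F.
Proof.
rewrite rowE; congr (_ *m _); apply/rowP => j; rewrite !mxE eqxx /=.
by case: i => -[|[|[|//]]] li; case: j => -[|[|[|//]]] lj.
Qed.

Lemma vec_mul (i j l : R) F : vec i j l *m F = i *: row 0 F + j *: row 1 F + l *: row 2 F.
Proof.
rewrite !rows_mul !scalemxAl -!mulmxDl !vecL; congr (_ *m _).
by apply: vec_eq; rewrite /=; ring.
Qed.

Lemma dot_row2 (i j l : R) F : orthogonal F -> dot (vec i j l *m F) (row 2 F) = l.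
Proof. by move=> oF; rewrite rows_mul dot_orth // dot_vec /=; ring. Qed.

Variables (P : set 'rV[R]_3) (W : seq 'rV[R]_3) (o : 'rV[R]_3) (k : R).
Hypotheses (hW : two_homogeneous W) (k0 : 0 < k) (PE : P = conv_hull (vertices P))
  (VE : vertices P = [set o + k *: w | w in [set` W]]).

(** A distance occurring both within a base and between the bases would give equal inner products in
    [W], and [separate_levels] would make the height zero. *)
Lemma disjoint_base_distances (a : 'rV[R]_3) (B0 B1 : set 'rV[R]_3) (l : R) : l != 0 ->
  (forall A, symmetry_of W A -> a *m A = a \/ a *m A = - a) ->
  (forall x, B0 x -> dot (x - o) a = l) -> (forall x, B1 x -> dot (x - o) a = - l) ->
  base_distances_disjoint P B0 B1.
Proof.
move=> l0 ha h0 h1; rewrite /base_distances_disjoint; apply/seteqP; split=> // d [].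
have kn := lt0r_neq0 k0.
have rep x : vertices P x -> exists2 w, w \in W & [/\ x = o + k *: w & dot (x - o) a = k * dot w a].
  rewrite VE => -[w wW <-]; exists w => //; split=> //.
  by rewrite addrC addKr dotZl.
have key x y z w : vertices P x -> vertices P y -> vertices P z -> vertices P w ->
    dot (x - o) a = dot (y - o) a -> dot (z - o) a = l -> dot (w - o) a = - l ->
    edist x y = edist z w -> False.
  move=> /rep[x' xW [-> xa]] /rep[y' yW [-> ya]] /rep[z' zW [-> za]] /rep[w' wW [-> wa]].
  rewrite xa ya za wa => /(mulfI kn) e1 e2 e3 /edist_eq.
  have s p q : o + k *: p - (o + k *: q) = k *: (p - q).
    by rewrite opprD addrACA subrr add0r -scalerBr.
  rewrite !s !dotZl !dotZr => /(mulfI kn)/(mulfI kn).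
  rewrite !dotB !(th_unit hW) // => e4.
  have zw : dot z' a = - dot w' a by apply: (mulfI kn); rewrite mulrN e2 e3 opprK.
  have e5 : dot x' y' = dot z' w' by lra.
  have := separate_levels hW ha xW yW zW wW e1 zw e5.
  by move: e2 => /[swap] ->; rewrite mulr0 => /esym/eqP; rewrite (negPf l0).
case=> -[x [Vx Bx] [y [Vy By] xy]] [z [Vz Bz] [w [Vw Bw] zw]].
  by apply: (key x y z w); rewrite ?xy ?zw ?(h0 x) ?(h0 y) ?(h0 z) ?(h1 w).
by apply: (key x y z w); rewrite ?xy ?zw ?(h1 x) ?(h1 y) ?(h0 z) ?(h1 w).
Qed.

Variables (F : 'M[R]_3) (n : nat) (r h phi : R).
Hypotheses (oF : orthogonal F) (n3 : (3 <= n)%N) (r0 : 0 < r) (h0 : 0 < h)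
  (tn : two_ngons W F n r h phi)
  (ha : forall A, symmetry_of W A -> row 2 F *m A = row 2 F \/ row 2 F *m A = - row 2 F).

Let ang (p : R) (j : nat) : R := p + 2 * pi * j%:R / n%:R.

Let pt (p l : R) (j : nat) : 'rV[R]_3 := vec (k * r * cos (ang p j)) (k * r * sin (ang p j)) (k * l).

Let verticesE : vertices P = [set o + x *m F | x in
  range (fun j : 'I_n => pt phi (- h) j) `|` range (fun j : 'I_n => pt 0 h j)].
Proof.
have e p l j : k *: (vec (r * cos (ang p j)) (r * sin (ang p j)) l *m F) = pt p l j *m F.
  by rewrite scalemxAl vecZ !mulrA.
have e0 j : ang 0 j = 2 * pi * j%:R / n%:R by rewrite /ang add0r.
rewrite VE; apply/seteqP; split=> [_ [w /tn[j jn [->|->]] <-]|_ [x [] [j _ <-] <-]].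
- exists (pt 0 h (Ordinal jn)); first by right; exists (Ordinal jn).
  by rewrite -e e0.
- exists (pt phi (- h) (Ordinal jn)); first by left; exists (Ordinal jn).
  by rewrite -e.
- exists (vec (r * cos (ang phi j)) (r * sin (ang phi j)) (- h) *m F); last by rewrite e.
  by apply/tn; exists j => //; right.
- exists (vec (r * cos (ang 0 j)) (r * sin (ang 0 j)) h *m F); last by rewrite e.
  by apply/tn; exists j => //; left; rewrite e0.
Qed.

Lemma antiprism_case : phi = pi / n%:R -> exists (n : nat) (B0 B1 : set 'rV[R]_3),
  (2 <= n)%N /\ right_antiprism n P B0 B1 /\ base_distances_disjoint P B0 B1.
Proof.
move=> phiE; have kr0 : 0 < k * r by rewrite mulr_gt0.
have kh0 : 0 < k * h by rewrite mulr_gt0.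
pose a := row 2 F; pose o1 := o + (k * h) *: a.
have rr i j : dot (row i F) (row j F) = (i == j)%:R.
  rewrite !rows_mul dot_orth // dot_vec.
  by case: i => -[|[|[|//]]] li; case: j => -[|[|[|//]]] lj; rewrite /=; ring.
have aa : dot a a = 1 by rewrite rr.
pose B0 := ngon n o1 (row 0 F) (row 1 F) (k * r) 0.
pose B1 := ngon n (o1 + (2 * (k * h)) *: - a) (row 0 F) (row 1 F) (k * r) (pi / n%:R).
have S0 : B0 = conv_hull [set o + x *m F | x in range (fun j : 'I_n => pt 0 h j)].
  rewrite /B0 /ngon; congr conv_hull; apply/seteqP; split=> [_ [j _ <-]|_ [_ [j _ <-] <-]].
    exists (pt 0 h j); first by exists j.
    by rewrite /pt vec_mul /o1 /ang; apply/rowP => i; rewrite !mxE; ring.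
  exists j => //.
  by rewrite /pt vec_mul /o1 /ang; apply/rowP => i; rewrite !mxE; ring.
have S1 : B1 = conv_hull [set o + x *m F | x in range (fun j : 'I_n => pt phi (- h) j)].
  rewrite /B1 /ngon -phiE; congr conv_hull; apply/seteqP; split=> [_ [j _ <-]|_ [_ [j _ <-] <-]].
    exists (pt phi (- h) j); first by exists j.
    by rewrite /pt vec_mul /o1 /ang; apply/rowP => i; rewrite !mxE; ring.
  exists j => //.
  by rewrite /pt vec_mul /o1 /ang; apply/rowP => i; rewrite !mxE; ring.
exists n, B0, B1; split; first exact: ltnW.
split.
(* The polygon of angle 0 is the upper one and serves as first base, so the second base is reached
   in the direction [- a]. *)
- exists o1, (row 0 F), (row 1 F), (- a), (k * r), (2 * (k * h)); split=> //.
  + by rewrite /orthonormal2 !rr dotNl !dotNr aa opprK !rr /= oppr0; split.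
  + by split=> //; rewrite mulr_gt0.
  + rewrite PE verticesE image_setU; apply: conv_eq => x.
      by case=> hx; apply: conv_sub; [right; rewrite S1 | left; rewrite S0]; apply: conv_sub.
    case; rewrite ?S0 ?S1; apply: conv_mono => y; [by right | by left].
- apply: (disjoint_base_distances (lt0r_neq0 kh0) ha).
  + rewrite S0 => x hx; apply/eqP; rewrite dotDl dotNl subr_eq; apply/eqP.
    rewrite dotC; apply: (conv_min (hyperplane_convex (b := _))) hx => _ [_ [j _ <-] <-] /=.
    by rewrite dotDr [dot _ (_ *m _)]dotC dot_row2 // addrC (dotC o).
  + rewrite S1 => x hx; apply/eqP; rewrite dotDl dotNl subr_eq; apply/eqP.
    rewrite dotC; apply: (conv_min (hyperplane_convex (b := _))) hx => _ [_ [j _ <-] <-] /=.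
    by rewrite dotDr [dot _ (_ *m _)]dotC dot_row2 // addrC (dotC o) mulrN.
Qed.

Definition lift_height (t : R) (q : 'rV[R]_2) : 'rV[R]_3 :=
  (row_mx q (const_mx t) : 'rV[R]_(2 + 1)).

Lemma lift_heightE t q : lift_height t q = vec (q 0 0) (q 0 1) t.
Proof.
apply/rowP => i; rewrite !mxE /=; case: splitP => j e.
  rewrite -[q]/(q); case: j e => -[|[|//]] lj /= e; rewrite e /=;
  by congr (q _ _); apply: val_inj.
by rewrite mxE; case: j e => -[|//] lj /= ->.
Qed.

Lemma prism_case : phi = 0 -> exists (n : nat) (B0 B1 : set 'rV[R]_3),
  (3 <= n)%N /\ right_prism n P B0 B1 /\ base_distances_disjoint P B0 B1.
Proof.
move=> phiE; have kr0 : 0 < k * r by rewrite mulr_gt0.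
have kh0 : 0 < k * h by rewrite mulr_gt0.
pose c := 2 * (k * h); have c0 : 0 < c by rewrite mulr_gt0.
pose e1 : 'rV[R]_2 := delta_mx 0 0; pose e2 : 'rV[R]_2 := delta_mx 0 1.
pose Q := ngon n 0 e1 e2 (k * r) 0.
pose qt (j : 'I_n) := (0 : 'rV[R]_2) + (k * r * cos (ang 0 j)) *: e1 + (k * r * sin (ang 0 j)) *: e2.
have QE : Q = conv_hull (range qt) by [].
have e12 : orthonormal2 e1 e2.
  have d (u v : 'rV[R]_2) : dot u v = u 0 0 * v 0 0 + u 0 1 * v 0 1.
    rewrite /dot !big_ord_recl big_ord0 addr0; congr (_ + _ * _); congr (_ _ _);
    exact: val_inj.
  by split; rewrite d !mxE /=; ring.
have lq t j : lift_height t (qt j) = vec (k * r * cos (ang 0 j)) (k * r * sin (ang 0 j)) t.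
  by rewrite lift_heightE /qt; apply: vec_eq; rewrite // !mxE /=; ring.
have lift_aff t (x y : 'rV[R]_2) s : lift_height t (s *: x + (1 - s) *: y) =
    s *: lift_height t x + (1 - s) *: lift_height t y.
  by rewrite !lift_heightE !vecL; apply: vec_eq; rewrite ?mxE //; ring.
pose S t := range (fun j : 'I_n => lift_height t (qt j)).
have liftQ t q : Q q -> conv_hull (S t) (lift_height t q).
  rewrite QE => qQ; have : (lift_height t @` conv_hull (range qt)) (lift_height t q) by exists q.
  rewrite conv_affine //; apply: conv_mono => _ [_ [j _ <-] <-].
  by exists j.
pose D := \bigcup_(t in `[0, c]) at_height t Q.
have DE : D = conv_hull (S 0 `|` S c).
  apply/seteqP; split.
    move=> _ [t /= tc [q qQ <-]]; rewrite -/(lift_height t q).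
    move: tc; rewrite in_itv /= => /andP[t0 tc].
    have -> : lift_height t q = (t / c) *: lift_height c q + (1 - t / c) *: lift_height 0 q.
      by rewrite !lift_heightE !vecL; apply: vec_eq; field; rewrite gt_eqF.
    apply: conv_convex_le.
    - by apply: conv_mono (liftQ c q qQ) => ?; right.
    - by apply: conv_mono (liftQ 0 q qQ) => ?; left.
    - by rewrite divr_ge0 ?ler_pdivrMr ?mul1r // ltW.
  apply: conv_min.
    move=> _ _ s [t /= tc [q qQ <-]] [t' /= tc' [q' qQ' <-]] s01.
    exists (s * t + (1 - s) * t').
      move: tc tc'; rewrite /= !in_itv /= => tc tc'.
      exact: itv_convex.
    exists (s *: q + (1 - s) *: q'); first by rewrite QE; apply: conv_convex.
    rewrite -/(lift_height _ _) -/(lift_height t q) -/(lift_height t' q').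
    by rewrite !lift_heightE !vecL; apply: vec_eq; rewrite ?mxE.
  move=> _ [] [j _ <-].
    exists 0; first by rewrite /= in_itv /= lexx ltW.
    by exists (qt j) => //; rewrite QE; apply: conv_sub; exists j.
  exists c; first by rewrite /= in_itv /= lexx ltW.
  by exists (qt j) => //; rewrite QE; apply: conv_sub; exists j.
(* The standard prism starts at height 0, so its origin goes to the centre of the lower polygon. *)
pose o' := o - vec 0 0 (k * h) *m F.
pose f := simil o' 1 F.
have fE (i j l : R) : f (vec i j l) = o + vec i j (l - k * h) *m F.
  rewrite /f /simil scale1r /o' -addrA -mulNmx -mulmxDl vecN vecD.
  by congr (_ + _ *m _); apply: vec_eq; ring.
have PD : P = f @` D.
  rewrite DE simil_conv PE verticesE phiE; congr conv_hull.
  rewrite !image_setU; congr (_ `|` _).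
  - apply/seteqP; split=> [_ [_ [j _ <-] <-]|_ [_ [j _ <-] <-]].
      exists (lift_height 0 (qt j)); first by exists j.
      by rewrite lq -/f fE /pt; congr (_ + _ *m _); apply: vec_eq; rewrite //; ring.
    exists (pt 0 (- h) j); first by exists j.
    by rewrite lq -/f fE /pt; congr (_ + _ *m _); apply: vec_eq; rewrite //; ring.
  - apply/seteqP; split=> [_ [_ [j _ <-] <-]|_ [_ [j _ <-] <-]].
      exists (lift_height c (qt j)); first by exists j.
      by rewrite lq -/f fE /pt; congr (_ + _ *m _); apply: vec_eq; rewrite // /c; ring.
    exists (pt 0 h j); first by exists j.
    by rewrite lq -/f fE /pt; congr (_ + _ *m _); apply: vec_eq; rewrite // /c; ring.
exists n, (f @` at_height 0 Q), (f @` at_height c Q); split=> //; split.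
- exists Q, c, f; split=> //.
    by exists 0, e1, e2, (k * r).
  split; last by move=> x y _ _; rewrite simil_edist // mul1r.
  rewrite PD; split.
  + by move=> x Dx; exists x.
  + move=> x y _ _; apply: (can_inj (@similK _ o' 1 F oF _)); exact: oner_neq0.
  + by move=> _ [x Dx <-]; exists x.
- have kh : - (k * h) != 0 by rewrite oppr_eq0 lt0r_neq0.
  have hgt t q : dot (f (lift_height t q) - o) (row 2 F) = t - k * h.
    by rewrite lift_heightE fE addrC addKr dot_row2.
  apply: (disjoint_base_distances kh ha).
  + by move=> _ [_ [q _ <-] <-]; rewrite -/(lift_height 0 q) hgt; ring.
  + by move=> _ [_ [q _ <-] <-]; rewrite -/(lift_height c q) hgt /c; ring.
Qed.

End TwoNgons.

(** * Tetrahedra *)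

Section Facets.
Variable R : realType.
Implicit Types (o u v w x y z g : 'rV[R]_3) (A : 'M[R]_3) (P G : set 'rV[R]_3).

Lemma affinely_independent3 (p : 'I_3 -> 'rV[R]_3) :
  affinely_independent p <-> cross (p 1 - p 0) (p 2 - p 0) != 0.
Proof.
have e1 : p (lift ord0 0) = p 1 by congr p; apply: val_inj.
have e2 : p (lift ord0 1) = p 2 by congr p; apply: val_inj.
have mulM (x : 'rV[R]_2) : x *m \matrix_(i < 2) (p (lift ord0 i) - p ord0) =
    x 0 0 *: (p 1 - p 0) + x 0 1 *: (p 2 - p 0).
  rewrite mulmx_sum_row big_ord_recl big_ord_recl big_ord0 addr0 !rowK.
  have -> : lift ord0 ord0 = 1 :> 'I_2 by apply: val_inj.
  by rewrite e1 e2.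
rewrite /affinely_independent; set d1 := p 1 - p 0; set d2 := p 2 - p 0.
split=> [fr|c0].
  apply/eqP => c0; have e := cross_eq0 c0.
  have z (x : 'rV[R]_2) : x 0 0 *: d1 + x 0 1 *: d2 = 0 -> x = 0.
    rewrite -mulM => xM; apply: (row_free_inj fr).
    by rewrite xM mul0mx.
  pose x : 'rV[R]_2 := \row_i [:: dot d2 d2; - dot d1 d2]`_i.
  have x0 : x = 0 by apply: z; rewrite !mxE /= e scaleNr subrr.
  have /eqP : dot d2 d2 = 0 by have /rowP/(_ 0) := x0; rewrite !mxE.
  rewrite dot_eq0 => /eqP d20.
  have : (delta_mx 0 1 : 'rV[R]_2) = 0 by apply: z; rewrite d20 !mxE /= scale0r scaler0 addr0.
  by move/rowP/(_ 1); rewrite !mxE /= => /eqP; rewrite oner_eq0.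
apply: inj_row_free => x; rewrite mulM -/d1 -/d2 => e.
have cc : cross d1 d2 != 0 := c0.
have lin (i j : R) : i *: d1 + j *: d2 = 0 -> i = 0 /\ j = 0.
  move=> h; have k1 : i *: cross d1 d2 = 0.
    have -> : i *: cross d1 d2 = cross (i *: d1 + j *: d2) d2.
      rewrite /cross vecZ; apply: vec_eq; rewrite !mxE; ring.
    by rewrite h /cross !mxE -vec0; apply: vec_eq; ring.
  have k2 : j *: cross d1 d2 = 0.
    have -> : j *: cross d1 d2 = cross d1 (i *: d1 + j *: d2).
      rewrite /cross vecZ; apply: vec_eq; rewrite !mxE; ring.
    by rewrite h /cross !mxE -vec0; apply: vec_eq; ring.
  by split; apply/eqP; [move/eqP: k1 | move/eqP: k2]; rewrite scaler_eq0 (negPf cc) orbF.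
have [i0 j0] := lin _ _ e.
apply/rowP => i; rewrite [RHS]mxE; have [->//|->] : i = 0 \/ i = 1.
  case: i => -[|[|m]] lt; [left|right|by []]; exact: val_inj.
by [].
Qed.

(** The last clause is two-dimensionality in the form used later: three non-collinear points of the
    facet leave only one direction for a functional constant on it. *)
Lemma facet_normal (V : set 'rV[R]_3) G : facet (conv_hull V) G ->
  exists u b, [/\ u != 0, forall x, V x -> dot u x <= b,
    G = conv_hull [set x | V x /\ dot u x = b] &
    forall g c, (forall x, V x -> dot u x = b -> dot g x = c) -> exists m, g = m *: u].
Proof.
move=> [] [u [b [u0 ub GE]]] [p [pA pG]].
have pI := (affinely_independent3 p).1 pA.
have ubV x : V x -> dot u x <= b by move=> Vx; apply: ub; apply: conv_sub.
have GE' : G = conv_hull [set x | V x /\ dot u x = b] by rewrite GE face_conv.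
exists u, b; split=> // g c gc.
have gp i : dot g (p i) = c.
  have := pG i; rewrite GE'; apply: (conv_min (hyperplane_convex (u := g) (b := c))).
  by move=> x [Vx ux]; apply: gc.
have up i : dot u (p i) = b by have := pG i; rewrite GE => -[].
set d1 := p 1 - p 0 in pI; set d2 := p 2 - p 0 in pI.
have par y : dot y d1 = 0 -> dot y d2 = 0 ->
    dot (cross d1 d2) (cross d1 d2) *: y = dot y (cross d1 d2) *: cross d1 d2.
  by move=> h1 h2; rewrite cross_decomp h1 h2 !scale0r !addr0.
have eu := par u; rewrite !dotDr !dotNr !up !subrr in eu; have {}eu := eu erefl erefl.
have eg := par g; rewrite !dotDr !dotNr !gp !subrr in eg; have {}eg := eg erefl erefl.
move: eu eg; set N := cross d1 d2 in pI *; move=> eu eg.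
have NN : dot N N != 0 by rewrite dot_eq0.
have uN : dot u N != 0.
  apply: contra_neq u0 => uN; apply: (scalerI NN).
  by rewrite eu uN scale0r scaler0.
exists (dot g N / dot u N); apply: (scalerI NN).
by rewrite eg scalerA mulrC -scalerA eu scalerA divfK.
Qed.

Lemma homogeneous2 P : point_homogeneous 2 P -> homogeneous P.
Proof.
move=> h2 A B hA hB hd.
have [//|//|i j|f fi fe] := h2 (fun=> A ord0) (fun=> B ord0).
  by rewrite !edistE !subrr.
by exists f => // i; rewrite (ord1 i); apply: (fe ord0).
Qed.

Lemma isometric_simil o A G : orthogonal A -> isometric G (simil o 1 A @` G).
Proof.
move=> oA; exists (simil o 1 A); split; last first.
  by move=> x y _ _; rewrite simil_edist // mul1r.
split.
- by move=> x Gx; exists x.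
- by move=> x y _ _; apply: (can_inj (@similK _ o 1 A oA _)); apply: oner_neq0.
- by move=> _ [x Gx <-]; exists x.
Qed.

End Facets.

Section Tetrahedra.
Variable R : realType.
Implicit Types (o u v w x y z g : 'rV[R]_3) (A : 'M[R]_3) (G : set 'rV[R]_3).
Variables (P : set 'rV[R]_3) (W : seq 'rV[R]_3) (o : 'rV[R]_3) (k : R).
Hypotheses (hW : two_homogeneous W) (k0 : 0 < k) (PE : P = conv_hull (vertices P))
  (VE : vertices P = [set o + k *: w | w in [set` W]]).
Hypothesis W4 : size W = 4%N.

Let ns (a b : 'rV[R]_3) : a != b -> b != a.
Proof. by rewrite eq_sym. Qed.

Let perm4 x y z : x \in W -> y \in W -> z \in W -> x != y -> x != z -> y != z ->
  exists l, [/\ l \in W, l != x, l != y & l != z] /\ perm_eq W [:: l; x; y; z].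
Proof.
move=> xW yW zW xy xz yz.
have [l lW] : exists2 l, l \in W & l \notin [:: x; y; z].
  apply: contrapT => h; have : (size W <= size [:: x; y; z])%N.
    apply: uniq_leq_size; first exact: (th_uniq hW).
    by move=> l lW; apply: contrapT => /negP lx; apply: h; exists l.
  by rewrite W4.
rewrite !inE !negb_or => /and3P[lx ly lz].
exists l; split=> //.
have us : uniq [:: l; x; y; z] by rewrite /= !inE !negb_or lx ly lz xy xz yz.
have ss : {subset [:: l; x; y; z] <= W}.
  by move=> t; rewrite !inE => /or4P[] /eqP->.
have sz : (size W <= size [:: l; x; y; z])%N by rewrite W4.
have [_ e] := uniq_min_size us ss sz.
by apply: uniq_perm; rewrite ?(th_uniq hW) // => t; rewrite e.
Qed.

(** The fourth point is [- (x + y + z)], and its unit length gives the sum. If [y] were [- x], the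
    fourth point would be [- z] and all of [W] would lie in a plane. *)
Let tri x y z : x \in W -> y \in W -> z \in W -> x != y -> x != z -> y != z ->
  dot x y + dot x z + dot y z = -1 /\ -1 < dot x y.
Proof.
move=> xW yW zW xy xz yz; have [l [[lW _ _ _] pe]] := perm4 xW yW zW xy xz yz.
have := th_sum hW; rewrite (perm_big _ pe) /= !big_cons big_nil addr0 => s0.
have lE : l = - (x + (y + z)) by apply/eqP; rewrite -addr_eq0 s0.
have [[xx yy] zz] := (th_unit hW xW, th_unit hW yW, th_unit hW zW).
have ll := th_unit hW lW.
split.
  by move: ll; rewrite lE !dotL (dotC y x) (dotC z x) (dotC z y) xx yy zz; lra.
have ge : -1 <= dot x y.
  by have := dot_ge0 (x + y); rewrite !dotL (dotC y x) xx yy; lra.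
rewrite lt_neqAle ge andbT; apply/eqP => e.
have yE : y = - x.
  apply: eq_dotB; rewrite opprK !dotL (dotC y x) xx yy -e; lra.
have c0 : cross x z = 0.
  apply: (th_span hW) => w; rewrite (perm_mem pe) !inE => /or4P[] /eqP ->.
  - by rewrite lE yE !dotL dot_crossl dot_crossr; ring.
  - exact: dot_crossl.
  - by rewrite yE dotNr dot_crossl oppr0.
  - exact: dot_crossr.
have := dot_cross2 x z; rewrite c0 dot0l xx zz mulr1 => /esym/eqP.
rewrite subr_eq0 eq_sym sqrf_eq1 => /orP[]/eqP xz1.
  by case/eqP: xz; apply: unit_dot_eq1.
case/eqP: yz; apply: unit_dot_eq1 => //.
by rewrite yE dotNl xz1 opprK.
Qed.

Let pt w := o + k *: w.

Let pt_sub x y : pt x - pt y = k *: (x - y).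
Proof. by rewrite /pt opprD addrACA subrr add0r -scalerBr. Qed.

(** Acuteness at [x]: by [tri] the product of the two edges is expressed by [dot y z] alone, which
    exceeds -1. *)
Let corner x y z : x \in W -> y \in W -> z \in W -> x != y -> x != z -> y != z ->
  dot (y - x) (z - x) = 2 * (1 + dot y z) /\ 0 < dot (y - x) (z - x).
Proof.
move=> xW yW zW xy xz yz; have [s l] := tri yW zW xW yz (ns xy)
   (ns xz).
have e : dot (y - x) (z - x) = 2 * (1 + dot y z).
  by rewrite !dotL (th_unit hW xW) (dotC x z); lra.
by split=> //; rewrite e; lra.
Qed.

Let angle_acute x y z : x \in W -> y \in W -> z \in W -> x != y -> x != z -> y != z ->
  angle (pt x) (pt y) (pt z) < pi / 2.
Proof.
move=> xW yW zW xy xz yz; have [_ d0] := corner xW yW zW xy xz yz.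
rewrite /angle !pt_sub !dotZl !dotZr.
set d := dot (y - x) (z - x) in d0 *.
have kp := k0.
have n0 v : v != 0 -> 0 < enorm (k *: v).
  move=> v0; rewrite sqrtr_gt0 dot_gt0 scaler_eq0 negb_or v0 andbT.
  exact: lt0r_neq0.
have n1 : 0 < enorm (k *: (y - x)) by apply: n0; rewrite subr_eq0 eq_sym.
have n2 : 0 < enorm (k *: (z - x)) by apply: n0; rewrite subr_eq0 eq_sym.
set q := _ / _.
have q0 : 0 < q by rewrite divr_gt0 // mulr_gt0 // mulr_gt0.
have q1 : q <= 1.
  rewrite ler_pdivrMr ?mulr_gt0 // mul1r.
  have a0 : k * (k * d) \is Num.nneg by rewrite nnegrE ltW // !mulr_gt0.
  have b0 : enorm (k *: (y - x)) * enorm (k *: (z - x)) \is Num.nneg.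
    by rewrite nnegrE ltW // mulr_gt0.
  rewrite -(ler_pXn2r (n := 2) _ a0 b0) // [leRHS]exprMn /enorm !sqr_sqrtr ?dot_ge0 //.
  have := dot_ge0 (cross (k *: (y - x)) (k *: (z - x))).
  by rewrite dot_cross2 !(dotZl, dotZr) subr_ge0.
rewrite ltNge; apply/negP => h.
have p0 := pi_gt0 R.
have qin : -1 <= q <= 1 by apply/andP; split; lra.
have : cos (acos q) <= cos (pi / 2).
  have [->//|ne] := eqVneq (pi / 2) (acos q).
  apply/ltW/cos_decr; first by lra.
    by rewrite lt_neqAle ne.
  exact: acos_lepi.
by rewrite acosK ?in_itv //= cos_pihalf leNgt q0.
Qed.

(** By spanning, a supporting plane misses some vertex. If it missed two, every functional vanishing
    on the difference of the other two would be a multiple of [u] by [facet_normal], but [g1] and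
    [cross (y - x) g1] are independent. *)
Let facet_opposite G : facet P G -> exists l, [/\ l \in W &
  G = conv_hull [set pt w | w in [set w | w \in W /\ w != l]]].
Proof.
rewrite PE VE => /facet_normal[u [b [u0 ub GE un]]].
have kn := lt0r_neq0 k0.
have ptI : injective pt by move=> x y /addrI/(scalerI kn).
have [l [lW lb]] : exists l, l \in W /\ dot u (pt l) <> b.
  apply: contrapT => h; case/eqP: u0; apply: (th_span hW).
  have cst w : w \in W -> dot u (pt w) = b.
    by move=> wW; apply: contrapT => wb; apply: h; exists w.
  pose t := (b - dot u o) / k.
  have cst' w : w \in W -> dot u w = t.
    move=> /cst; rewrite /pt dotDr dotZr => e; rewrite /t -e; field.
    exact: kn.
  have : dot u (\sum_(w <- W) w) = 0 by rewrite (th_sum hW) dot0r.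
  rewrite dot_sumr big_seq (eq_bigr (fun=> t)); last by move=> w /cst'.
  rewrite -big_seq big_const_seq count_predT iter_addr_0 W4 => /eqP.
  by rewrite mulrn_eq0 /= => /eqP t0 w /cst' ->.
exists l; split=> //; rewrite GE; congr conv_hull.
have uniqe l' : l' \in W -> dot u (pt l') <> b -> l' = l.
  move=> lW' lb'; apply: contrapT => /eqP ll'.
  have [x [xW xl xl']] : exists x, [/\ x \in W, x != l & x != l'].
    apply: contrapT => h; have : (size W <= size [:: l; l'])%N.
      apply: uniq_leq_size; first exact: (th_uniq hW).
      move=> x xW; rewrite !inE; apply: contrapT => /negP; rewrite negb_or => /andP[x1 x2].
      by apply: h; exists x.
    by rewrite W4.
  have [y [[yW yx yl yl'] pe]] := perm4 xW lW lW' xl xl' (ns ll').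
  have all w c g : dot g (pt x) = c -> dot g (pt y) = c -> w \in W ->
      dot u (pt w) = b -> dot g (pt w) = c.
    move=> gx gy; rewrite (perm_mem pe) !inE => /or4P[]/eqP-> //.
  have par g : dot g (y - x) = 0 -> exists m, g = m *: u.
    move=> gd; apply: (un g (dot g (pt x))) => _ [w /= wW <-] uw.
    apply: (all w) => //; apply/eqP; rewrite -subr_eq0 -dotNr -dotDr.
    by rewrite pt_sub dotZr gd mulr0.
  have [g1 g11 g1d] := exists_unit_orth (y - x).
  have d0 : y - x != 0 by rewrite subr_eq0.
  have [m1 e1] := par _ g1d.
  have [m2 e2] := par _ (dot_crossl (y - x) g1).
  have : dot (cross (y - x) g1) g1 = 0 := dot_crossr _ _.
  rewrite e2 e1 dotZl dotZr => /eqP; rewrite !mulf_eq0 dot_eq0 (negPf u0) orbF.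
  move=> /orP[/eqP m20|/eqP m10]; last first.
    by move: g11; rewrite e1 m10 scale0r dot0l => /eqP; rewrite eq_sym oner_eq0.
  have := dot_cross2 (y - x) g1; rewrite e2 m20 scale0r dot0l g11 (dotC _ g1) g1d.
  by rewrite mulr1 expr2 mul0r subr0 => /esym/eqP; rewrite dot_eq0 (negPf d0).
apply/seteqP; split=> [_ [[w /= wW <-] uw]|_ [w [wW wl] <-]].
  by exists w => //; split=> //; apply/eqP => wl; apply: lb; rewrite -wl.
split; first by exists w.
by apply: contrapT => /(uniqe w wW)/eqP; rewrite (negPf wl).
Qed.

Lemma tetrahedron_case : point_homogeneous 2 P ->
  tetrahedron P /\ homogeneous P /\
     (forall F G, facet P F -> facet P G -> isometric F G) /\
     (forall F, facet P F -> acute_triangle F).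
Proof.
move=> h2; have kn := lt0r_neq0 k0; split.
  exists (fun i : 'I_4 => pt (nth 0 W i)); split; last first.
    rewrite {1}PE VE; congr conv_hull; apply/seteqP; split=> [_ [w /= wW <-]|_ [i _ <-]].
      have iw : (index w W < 4)%N by rewrite -W4 index_mem.
      by exists (Ordinal iw) => //=; rewrite nth_index.
    by exists (nth 0 W i) => //=; apply: mem_nth; rewrite W4.
  rewrite /affinely_independent row_free_unit -unitmx_tr -row_free_unit.
  apply: inj_row_free => x xM; apply: (th_span hW).
  have h (i : 'I_3) : dot x (nth 0 W i.+1) = dot x (nth 0 W 0).
    have /rowP/(_ i) := xM; rewrite mxE [RHS]mxE => e.
    have e' : dot x (pt (nth 0 W i.+1) - pt (nth 0 W 0)) = 0.
      by rewrite -[RHS]e; apply: eq_bigr => j _; rewrite !mxE.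
    move: e'; rewrite pt_sub dotZr dotDr dotNr => /eqP.
    by rewrite mulf_eq0 (negPf kn) subr_eq0 => /eqP.
  have h' w : w \in W -> dot x w = dot x (nth 0 W 0).
    move=> wW; rewrite -(nth_index 0 wW).
    have : (index w W < 4)%N by rewrite -W4 index_mem.
    case: (index w W) => [//|j] j3.
    by have := h (Ordinal (j3 : (j < 3)%N)).
  have : dot x (\sum_(w <- W) w) = 0 by rewrite (th_sum hW) dot0r.
  rewrite dot_sumr big_seq (eq_bigr (fun=> dot x (nth 0 W 0))); last by move=> w /h'.
  rewrite -big_seq big_const_seq count_predT iter_addr_0 W4 => /eqP.
  by rewrite mulrn_eq0 /= => /eqP t0 w /h' ->.
split.
  exact: homogeneous2.
split.
  move=> F G /facet_opposite[l [lW ->]] /facet_opposite[l' [lW' ->]].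
  have [A sA lA] := th_trans hW lW lW'; have sT := sym_tr hW sA.
  have -> : conv_hull [set pt w | w in [set w | w \in W /\ w != l']] =
      simil (o - o *m A) 1 A @` conv_hull [set pt w | w in [set w | w \in W /\ w != l]].
    rewrite simil_conv; congr conv_hull.
    have e w : simil (o - o *m A) 1 A (pt w) = pt (w *m A).
      by rewrite /simil /pt scale1r mulmxDl addrA subrK scalemxAl.
    apply/seteqP; split=> [_ [w [wW wl] <-]|_ [_ [w [wW wl] <-] <-]].
      exists (pt (w *m A^T)); last by rewrite e orthVK //; apply: sA.1.
      exists (w *m A^T) => //; split; first exact: sT.2.
      apply: contra_neq wl => wl; rewrite -lA -wl orthVK //; exact: sA.1.
    rewrite e; exists (w *m A) => //; split; first exact: sA.2.
    by rewrite -lA (inj_eq (orth_inj sA.1)).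
  by apply: isometric_simil; apply: sA.1.
move=> F /facet_opposite[l [lW ->]].
have [x [xW xl]] : exists x, x \in W /\ x != l.
  by have [x xW xl] := neq_exists hW lW; exists x.
have [y [yW yl yx]] : exists y, [/\ y \in W, y != l & y != x].
  apply: contrapT => h; have : (size W <= size [:: l; x])%N.
    apply: uniq_leq_size; first exact: (th_uniq hW).
    move=> t tW; rewrite !inE; apply: contrapT => /negP; rewrite negb_or => /andP[x1 x2].
    by apply: h; exists t.
  by rewrite W4.
have [z [[zW zl zx zy] pe]] := perm4 lW xW yW (ns xl)
  (ns yl) (ns yx).
pose t (i : 'I_3) := [:: x; y; z]`_i.
have tW i : t i \in W by case: i => -[|[|[|//]]] lt.
have tI i j : i != j -> t i != t j.
  case: i => -[|[|[|//]]] li; case: j => -[|[|[|//]]] lj => //= _; rewrite /t /=; auto.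
exists (fun i => pt (t i)); split.
- apply/affinely_independent3; rewrite !pt_sub.
  have [e01 l01] := corner (tW 0) (tW 1) (tW 2) (tI 0 1 isT) (tI 0 2 isT) (tI 1 2 isT).
  have [s12 l12] := tri (tW 1) (tW 2) (tW 0) (tI 1 2 isT) (tI 1 0 isT) (tI 2 0 isT).
  have [s01 l01'] := tri (tW 0) (tW 1) (tW 2) (tI 0 1 isT) (tI 0 2 isT) (tI 1 2 isT).
  have [s02 l02'] := tri (tW 0) (tW 2) (tW 1) (tI 0 2 isT) (tI 0 1 isT) (tI 2 1 isT).
  have := (th_unit hW (tW 0), th_unit hW (tW 1), th_unit hW (tW 2)).
  move: e01 s12 l12 s01 l01' s02 l02'; set a := t 0; set b := t 1; set c := t 2.
  move=> e01 s12 l12 s01 l01' s02 l02' [[aa bb] cc].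
  rewrite -dot_gt0 dot_cross2 !dotZl !dotZr e01 !dotB aa bb cc (dotC b a) (dotC c a).
  set A := dot a b in s01 l01' *; set B := dot a c in s01 l02' *; set C := dot b c in s01 l12 *.
  have -> : k * (k * (1 + 1 - 2 * A)) * (k * (k * (1 + 1 - 2 * B))) -
      (k * (k * (2 * (1 + C)))) ^+ 2 = 4 * k ^+ 4 * ((1 - A) * (1 - B) - (1 + C) ^+ 2) by ring.
  (* By A + B + C = -1 the squared area becomes a sum of products of the positive numbers 1 + A, 1 +
     B, 1 + C. *)
  have -> : (1 - A) * (1 - B) - (1 + C) ^+ 2 =
      (1 + A) * (1 + B) + (1 + A) * (1 + C) + (1 + B) * (1 + C).
    have -> : C = -1 - A - B by lra.
    by ring.
  apply: mulr_gt0; first by rewrite mulr_gt0 // exprn_gt0.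
  have h1 : 0 < (1 + A) * (1 + B) by apply: mulr_gt0; lra.
  have h2' : 0 < (1 + A) * (1 + C) by apply: mulr_gt0; lra.
  have h3 : 0 < (1 + B) * (1 + C) by apply: mulr_gt0; lra.
  by lra.
- congr conv_hull; apply/seteqP; split=> [_ [w [wW wl] <-]|_ [i _ <-]].
    move: wW; rewrite (perm_mem pe) !inE (negPf wl) /= => /or3P[]/eqP->.
    + by exists 2.
    + by exists 0.
    + by exists 1.
  exists (t i) => //; split; first exact: tW.
  by case: i => -[|[|[|//]]] lt; rewrite /t /=.
- by move=> i j m ij im jm; apply: angle_acute; rewrite ?tW ?tI.
Qed.

End Tetrahedra.

(** * Regular polyhedra *)

Section RegularPolygonsInSpace.
Variable R : realType.
Implicit Types (o u v w x y z e : 'rV[R]_3) (A : 'M[R]_3) (P G : set 'rV[R]_3).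

(** The recurrence is that of a rotation by 2 pi / N, so a polygon listed in coordinates is
    recognised from a single cosine; [e2] is the normalised part of [q 1] orthogonal to [q 0]. *)
Lemma ngon_of_recurrence (N : nat) o (q : nat -> 'rV[R]_3) (r : R) :
  let c := cos (2 * pi / N%:R) in
  (3 <= N)%N -> 0 < r -> dot (q 0%N) (q 0%N) = r ^+ 2 -> dot (q 1%N) (q 1%N) = r ^+ 2 ->
  dot (q 0%N) (q 1%N) = r ^+ 2 * c ->
  (forall k, (k.+2 < N)%N -> q k.+2 = (2 * c) *: q k.+1 - q k) ->
  exists e1 e2, orthonormal2 e1 e2 /\
    conv_hull (range (fun k : 'I_N => o + q k)) = ngon N o e1 e2 r 0.
Proof.
set t := 2 * pi / N%:R => c N3 r0 q00 q11 q01 rec.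
have N0 : N%:R != 0 :> R by rewrite pnatr_eq0; case: (N) N3.
have N3' : 3 <= N%:R :> R by rewrite (ler_nat R 3 N).
have p0 := pi_gt0 R.
have s0 : 0 < sin t.
  apply: sin_gt0_pi; apply/andP; split; first by rewrite divr_gt0 //; lra.
  by rewrite /t ltr_pdivrMr; [nra | lra].
have cs : c ^+ 2 + sin t ^+ 2 = 1 by exact: cos2Dsin2.
set s := sin t in s0 cs.
have [r' s'] := (lt0r_neq0 r0, lt0r_neq0 s0).
pose e1 := r^-1 *: q 0%N; pose e2 := (r * s)^-1 *: (q 1%N - c *: q 0%N).
have qk k : (k < N)%N -> q k = (r * cos (t * k%:R)) *: e1 + (r * sin (t * k%:R)) *: e2.
  have [m] := ubnP k; elim: m k => // m IH [|[|k]] km kN.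
  - by rewrite mulr0 cos0 sin0 mulr0 scale0r addr0 mulr1 /e1 scalerA mulfV ?scale1r.
  - rewrite mulr1 -/c -/s /e1 /e2 !scalerA mulfV ?mulf_neq0 // scale1r.
    by rewrite [r * c]mulrC mulfK // addrC subrK.
  have k1N : (k.+1 < N)%N by apply: ltnW.
  rewrite rec // (IH k.+1 km k1N) (IH k (ltnW km) (ltnW k1N)).
  have tk : t * k.+2%:R = t * k.+1%:R + t.
    by rewrite -(natr1 k.+1); ring.
  have tk' : t * k%:R = t * k.+1%:R - t by rewrite -(natr1 k); ring.
  rewrite tk tk' cosB sinB cosD sinD -/c -/s.
  move: (cos _) (sin _) => C S; apply/rowP => i; rewrite !mxE; ring.
have o12 : orthonormal2 e1 e2.
  split; rewrite /e1 /e2 !dotZl !dotZr.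
  - by rewrite q00; field.
  - rewrite dotB !dotZr !dotZl (dotC (q 1%N)) q00 q11 q01.
    have -> : (r * s)^-1 * ((r * s)^-1 * (r ^+ 2 + c * (c * r ^+ 2) - 2 * (c * (r ^+ 2 * c))))
       = (1 - c ^+ 2) / s ^+ 2 by field; rewrite r' s'.
    by rewrite -cs addrC addKr mulfV // expf_neq0.
  - rewrite dotDr dotNr dotZr q00 q01; have -> : r ^+ 2 * c - c * r ^+ 2 = 0 by ring.
    by rewrite !mulr0.
exists e1, e2; split=> //; congr (conv_hull _); apply/seteqP.
have e (k : 'I_N) : o + q k = o + (r * cos (0 + 2 * pi * k%:R / N%:R)) *: e1 +
    (r * sin (0 + 2 * pi * k%:R / N%:R)) *: e2.
  by rewrite qk // addrA add0r mulrAC.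
by split=> _ [k _ <-]; exists k => //; rewrite e.
Qed.

Lemma ngon_isometric (N : nat) o o' e1 e2 e1' e2' (r : R) :
  orthonormal2 e1 e2 -> orthonormal2 e1' e2' ->
  isometric (ngon N o e1 e2 r 0) (ngon N o' e1' e2' r 0).
Proof.
move=> h h'; have [nn n1 n2] := ortho_cross h; have [nn' n1' n2'] := ortho_cross h'.
set n := cross e1 e2 in nn n1 n2; set n' := cross e1' e2' in nn' n1' n2'.
pose A := rows3 e1 e2 n; pose A' := rows3 e1' e2' n'.
have oA : orthogonal A by apply: orth_rows3; rewrite // dotC.
have oA' : orthogonal A' by apply: orth_rows3; rewrite // dotC.
have AA : orthogonal (A^T *m A') by apply: orth_mul => //; apply: orth_tr.
case: h => uu vv uv; clearbody n n'.
have E1 : e1 *m (A^T *m A') = e1'.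
  by rewrite mulmxA mul_rows3 uu uv dotC n1 vec_rows3 scale1r !scale0r !addr0.
have E2 : e2 *m (A^T *m A') = e2'.
  by rewrite mulmxA mul_rows3 vv (dotC _ e1) uv dotC n2 vec_rows3 scale1r !scale0r add0r addr0.
have -> : ngon N o' e1' e2' r 0 = simil (o' - o *m (A^T *m A')) 1 (A^T *m A') @` ngon N o e1 e2 r 0.
  rewrite simil_conv; congr (conv_hull _); set M := A^T *m A' in E1 E2 *.
  have e t : simil (o' - o *m M) 1 M (o + (r * cos t) *: e1 + (r * sin t) *: e2) =
      o' + (r * cos t) *: e1' + (r * sin t) *: e2'.
    by rewrite /simil scale1r !mulmxDl -!scalemxAl E1 E2 !addrA subrK.
  by rewrite image_comp; apply: eq_imagel => k _ /=; rewrite e.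
exact: isometric_simil.
Qed.

Lemma ngon_simil (N : nat) o e1 e2 (r : R) o' (k : R) A :
  simil o' k A @` ngon N o e1 e2 r 0 =
  ngon N (simil o' k A o) (e1 *m A) (e2 *m A) (k * r) 0.
Proof.
rewrite simil_conv; congr (conv_hull _).
have e t : simil o' k A (o + (r * cos t) *: e1 + (r * sin t) *: e2) =
    simil o' k A o + (k * r * cos t) *: (e1 *m A) + (k * r * sin t) *: (e2 *m A).
  by rewrite /simil !mulmxDl -!scalemxAl !scalerDr !scalerA !addrA !mulrA.
by rewrite image_comp; apply: eq_imagel => i _ /=; rewrite e.
Qed.

Lemma facet_simil o (k : R) A P G : orthogonal A -> 0 < k -> facet P G ->
  facet (simil o k A @` P) (simil o k A @` G).
Proof.
move=> oA k0 [] [u [b [u0 ub GE]]] [p [pA pG]]; split.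
  have e x : dot (u *m A) (simil o k A x) = dot (u *m A) o + k * dot u x.
    by rewrite /simil dotDr dotZr dot_orth.
  exists (u *m A), (dot (u *m A) o + k * b); split.
  - by apply: contra_neq u0 => uA; apply: (orth_inj oA); rewrite uA mul0mx.
  - by move=> _ [x Px <-]; rewrite e lerD2l ler_pM2l // ub.
  - rewrite GE; apply/seteqP; split=> [_ [x [Px ux] <-]|_ [[x Px <-] ux]].
      by split; [exists x | rewrite e ux].
    exists x => //; split=> //; move: ux; rewrite e => /addrI.
    by apply: mulfI; rewrite lt0r_neq0.
exists (simil o k A \o p); split; last by move=> i; exists (p i).
apply/affinely_independent3; rewrite /= !simil_sub -dot_gt0 dot_cross2.
rewrite !dotZl !dotZr !dot_orth //.
have := (affinely_independent3 p).1 pA; rewrite -dot_gt0 dot_cross2.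
set a := dot _ _; set b' := dot _ _; set c := dot _ _ => h.
have -> : k * (k * a) * (k * (k * b')) - (k * (k * c)) ^+ 2 = k ^+ 4 * (a * b' - c ^+ 2) by ring.
by rewrite mulr_gt0 // exprn_gt0.
Qed.

Lemma facet_similE o (k : R) A P G : orthogonal A -> 0 < k ->
  facet (simil o k A @` P) G <-> exists2 G', facet P G' & G = simil o k A @` G'.
Proof.
move=> oA k0; have kn := lt0r_neq0 k0; split; last first.
  by move=> [G' fG ->]; apply: facet_simil.
have c1 := @similK _ o k A oA kn; have c2 := @simil_invK _ o k A oA kn.
have e1 : simil_inv o k A \o simil o k A = id by apply/funext/c1.
have e2 : simil o k A \o simil_inv o k A = id by apply/funext/c2.
move=> fG; exists (simil_inv o k A @` G); last by rewrite image_comp e2 image_id.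
have ki : 0 < k^-1 by rewrite invr_gt0.
have := facet_simil (- (k^-1 *: (o *m A^T))) (orth_tr oA) ki fG.
by rewrite -simil_invE // image_comp e1 image_id.
Qed.

End RegularPolygonsInSpace.

(** * Facets described by a dual list of normals *)

Section DualPairs.
Variable R : realType.
Implicit Types (o u v w x y z e d : 'rV[R]_3) (A : 'M[R]_3) (G : set 'rV[R]_3).

Definition tight (S : seq 'rV[R]_3) (b : R) u := [set x | [set` S] x /\ dot u x = b].

(** The radius is a parameter so that faces with the same [N] and [r] are isometric. *)
Definition regular_face S b (N : nat) (r : R) u :=
  (exists x y z, [/\ tight S b u x, tight S b u y, tight S b u z & cross (y - x) (z - x) != 0]) /\
  (exists o e1 e2, orthonormal2 e1 e2 /\ conv_hull (tight S b u) = ngon N o e1 e2 r 0).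

Lemma tight_orth S b u A : orthogonal A ->
  (forall x, x \in S -> x *m A \in S) -> (forall x, x \in S -> x *m A^T \in S) ->
  tight S b u = (fun x => x *m A^T) @` tight S b (u *m A).
Proof.
move=> oA SA SA'; apply/seteqP; split=> [x [xS ux]|_ [x [xS ux] <-]].
  exists (x *m A); last by rewrite orthK.
  by split; [exact: SA | rewrite dot_orth].
by split; [exact: SA' | rewrite -dot_mxl].
Qed.

Lemma regular_face_orth S b N r u A : orthogonal A ->
  (forall x, x \in S -> x *m A \in S) -> (forall x, x \in S -> x *m A^T \in S) ->
  regular_face S b N r (u *m A) -> regular_face S b N r u.
Proof.
move=> oA SA SA' [[x [y [z [tx ty tz c0]]]] [a [e1 [e2 [n12 fE]]]]].
have tE := tight_orth b u oA SA SA'; have oT := orth_tr oA.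
split.
  exists (x *m A^T), (y *m A^T), (z *m A^T).
  rewrite tE; split; [by exists x|by exists y|by exists z|].
  move: c0; rewrite -!dot_gt0 !dot_cross2 -!mulmxBl.
  by rewrite !dot_orth.
exists (simil 0 1 A^T a), (e1 *m A^T), (e2 *m A^T); split.
  by case: n12 => *; split; rewrite dot_orth.
have -> : r = 1 * r by rewrite mul1r.
rewrite -ngon_simil -fE tE simil_conv; congr conv_hull.
by apply: eq_imagel => v _; rewrite /simil add0r scale1r.
Qed.

(** Three non-collinear points span the plane, and a plane not through the origin has only one
    normal with value [b]; distinct normals thus give distinct facets. *)
Lemma regular_face_unique S (b : R) N r u v : b != 0 -> regular_face S b N r u ->
  tight S b u `<=` [set x | dot v x = b] -> v = u.
Proof.
move=> b0 [[x [y [z [tx ty tz c0]]]] _] uv.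
have vx : dot v x = b := uv _ tx.
have vy : dot v y = b := uv _ ty.
have vz : dot v z = b := uv _ tz.
have [[[_ ux] [_ uy]] [_ uz]] := (tx, ty, tz).
apply: (eq_of_dots c0); rewrite ?(dotDr, dotNr) /= ?ux ?uy ?uz ?vx ?vy ?vz //.
set n := cross _ _ in c0 *.
have par w : dot w x = b -> dot w y = b -> dot w z = b -> dot n n * b = dot w n * dot n x.
  move=> wx wy wz; have := congr1 (fun w' => dot w' x) (cross_decomp w (y - x) (z - x)).
  by rewrite /= !dotDl !dotZl !dotDr !dotNr wx wy wz subrr !mul0r !addr0 -/n.
have := par v vx vy vz; rewrite (par u ux uy uz) => /esym.
apply: mulIf; apply: contraNneq b0 => nx; have := par u ux uy uz.
by rewrite nx mulr0 => /eqP; rewrite mulf_eq0 dot_eq0 (negPf c0).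
Qed.

(* U is to be the list of the outer normals of the facets of the convex hull of
   S, scaled so that the supporting value is b; [dual_face] makes U exhaustive
   without computing the polar polytope. *)
Variables (S U : seq 'rV[R]_3) (b : R) (N : nat) (r : R).
Hypotheses (b0 : 0 < b) (N3 : (3 <= N)%N) (r0 : 0 < r) (uU : uniq U).
Hypotheses (S0 : S != [::]) (SN : forall x, x \in S -> - x \in S).
Hypothesis Sspan : forall u, (forall x, x \in S -> dot u x = 0) -> u = 0.
Hypothesis dual_le : forall u x, u \in U -> x \in S -> dot u x <= b.
Hypothesis dual_face : forall u, (forall x, x \in S -> dot u x <= b) ->
  exists2 d, d \in U & forall x, x \in S -> dot u x = b -> dot d x = b.
Hypothesis faces : forall u, u \in U -> regular_face S b N r u.

(** A facet normal, rescaled to the value [b], is tight only where some [d] in [U] is tight; the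
    facet being two-dimensional, [d] is a multiple of it, and the common value [b] makes them
    equal. *)
Lemma dual_facets G : facet (conv_hull [set` S]) G <->
  exists2 u, u \in U & G = conv_hull (tight S b u).
Proof.
split=> [/facet_normal[u [t [u0 ut GE un]]]|[u uU' ->]]; last first.
  split; last first.
    have [[x [y [z [tx ty tz c0]]]] _] := faces uU'.
    exists (fun i : 'I_3 => [:: x; y; z]`_i); split; first exact/affinely_independent3.
    by case=> -[|[|[|//]]] lt; apply: conv_sub.
  exists u, b; split; last by rewrite face_conv // => x xS; apply: dual_le.
    apply/eqP => uz; have [[x [y [z [[_ +] _ _ _]]]] _] := faces uU'.
    by rewrite uz dot0l; apply/eqP; rewrite lt_eqF.
  by apply: (conv_min (halfspace_convex (u := u) (b := b))) => x xS; apply: dual_le.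
(* [S] is symmetric about the origin, so the value is non-negative; the value 0 would put [S] into a
   plane through the origin. *)
have t0 : 0 < t.
  have [x xS] : exists x, x \in S by case: (S) S0 => // x s _; exists x; rewrite mem_head.
  have t0 : 0 <= t.
    by have := ut _ xS; have := ut _ (SN xS); rewrite dotNr; lra.
  rewrite lt_neqAle t0 andbT; apply: contra_neq u0 => tz; apply: Sspan => y yS.
  by have := ut _ yS; have := ut _ (SN yS); rewrite dotNr -tz; lra.
have [bn tn] := (lt0r_neq0 b0, lt0r_neq0 t0).
pose v := (b / t) *: u.
have bt : 0 < b / t by rewrite divr_gt0.
have ve x : (dot v x == b) = (dot u x == t).
  rewrite /v dotZl; apply/eqP/eqP => [h|->]; last by rewrite divfK.
  by apply: (mulfI (lt0r_neq0 bt)); rewrite h divfK.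
have [d dU dt] : exists2 d, d \in U & forall x, x \in S -> dot v x = b -> dot d x = b.
  apply: dual_face => x xS; rewrite /v dotZl -[leRHS](divfK tn) ler_pM2l //.
  exact: ut.
have tuv : tight S t u = tight S b v.
  by apply/seteqP; split=> x [xS /eqP e]; split=> //; apply/eqP; rewrite ?ve // -ve.
have [m dE] : exists m, d = m *: u.
  by apply: (un d b) => x xS ux; apply: dt => //; apply/eqP; rewrite ve ux.
have [x [xS ux]] : exists x, tight S t u x.
  apply: contrapT => h.
  have [w ww wu] := exists_unit_orth u.
  have [k kE] : exists k, w = k *: u.
    by apply: (un w 0) => x xS ux; case: h; exists x.
  move: wu; rewrite kE dotZl => /eqP; rewrite mulf_eq0 dot_eq0 (negPf u0) orbF => /eqP k0.
  by move: ww; rewrite kE k0 scale0r dot0l => /eqP; rewrite eq_sym oner_eq0.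
have dv : d = v.
  have : dot d x = b by apply: dt => //; apply/eqP; rewrite ve ux.
  rewrite dE /v dotZl ux => <-; by rewrite mulfK.
by exists d => //; rewrite GE -/(tight S t u) tuv dv.
Qed.

Lemma dual_regular P o (k : R) F : orthogonal F -> 0 < k ->
  P = simil o k F @` conv_hull [set` S] ->
  nondegenerate_polyhedron P -> homogeneous P ->
  regular_polyhedron P /\ has_facets P (size U).
Proof.
move=> oF k0 PE nP hP.
have facetE G : facet P G <->
    exists2 u, u \in U & G = simil o k F @` conv_hull (tight S b u).
  rewrite PE facet_similE //; split=> [[G' /dual_facets[u uS ->] ->]|[u uS ->]].
    by exists u.
  by exists (conv_hull (tight S b u)) => //; apply/dual_facets; exists u.
have ngonE G : facet P G -> exists c e1 e2, orthonormal2 e1 e2 /\ G = ngon N c e1 e2 (k * r) 0.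
  move=> /facetE[u uS ->]; have [_ [c [e1 [e2 [n12 ->]]]]] := faces uS.
  exists (simil o k F c), (e1 *m F), (e2 *m F); rewrite ngon_simil; split=> //.
  by case: n12 => *; split; rewrite dot_orth.
split.
  split=> // [G /ngonE[c [e1 [e2 [n12 ->]]]]|G G'].
    by exists N; split=> //; exists c, e1, e2, (k * r); split=> //; apply: mulr_gt0.
  move=> /ngonE[c [e1 [e2 [n12 ->]]]] /ngonE[c' [e1' [e2' [n12' ->]]]].
  exact: ngon_isometric.
pose g (i : nat) := simil o k F @` conv_hull (tight S b (nth 0 U i)).
rewrite /has_facets; have -> : [set G | facet P G] = g @` `I_(size U).
  apply/seteqP; split=> [G /= /facetE[u uS ->]|_ [i /= iU <-]].
    by exists (index u U); rewrite /= ?index_mem // /g nth_index.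
  by apply/facetE; exists (nth 0 U i) => //; apply: mem_nth.
apply: inj_card_eq => i j /set_mem /= iU /set_mem /= jU gij.
apply/eqP; rewrite -(nth_uniq 0 iU jU uU); apply/eqP/esym.
apply: (regular_face_unique (lt0r_neq0 b0) (faces (mem_nth 0 iU))) => x tx.
have : g j (simil o k F x) by rewrite -gij; exists x => //; apply: conv_sub.
move=> [y cy /(can_inj (similK o oF (lt0r_neq0 k0))) xy]; rewrite -xy.
by move: y cy {xy}; apply: (conv_min (hyperplane_convex (b := b))) => y [].
Qed.

End DualPairs.

(** * Reduction to one octant by pyritohedral symmetry *)

Section Pyritohedral.
Variable R : realType.
Implicit Types (o u v w d s : 'rV[R]_3) (S U : seq 'rV[R]_3) (Q : 'rV[R]_3 -> Prop).
Local Notation f := (golden R).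

(* Invariance under the group of order 24 generated by the sign changes and
   the cyclic permutations of the coordinates. *)
Definition pyritohedral Q := forall x y z, Q (vec x y z) ->
  [/\ Q (vec (- x) y z), Q (vec x (- y) z), Q (vec x y (- z)) & Q (vec z x y)].

Lemma pyritohedral_octant Q : pyritohedral Q ->
  (forall x y z, 0 <= x -> 0 <= y -> 0 <= z -> Q (vec x y z)) -> forall u, Q u.
Proof.
move=> pQ oct u; rewrite (vecE u); move: (u 0 0) (u 0 1) (u 0 2) => x y z.
have h1 (a b c : R) : 0 <= b -> 0 <= c -> Q (vec a b c).
  move=> b0 c0; have [a0|/ltW a0] := leP 0 a; first exact: oct.
  by rewrite -[a]opprK; have [] := pQ _ _ _ (oct (- a) b c _ b0 c0); rewrite ?oppr_ge0.
have h2 (a b c : R) : 0 <= c -> Q (vec a b c).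
  move=> c0; have [b0|/ltW b0] := leP 0 b; first exact: h1.
  by rewrite -[b]opprK; have [] := pQ _ _ _ (h1 a (- b) c _ c0); rewrite ?oppr_ge0.
have [z0|/ltW z0] := leP 0 z; first exact: h2.
by rewrite -[z]opprK; have [] := pQ _ _ _ (h2 x y (- z) _); rewrite ?oppr_ge0.
Qed.

Local Notation mem_pred S := (fun u => is_true (u \in S)).

Lemma pyritohedral_opp S : pyritohedral (mem_pred S) -> forall u, u \in S -> - u \in S.
Proof.
move=> pS u; rewrite (vecE u) => /pS[/pS[_ /pS[_ _ + _] _ _] _ _ _].
by rewrite vecN.
Qed.

Lemma pyritohedral_span S x y z : pyritohedral (mem_pred S) -> vec x y z \in S -> x != 0 ->
  forall u, (forall s, s \in S -> dot u s = 0) -> u = 0.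
Proof.
move=> pS sS x0 u; rewrite (vecE u) -[X in _ = X]vec0.
move: (u 0 0) (u 0 1) (u 0 2) => a b c h.
have zero t : t * x = 0 -> t = 0.
  by move=> /eqP; rewrite mulf_eq0 (negPf x0) orbF => /eqP.
have [s1 _ _ s2] := pS _ _ _ sS; have [_ s3 _ s4] := pS _ _ _ s2.
have [_ _ s5 _] := pS _ _ _ s4.
move: (h _ sS) (h _ s1) (h _ s2) (h _ s3) (h _ s4) (h _ s5); rewrite !dot_vec => *.
by apply: vec_eq; apply: zero; lra.
Qed.

Definition flip1 : 'M[R]_3 := rows3 (vec (- 1) 0 0) (vec 0 1 0) (vec 0 0 1).
Definition flip2 : 'M[R]_3 := rows3 (vec 1 0 0) (vec 0 (- 1) 0) (vec 0 0 1).
Definition flip3 : 'M[R]_3 := rows3 (vec 1 0 0) (vec 0 1 0) (vec 0 0 (- 1)).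
Definition cycle3 : 'M[R]_3 := rows3 (vec 0 1 0) (vec 0 0 1) (vec 1 0 0).

Lemma vec_pyritohedral (x y z : R) :
  [/\ vec x y z *m flip1 = vec (- x) y z, vec x y z *m flip2 = vec x (- y) z,
      vec x y z *m flip3 = vec x y (- z) & vec x y z *m cycle3 = vec z x y].
Proof. by split; rewrite vec_rows3 !vecL; apply: vec_eq; ring. Qed.

Lemma vec_pyritohedralT (x y z : R) :
  [/\ vec x y z *m flip1^T = vec (- x) y z, vec x y z *m flip2^T = vec x (- y) z,
      vec x y z *m flip3^T = vec x y (- z) & vec x y z *m cycle3^T = vec y z x].
Proof. by split; rewrite mul_rows3 !dot_vec; apply: vec_eq; ring. Qed.

Lemma orth_pyritohedral :
  [/\ orthogonal flip1, orthogonal flip2, orthogonal flip3 & orthogonal cycle3].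
Proof. by split; apply: orth_rows3; rewrite /orthonormal2 ?dot_vec; try split; ring. Qed.

Lemma pyritohedral_face S b N r : pyritohedral (mem_pred S) ->
  pyritohedral (regular_face S b N r).
Proof.
move=> pS x y z h; have [orth1 orth2 orth3 orthc] := orth_pyritohedral.
have pS1 p q t : vec p q t \in S -> vec q t p \in S.
  by move=> /pS[_ _ _ /pS[]].
split.
- apply: (@regular_face_orth _ S b N r _ flip1) => // [s|s|].
  + by rewrite (vecE s) => /pS[+ _ _ _]; have [->] := vec_pyritohedral (s 0 0) (s 0 1) (s 0 2).
  + by rewrite (vecE s) => /pS[+ _ _ _]; have [->] := vec_pyritohedralT (s 0 0) (s 0 1) (s 0 2).
  + by have [-> _ _ _] := vec_pyritohedral (- x) y z; rewrite opprK.
- apply: (@regular_face_orth _ S b N r _ flip2) => // [s|s|].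
  + by rewrite (vecE s) => /pS[_ + _ _]; have [_ ->] := vec_pyritohedral (s 0 0) (s 0 1) (s 0 2).
  + by rewrite (vecE s) => /pS[_ + _ _]; have [_ ->] := vec_pyritohedralT (s 0 0) (s 0 1) (s 0 2).
  + by have [_ -> _ _] := vec_pyritohedral x (- y) z; rewrite opprK.
- apply: (@regular_face_orth _ S b N r _ flip3) => // [s|s|].
  + by rewrite (vecE s) => /pS[_ _ + _]; have [_ _ ->] := vec_pyritohedral (s 0 0) (s 0 1) (s 0 2).
  + by rewrite (vecE s) => /pS[_ _ + _]; have [_ _ ->] := vec_pyritohedralT (s 0 0) (s 0 1) (s 0 2).
  + by have [_ _ -> _] := vec_pyritohedral x y (- z); rewrite opprK.
- apply: (@regular_face_orth _ S b N r _ cycle3^T) => // [|s|s|].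
  + exact: orth_tr.
  + by rewrite (vecE s) => /pS1; have [_ _ _ ->] := vec_pyritohedralT (s 0 0) (s 0 1) (s 0 2).
  + rewrite trmxK (vecE s) => /pS[_ _ _ +].
    by have [_ _ _ ->] := vec_pyritohedral (s 0 0) (s 0 1) (s 0 2).
  + by have [_ _ _ ->] := vec_pyritohedralT z x y.
Qed.

Lemma pyritohedral_le S (b : R) : pyritohedral (mem_pred S) ->
  pyritohedral (fun u => forall s, s \in S -> dot u s <= b).
Proof.
move=> pS x y z h; split=> s; rewrite (vecE s); move: (s 0 0) (s 0 1) (s 0 2) => p q t sS;
  have [s1 s2 s3 sc] := pS _ _ _ sS; have [_ _ _ scc] := pS _ _ _ sc; rewrite dot_vec.
- by have := h _ s1; rewrite dot_vec; lra.
- by have := h _ s2; rewrite dot_vec; lra.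
- by have := h _ s3; rewrite dot_vec; lra.
- by have := h _ scc; rewrite dot_vec; lra.
Qed.

(** The hypothesis [dual_face] for a single [u], isolated because it is invariant under the group
    and need only be checked on one octant. *)
Definition tight_dominated S U (b : R) u := (forall s, s \in S -> dot u s <= b) ->
  exists2 d, d \in U & forall s, s \in S -> dot u s = b -> dot d s = b.

Lemma pyritohedral_dominated S U (b : R) : pyritohedral (mem_pred S) ->
  pyritohedral (mem_pred U) -> pyritohedral (tight_dominated S U b).
Proof.
move=> pS pU x y z h; split=> le.
- have [|d dU dt] := h.
    by rewrite -[x]opprK; have [] := pyritohedral_le pS le.
  move: dU dt; rewrite (vecE d) => /pU[dU _ _ _] dt; eexists; first exact: dU.
  move=> s; rewrite (vecE s) => /pS[sS _ _ _] e; have := dt _ sS.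
  by rewrite !dot_vec !mulrN in e *; rewrite !mulNr in e *; apply.
- have [|d dU dt] := h.
    by rewrite -[y]opprK; have [] := pyritohedral_le pS le.
  move: dU dt; rewrite (vecE d) => /pU[_ dU _ _] dt; eexists; first exact: dU.
  move=> s; rewrite (vecE s) => /pS[_ sS _ _] e; have := dt _ sS.
  by rewrite !dot_vec !mulrN in e *; rewrite !mulNr in e *; apply.
- have [|d dU dt] := h.
    by rewrite -[z]opprK; have [] := pyritohedral_le pS le.
  move: dU dt; rewrite (vecE d) => /pU[_ _ dU _] dt; eexists; first exact: dU.
  move=> s; rewrite (vecE s) => /pS[_ _ sS _] e; have := dt _ sS.
  by rewrite !dot_vec !mulrN in e *; rewrite !mulNr in e *; apply.
- have [|d dU dt] := h.
    by have [_ _ _ le1] := pyritohedral_le pS le; have [] := pyritohedral_le pS le1.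
  move: dU dt; rewrite (vecE d) => /pU[_ _ _ dU] dt; eexists; first exact: dU.
  move=> s; rewrite (vecE s) => /pS[_ _ _ /pS[_ _ _ sS]] e; have := dt _ sS.
  have {}e : dot (vec x y z) (vec (s 0 1) (s 0 2) (s 0 0)) = b by rewrite -e !dot_vec; ring.
  by move=> /(_ e) <-; rewrite !dot_vec; ring.
Qed.

Lemma regular_face_seq S (b : R) (N : nat) (r : R) u o (L : seq 'rV[R]_3) :
  let q k := nth 0 L k - o in let c := cos (2 * pi / N%:R) in
  size L = N -> tight S b u = [set` L] -> (3 <= N)%N -> 0 < r ->
  dot (q 0%N) (q 0%N) = r ^+ 2 -> dot (q 1%N) (q 1%N) = r ^+ 2 ->
  dot (q 0%N) (q 1%N) = r ^+ 2 * c ->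
  (forall k, (k.+2 < N)%N -> q k.+2 = (2 * c) *: q k.+1 - q k) ->
  cross (L`_1 - L`_0) (L`_2 - L`_0) != 0 ->
  regular_face S b N r u.
Proof.
move=> q c sL tE N3 r0 q00 q11 q01 rec c0; split.
  exists L`_0, L`_1, L`_2; rewrite tE /=; split=> //; apply: mem_nth; rewrite sL //.
  - by case: (N) N3.
  - by case: (N) N3 => [|[]].
have [e1 [e2 [e12 nE]]] := ngon_of_recurrence o N3 r0 q00 q11 q01 rec.
exists o, e1, e2; split=> //; rewrite -nE tE; congr conv_hull.
apply/seteqP; split=> [x /= xL|_ [k _ <-]].
  have kN : (index x L < N)%N by rewrite -sL index_mem.
  by exists (Ordinal kN) => //=; rewrite /q nth_index // addrC subrK.
by rewrite /q addrC subrK /=; apply: mem_nth; rewrite sL.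
Qed.

End Pyritohedral.

Section DualModels.
Variable R : realType.
Implicit Types (o u v w d s : 'rV[R]_3) (S U : seq 'rV[R]_3) (Q : 'rV[R]_3 -> Prop).
Local Notation f := (golden R).

Lemma octahedron_pyritohedral : pyritohedral (fun u => u \in octahedron_pts R).
Proof.
move=> x y z; each_point => /vec_inj[-> -> ->]; rewrite ?opprK ?oppr0; split; in_list.
Qed.

Lemma cube_pyritohedral : pyritohedral (fun u => u \in cube_pts R).
Proof.
move=> x y z; each_point => /vec_inj[-> -> ->]; rewrite ?opprK ?oppr0; split; in_list.
Qed.

Lemma icosahedron_pyritohedral : pyritohedral (fun u => u \in icosahedron_pts R).
Proof.
move=> x y z; each_point => /vec_inj[-> -> ->]; rewrite ?opprK ?oppr0; split; in_list.
Qed.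

Lemma dodecahedron_pyritohedral : pyritohedral (fun u => u \in dodecahedron_pts R).
Proof.
move=> x y z; each_point => /vec_inj[-> -> ->]; rewrite ?opprB ?opprK ?oppr0; split; in_list.
Qed.

Ltac by_signs fl1 fl2 fl3 := repeat first
  [ assumption | apply: fl1 | apply: fl2 | apply: fl3 ].

Lemma cube_orbit Q : pyritohedral Q -> Q (vec 1 1 1) -> forall u, u \in cube_pts R -> Q u.
Proof.
move=> pQ h.
have fl1 (x y z : R) : Q (vec x y z) -> Q (vec (- x) y z) by case/pQ.
have fl2 (x y z : R) : Q (vec x y z) -> Q (vec x (- y) z) by case/pQ.
have fl3 (x y z : R) : Q (vec x y z) -> Q (vec x y (- z)) by case/pQ.
move=> u; each_point => ->; by_signs fl1 fl2 fl3.
Qed.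

Lemma icosahedron_orbit Q : pyritohedral Q -> Q (vec 0 1 f) ->
  forall u, u \in icosahedron_pts R -> Q u.
Proof.
move=> pQ h.
have fl1 (x y z : R) : Q (vec x y z) -> Q (vec (- x) y z) by case/pQ.
have fl2 (x y z : R) : Q (vec x y z) -> Q (vec x (- y) z) by case/pQ.
have fl3 (x y z : R) : Q (vec x y z) -> Q (vec x y (- z)) by case/pQ.
have [_ _ _ h'] := pQ _ _ _ h; have [_ _ _ h''] := pQ _ _ _ h'.
move=> u; each_point => ->; by_signs fl1 fl2 fl3.
Qed.

Lemma dodecahedron_orbits Q : pyritohedral Q -> Q (vec 1 1 1) -> Q (vec 0 f (f - 1)) ->
  forall u, u \in dodecahedron_pts R -> Q u.
Proof.
move=> pQ h1 h.
have fl1 (x y z : R) : Q (vec x y z) -> Q (vec (- x) y z) by case/pQ.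
have fl2 (x y z : R) : Q (vec x y z) -> Q (vec x (- y) z) by case/pQ.
have fl3 (x y z : R) : Q (vec x y z) -> Q (vec x y (- z)) by case/pQ.
have [_ _ _ h'] := pQ _ _ _ h; have [_ _ _ h''] := pQ _ _ _ h'.
move=> u; each_point => ->; rewrite -?(opprB f 1); by_signs fl1 fl2 fl3.
Qed.

End DualModels.

Section DualFaces.
Variable R : realType.
Implicit Types (o u v w d s : 'rV[R]_3) (S U : seq 'rV[R]_3) (Q : 'rV[R]_3 -> Prop).
Local Notation f := (golden R).

Lemma octahedron_dominated u : tight_dominated (octahedron_pts R) (cube_pts R) 1 u.
Proof.
move: u; apply: pyritohedral_octant.
  apply: pyritohedral_dominated; [exact: octahedron_pyritohedral|exact: cube_pyritohedral].
move=> x y z x0 y0 z0 le; exists (vec 1 1 1); first in_list.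
by move=> s; each_point => ->; rewrite !dot_vec; lra.
Qed.

Let golden_le x : f * x <= f + 1 -> x <= f.
Proof.
have := golden_sqr R; have /andP[f1 f2] := golden_bounds R.
by rewrite expr2 => <-; rewrite ler_pM2l //; lra.
Qed.

Ltac tight_or_absurd e H := first [clear - e; lra | exfalso; lra].

(** In the open octant only the three vertices of the face with normal (1, 1, 1) can be tight,
    because a sign change that raises the value rules out the others. On the wall x = 0 with y > 0
    the face with normal (0, f, f - 1) takes over. *)
Lemma icosahedron_dominated u :
  tight_dominated (icosahedron_pts R) (dodecahedron_pts R) (f + 1) u.
Proof.
have e := golden_sqr R; have /andP[f1 f2] := golden_bounds R.
have f0 : 0 < f by lra.
have pD := pyritohedral_dominated (b := f + 1) (@icosahedron_pyritohedral R)
  (@dodecahedron_pyritohedral R).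
have core1 x y z : 0 < x -> 0 < y -> 0 < z ->
    tight_dominated (icosahedron_pts R) (dodecahedron_pts R) (f + 1) (vec x y z).
  move=> x0 y0 z0 le; exists (vec 1 1 1); first in_list.
  have [le0 {}le] := forall_in_cons le; have [_ {}le] := forall_in_cons le.
  have [le2 {}le] := forall_in_cons le; have [_ {}le] := forall_in_cons le.
  have [le4 {le}_] := forall_in_cons le; rewrite !dot_vec in le0 le2 le4.
  have := mulr_gt0 f0 x0; have := mulr_gt0 f0 y0; have := mulr_gt0 f0 z0 => h1 h2 h3.
  by move=> s; each_point => ->; rewrite !dot_vec => H; tight_or_absurd e H.
have core2 y z : 0 < y -> 0 <= z ->
    tight_dominated (icosahedron_pts R) (dodecahedron_pts R) (f + 1) (vec 0 y z).
  move=> y0 z0 le; exists (vec 0 f (f - 1)); first in_list.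
  have [le0 {}le] := forall_in_cons le; have [_ {}le] := forall_in_cons le.
  have [le2 {}le] := forall_in_cons le; have [_ {}le] := forall_in_cons le.
  have [le4 {le}_] := forall_in_cons le; rewrite !dot_vec in le0 le2 le4.
  have zf : z <= f by apply: golden_le; lra.
  have yf : y <= f by apply: golden_le; lra.
  have := mulr_gt0 f0 y0; have := mulr_ge0 (ltW f0) z0 => h1 h2.
  by move=> s; each_point => ->; rewrite !dot_vec => H; tight_or_absurd e H.
have cyc x y z : tight_dominated (icosahedron_pts R) (dodecahedron_pts R) (f + 1) (vec x y z) ->
    tight_dominated (icosahedron_pts R) (dodecahedron_pts R) (f + 1) (vec z x y).
  by case/pD.
move: u; apply: pyritohedral_octant => // x y z.
rewrite le_eqVlt => /orP[/eqP<-|x0]; rewrite le_eqVlt => /orP[/eqP<-|y0] zge.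
- have [->|z0] := eqVneq z 0; last by apply: (cyc); apply: core2; rewrite // lt0r z0.
  move=> le; exists (vec 1 1 1); first in_list.
  by move=> s; each_point => ->; rewrite !dot_vec => H; tight_or_absurd e H.
- exact: core2.
- have [->|z0] := eqVneq z 0; first by apply: (cyc); apply: (cyc); apply: core2.
  by apply: (cyc); apply: core2; rewrite ?ltW // lt0r z0.
- have [->|z0] := eqVneq z 0; first by apply: (cyc); apply: (cyc); apply: core2; rewrite ?ltW.
  by apply: core1; rewrite // lt0r z0.
Qed.

(** In the open octant the face with normal (0, 1, f) contains every vertex that can be tight except
    (f, f - 1, 0). Up to cyclic permutation, it thus suffices that one of the three vertices of this
    type is not tight. *)
Lemma dodecahedron_dominated u :
  tight_dominated (dodecahedron_pts R) (icosahedron_pts R) (f + 1) u.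
Proof.
have e := golden_sqr R; have /andP[f1 f2] := golden_bounds R.
have f0 : 0 < f by lra.
have g0 : 0 < f - 1 by lra.
have pD := pyritohedral_dominated (b := f + 1) (@dodecahedron_pyritohedral R)
  (@icosahedron_pyritohedral R).
have core1 x y z : 0 < x -> 0 < y -> 0 < z -> f * x + (f - 1) * y < f + 1 ->
    tight_dominated (dodecahedron_pts R) (icosahedron_pts R) (f + 1) (vec x y z).
  move=> x0 y0 z0 lt le; exists (vec 0 1 f); first in_list.
  have [le0 {}le] := forall_in_cons le; have [le1 {}le] := forall_in_cons le.
  have [le2 {}le] := forall_in_cons le; have [le3 {le}_] := forall_in_cons le.
  rewrite !dot_vec in le0 le1 le2 le3.
  have hx := mulr_gt0 f0 x0; have hy := mulr_gt0 f0 y0; have hz := mulr_gt0 f0 z0.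
  have gx := mulr_gt0 g0 x0; have gy := mulr_gt0 g0 y0; have gz := mulr_gt0 g0 z0.
  by move=> s; each_point => ->; rewrite !dot_vec => H; tight_or_absurd e H.
have core2 y z : 0 <= y -> 0 < z ->
    tight_dominated (dodecahedron_pts R) (icosahedron_pts R) (f + 1) (vec 0 y z).
  move=> y0 z0 le; exists (vec 0 1 f); first in_list.
  have [le0 {}le] := forall_in_cons le; have [le1 {}le] := forall_in_cons le.
  have [le2 {}le] := forall_in_cons le; have [le3 {le}_] := forall_in_cons le.
  rewrite !dot_vec in le0 le1 le2 le3.
  have hy := mulr_ge0 (ltW f0) y0; have hz := mulr_gt0 f0 z0.
  have gy := mulr_ge0 (ltW g0) y0; have gz := mulr_gt0 g0 z0.
  have yf : y <= f by apply: golden_le; lra.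
  have zf : z <= f by apply: golden_le; lra.
  have gyf : (f - 1) * y <= (f - 1) * f by rewrite ler_pM2l.
  have gzf : (f - 1) * z <= (f - 1) * f by rewrite ler_pM2l.
  by move=> s; each_point => ->; rewrite !dot_vec => H; tight_or_absurd e H.
have cyc x y z : tight_dominated (dodecahedron_pts R) (icosahedron_pts R) (f + 1) (vec x y z) ->
    tight_dominated (dodecahedron_pts R) (icosahedron_pts R) (f + 1) (vec z x y).
  by case/pD.
move: u; apply: pyritohedral_octant => // x y z xge yge zge.
have [->|xn] := eqVneq x 0.
  have [->|zn] := eqVneq z 0; last by apply: core2; rewrite // lt0r zn.
  have [->|yn] := eqVneq y 0; last by apply: (cyc); apply: (cyc); apply: core2; rewrite // lt0r yn.
  move=> le; exists (vec 0 1 f); first in_list.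
  by move=> s; each_point => ->; rewrite !dot_vec => H; tight_or_absurd e H.
have x0 : 0 < x by rewrite lt0r xn.
have [->|yn] := eqVneq y 0; first by apply: (cyc); apply: core2.
have y0 : 0 < y by rewrite lt0r yn.
have [->|zn] := eqVneq z 0; first by apply: (cyc); apply: (cyc); apply: core2; rewrite ?ltW.
have z0 : 0 < z by rewrite lt0r zn.
have [h|h1] := ltP (f * x + (f - 1) * y) (f + 1); first exact: core1.
have [h|h2] := ltP (f * y + (f - 1) * z) (f + 1); first by apply: (cyc); apply: core1.
have [h|h3] := ltP (f * z + (f - 1) * x) (f + 1); first by apply: (cyc); apply: (cyc); apply: core1.
(* All three being tight, their values sum to (2f - 1)(x + y + z) = 3(f + 1), while the vertex (1,
   1, 1) gives x + y + z <= f + 1; but 2f - 1 < 3. *)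
move=> /(_ (vec 1 1 1) ltac:(in_list)); rewrite dot_vec => h.
have : (2 * f - 1) * (x + y + z) <= (2 * f - 1) * (f + 1) by rewrite ler_pM2l; lra.
lra.
Qed.

End DualFaces.

(** * Facets of the octahedron, icosahedron and dodecahedron *)

Section PlatonicFacets.
Variable R : realType.
Implicit Types (o u v w d s : 'rV[R]_3) (S U : seq 'rV[R]_3).
Local Notation f := (golden R).

Lemma tight_list S (b : R) u (L : seq 'rV[R]_3) :
  (forall s, s \in L -> s \in S) -> (forall s, s \in L -> dot u s = b) ->
  (forall s, s \in S -> dot u s = b -> s \in L) -> tight S b u = [set` L].
Proof.
move=> LS Lb SL; apply/seteqP; split=> s /= h; first by apply: SL; case: h.
by split; [exact: LS | exact: Lb].
Qed.

Let sqr_sqrt (a : R) : 0 < a -> 0 < Num.sqrt a /\ Num.sqrt a ^+ 2 = a.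
Proof. by move=> a0; rewrite sqrtr_gt0 sqr_sqrtr ?ltW. Qed.

Let cross_vec_neq0 (a b c : R) : a ^+ 2 + b ^+ 2 + c ^+ 2 != 0 -> vec a b c != 0.
Proof. by apply: contra_neq; rewrite -vec0 => /vec_inj[-> -> ->]; ring. Qed.

Lemma octahedron_face u : u \in cube_pts R ->
  regular_face (octahedron_pts R) 1 3 (Num.sqrt (2 / 3)) u.
Proof.
have [r0 rE] : 0 < Num.sqrt (2 / 3 : R) /\ Num.sqrt (2 / 3 : R) ^+ 2 = 2 / 3.
  by apply: sqr_sqrt; lra.
apply: cube_orbit; first exact/pyritohedral_face/octahedron_pyritohedral.
apply: (@regular_face_seq _ _ _ _ _ _ (vec (1 / 3) (1 / 3) (1 / 3))
  [:: vec 1 0 0; vec 0 1 0; vec 0 0 1]); rewrite ?cos_2pi3 ?rE //=.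
- apply: tight_list => s; each_point => ->; rewrite ?dot_vec;
    first [in_list | by move=> _; in_list | lra].
- by rewrite !vecL dot_vec; lra.
- by rewrite !vecL dot_vec; lra.
- by rewrite !vecL dot_vec; lra.
- by case=> //= _; rewrite !vecL; apply: vec_eq; lra.
- by rewrite !vecL cross_vec; apply: cross_vec_neq0; apply/eqP; lra.
Qed.

(** The twenty faces form two orbits of the pyritohedral group, hence two computations. The edge
    length is 2, so the squared circumradius of a face is 4/3. *)
Lemma icosahedron_face u : u \in dodecahedron_pts R ->
  regular_face (icosahedron_pts R) (f + 1) 3 (Num.sqrt (4 / 3)) u.
Proof.
have e := golden_sqr R; have /andP[f1 f2] := golden_bounds R.
have [r0 rE] : 0 < Num.sqrt (4 / 3 : R) /\ Num.sqrt (4 / 3 : R) ^+ 2 = 4 / 3.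
  by apply: sqr_sqrt; lra.
apply: dodecahedron_orbits; first exact/pyritohedral_face/icosahedron_pyritohedral.
  apply: (@regular_face_seq _ _ _ _ _ _ (vec ((f + 1) / 3) ((f + 1) / 3) ((f + 1) / 3))
    [:: vec 0 1 f; vec f 0 1; vec 1 f 0]); rewrite ?cos_2pi3 ?rE //=.
  - apply: tight_list => s; each_point => ->; rewrite ?dot_vec;
    first [in_list | by move=> _; in_list | lra].
  - by rewrite !vecL dot_vec; lra.
  - by rewrite !vecL dot_vec; lra.
  - by rewrite !vecL dot_vec; lra.
  - by case=> //= _; rewrite !vecL; apply: vec_eq; lra.
  - by rewrite !vecL cross_vec; apply: cross_vec_neq0; apply/eqP; nra.
apply: (@regular_face_seq _ _ _ _ _ _ (vec 0 ((2 * f + 1) / 3) (f / 3))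
  [:: vec 0 1 f; vec 1 f 0; vec (- 1) f 0]); rewrite ?cos_2pi3 ?rE //=.
- apply: tight_list => s; each_point => ->; rewrite ?dot_vec;
    first [in_list | by move=> _; in_list | lra].
- by rewrite !vecL dot_vec; lra.
- by rewrite !vecL dot_vec; lra.
- by rewrite !vecL dot_vec; lra.
- by case=> //= _; rewrite !vecL; apply: vec_eq; lra.
- by rewrite !vecL cross_vec; apply: cross_vec_neq0; apply/eqP; nra.
Qed.

Lemma cos_2pi5_golden : 2 * cos (2 * pi / 5) = f - 1.
Proof. by apply: golden_unique; have [c0 ce] := cos_2pi5 R; lra. Qed.

Lemma dodecahedron_face u : u \in icosahedron_pts R ->
  regular_face (dodecahedron_pts R) (f + 1) 5 (Num.sqrt ((12 - 4 * f) / 5)) u.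
Proof.
have e := golden_sqr R; have /andP[f1 f2] := golden_bounds R.
(* The squared circumradius of a pentagon: the squared norm 3 of a vertex minus the squared distance
   (4f + 3) / 5 of the face centre from the origin. *)
set a := (12 - 4 * f) / 5; have [r0 rE] : 0 < Num.sqrt a /\ Num.sqrt a ^+ 2 = a.
  by apply: sqr_sqrt; rewrite /a; lra.
have cE : cos (2 * pi / 5) = (f - 1) / 2 by rewrite -cos_2pi5_golden; lra.
apply: icosahedron_orbit; first exact/pyritohedral_face/dodecahedron_pyritohedral.
apply: (@regular_face_seq _ _ _ _ _ _ (vec 0 ((f + 2) / 5) ((3 * f + 1) / 5))
  [:: vec 0 f (f - 1); vec 1 1 1; vec (f - 1) 0 f; vec (1 - f) 0 f; vec (- 1) 1 1]);
  rewrite ?cE ?rE //=.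
- apply: tight_list => s; each_point => ->; rewrite ?dot_vec;
    first [in_list | by move=> _; in_list | lra].
- by rewrite !vecL dot_vec /a; lra.
- by rewrite !vecL dot_vec /a; lra.
- by rewrite !vecL dot_vec /a; lra.
- by move=> [|[|[|//]]] //= _; rewrite !vecL; apply: vec_eq; lra.
- by rewrite !vecL cross_vec; apply: cross_vec_neq0; apply/eqP; nra.
Qed.

Lemma octahedron_dual_le u s : u \in cube_pts R -> s \in octahedron_pts R -> dot u s <= 1.
Proof.
move=> uU; move: s; move: u uU; apply: cube_orbit.
  exact/pyritohedral_le/octahedron_pyritohedral.
by move=> s; each_point => ->; rewrite dot_vec; lra.
Qed.

Lemma icosahedron_dual_le u s : u \in dodecahedron_pts R -> s \in icosahedron_pts R ->
  dot u s <= f + 1.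
Proof.
have e := golden_sqr R; have /andP[f1 f2] := golden_bounds R.
move=> uU; move: s; move: u uU; apply: dodecahedron_orbits.
- exact/pyritohedral_le/icosahedron_pyritohedral.
- by move=> s; each_point => ->; rewrite dot_vec; lra.
- by move=> s; each_point => ->; rewrite dot_vec; lra.
Qed.

(* The points are sorted by the values of a linear form that separates them. *)
Let uniq_sorted (s t : seq 'rV[R]_3) :
  sorted (fun u v => dot (vec 1 10 100) u < dot (vec 1 10 100) v) t ->
  (forall u, u \in t -> u \in s) -> (size s <= size t)%N -> uniq s.
Proof.
move=> st ts sz; apply: (leq_size_uniq _ ts sz).
apply: (sorted_uniq _ _ st) => [v u w|u]; [exact: lt_trans | exact: ltxx].
Qed.

Ltac increasing := rewrite /= ?dot_vec; repeat (apply/andP; split => //); lra.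

Lemma cube_uniq : uniq (cube_pts R).
Proof.
apply: (@uniq_sorted _
  [:: vec (- 1) (- 1) (- 1); vec 1 (- 1) (- 1); vec (- 1) 1 (- 1); vec 1 1 (- 1);
      vec (- 1) (- 1) 1; vec 1 (- 1) 1; vec (- 1) 1 1; vec 1 1 1]);
  [increasing | by move=> u; each_point => ->; in_list | by []].
Qed.

Lemma icosahedron_uniq : uniq (icosahedron_pts R).
Proof.
have /andP[f1 f2] := golden_bounds R.
apply: (@uniq_sorted _
  [:: vec 0 (- 1) (- f); vec 0 1 (- f); vec (- f) 0 (- 1); vec f 0 (- 1);
      vec (- 1) (- f) 0; vec 1 (- f) 0; vec (- 1) f 0; vec 1 f 0; vec (- f) 0 1;
      vec f 0 1; vec 0 (- 1) f; vec 0 1 f]);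
  [increasing | by move=> u; each_point => ->; in_list | by []].
Qed.

Lemma dodecahedron_uniq : uniq (dodecahedron_pts R).
Proof.
have e := golden_sqr R; have /andP[f1 f2] := golden_bounds R.
(* Putting (1, 1, -1) before (0, -f, 1 - f) needs 110 f < 189, which the bound 7/4 does not give. *)
have f3 : f < 13 / 8 by rewrite ltNge; apply/negP => f3; nra.
apply: (@uniq_sorted _
  [:: vec (1 - f) 0 (- f); vec (f - 1) 0 (- f); vec (- 1) (- 1) (- 1);
      vec 1 (- 1) (- 1); vec (- 1) 1 (- 1); vec 1 1 (- 1); vec 0 (- f) (1 - f);
      vec 0 f (1 - f); vec (- f) (1 - f) 0; vec f (1 - f) 0; vec (- f) (f - 1) 0;
      vec f (f - 1) 0; vec 0 (- f) (f - 1); vec 0 f (f - 1); vec (- 1) (- 1) 1;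
      vec 1 (- 1) 1; vec (- 1) 1 1; vec 1 1 1; vec (1 - f) 0 f; vec (f - 1) 0 f]);
  [increasing | by move=> u; each_point => ->; in_list | by []].
Qed.

Variables (P : set 'rV[R]_3) (W : seq 'rV[R]_3) (o : 'rV[R]_3) (k : R).
Hypotheses (k0 : 0 < k) (PE : P = conv_hull (vertices P))
  (VE : vertices P = [set o + k *: w | w in [set` W]]).
Hypotheses (nP : nondegenerate_polyhedron P) (hP : homogeneous P).

Lemma octahedron_case : modelled W (octahedron_pts R) -> regular_octahedron P.
Proof.
move=> mW; have [F [l [oF l0 _ PE']]] := modelled_polytope k0 mW PE VE.
have pS := @octahedron_pyritohedral R.
have sS : vec 1 0 0 \in octahedron_pts R by in_list.
have r0 : 0 < Num.sqrt (2 / 3 : R) by rewrite sqrtr_gt0; lra.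
apply: (dual_regular ltr01 (leqnn 3) r0 cube_uniq _ (pyritohedral_opp pS) _
  octahedron_dual_le _ octahedron_face oF l0 PE' nP hP) => //.
- exact: (pyritohedral_span pS sS (oner_neq0 _)).
- by move=> u; apply: octahedron_dominated.
Qed.

Lemma icosahedron_case : modelled W (icosahedron_pts R) -> regular_icosahedron P.
Proof.
move=> mW; have [F [l [oF l0 _ PE']]] := modelled_polytope k0 mW PE VE.
have /andP[f1 f2] := golden_bounds R.
have pS := @icosahedron_pyritohedral R.
have sS : vec 1 f 0 \in icosahedron_pts R by in_list.
have r0 : 0 < Num.sqrt (4 / 3 : R) by rewrite sqrtr_gt0; lra.
have b0 : 0 < f + 1 by lra.
apply: (dual_regular b0 (leqnn 3) r0 dodecahedron_uniq _ (pyritohedral_opp pS) _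
  icosahedron_dual_le _ icosahedron_face oF l0 PE' nP hP) => //.
- exact: (pyritohedral_span pS sS (oner_neq0 _)).
- by move=> u; apply: icosahedron_dominated.
Qed.

Lemma dodecahedron_case : modelled W (dodecahedron_pts R) -> regular_dodecahedron P.
Proof.
move=> mW; have [F [l [oF l0 _ PE']]] := modelled_polytope k0 mW PE VE.
have /andP[f1 f2] := golden_bounds R.
have pS := @dodecahedron_pyritohedral R.
have sS : vec 1 1 1 \in dodecahedron_pts R by in_list.
have r0 : 0 < Num.sqrt ((12 - 4 * f) / 5) by rewrite sqrtr_gt0; lra.
have b0 : 0 < f + 1 by lra.
apply: (dual_regular b0 (isT : (3 <= 5)%N) r0 icosahedron_uniq _ (pyritohedral_opp pS) _
  _ _ dodecahedron_face oF l0 PE' nP hP) => //.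
- exact: (pyritohedral_span pS sS (oner_neq0 _)).
- by move=> u s uI sD; rewrite dotC; apply: icosahedron_dual_le.
- by move=> u; apply: dodecahedron_dominated.
Qed.

End PlatonicFacets.

(** * Distribution of the configurations over the six families *)

Theorem theorem5 (R : realType) (P : set 'rV[R]_3)
    (hP : nondegenerate_polyhedron P) (h2 : point_homogeneous 2 P) :
  (regular_tetrahedron P \/ cube P \/ regular_octahedron P \/
     regular_dodecahedron P \/ regular_icosahedron P) \/
  cuboctahedron P \/
  (tetrahedron P /\ homogeneous P /\
     (forall F G, facet P F -> facet P G -> isometric F G) /\
     (forall F, facet P F -> acute_triangle F)) \/
  (exists (n : nat) (B0 B1 : set 'rV[R]_3),
     (3 <= n)%N /\ right_prism n P B0 B1 /\ base_distances_disjoint P B0 B1) \/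
  (exists (n : nat) (B0 B1 : set 'rV[R]_3),
     (2 <= n)%N /\ right_antiprism n P B0 B1 /\
     base_distances_disjoint P B0 B1) \/
  (exists a b c : R,
     a <= b /\ b <= c /\ a ^+ 2 + b ^+ 2 != c ^+ 2 /\
     rectangular_parallelepiped a b c P).
Proof.
have [W [z [k [hW k0 [PE VE]]]]] := polyhedron_config hP h2.
have hP1 := homogeneous2 h2.
have [h|h] := pselect (exists v q, [/\ v \in W, forall t, q != t *: v &
    forall A, symmetry_of W A -> v *m A = v -> q *m A = q]).
  have [v [q [vW qv qfix]]] := h; have [a aa ha] := reducible hW vW qv qfix.
  have [W4|[[F [n [r [t [phi [oF n3 [r0 t0] phiE [tn haF]]]]]]]|]] := reducible_classification hW aa ha.
  - by do 2!right; left; apply: (tetrahedron_case hW k0 PE VE W4 h2).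
  - case: phiE => phiE; do 3!right.
      by left; apply: (prism_case hW k0 PE VE oF n3 r0 t0 tn haF phiE).
    by right; left; apply: (antiprism_case hW k0 PE VE oF n3 r0 t0 tn haF phiE).
  - move=> [X [Y [Z [X0 Y0 Z0 ne m]]]].
    by do 5!right; apply: (box_case k0 PE VE X0 Y0 Z0 ne m).
have irr v q : v \in W -> (forall A, symmetry_of W A -> v *m A = v -> q *m A = q) ->
    exists t, q = t *: v.
  move=> vW qfix; apply: contrapT => nt; apply: h; exists v, q; split=> // t.
  by apply/eqP => qt; apply: nt; exists t.
have [c hc] := exists_min_dot hW.
have [W4|[m|[m|[m|[m|m]]]]] := irreducible_classification hW hc irr.
(* The regular tetrahedron is covered by the homogeneous ones. *)
- by do 2!right; left; apply: (tetrahedron_case hW k0 PE VE W4 h2).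
(* The cube is delivered as the box of half-sides 1, for which the condition on the sides reads 1 +
   1 != 1. *)
- do 5!right; apply: (box_case k0 PE VE ltr01 ltr01 ltr01 _ m).
  have ne : 1 ^+ 2 + 1 ^+ 2 != 1 ^+ 2 :> R by apply/eqP; lra.
  by split.
- by left; do 2!right; left; apply: (octahedron_case k0 PE VE hP hP1 m).
- by left; do 4!right; apply: (icosahedron_case k0 PE VE hP hP1 m).
- by left; do 3!right; left; apply: (dodecahedron_case k0 PE VE hP hP1 m).
- have [F [l [oF l0 _ PE']]] := modelled_polytope k0 m PE VE.
  by right; left; apply: (cuboctahedron_case oF l0 PE').
Qed.
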